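(* Let $G$ be a graph of maximum degree $\Delta$ in which, for each vertex $u$, every clique containing $u$ has at most $\omega_u$ vertices, where $\omega_u\ge3$ is an integer, and let $\omega=\max_u\omega_u$. (1) For every fixed $\lambda>0$, as $\Delta\to\infty$, \[ \frac{1}{|V(G)|}\frac{\lambda Z_G'(\lambda)}{Z_G(\lambda)}\ \ge\ (1-o(1))\max\Bigl\{\frac{\log\Delta}{(\omega-2)\Delta\log\log\Delta},\ \frac{1}{2\Delta}\sqrt{\frac{\log\Delta}{\log(\omega-1)}}\Bigr\}, \] where the $o(1)$ term depends only on $\lambda$ and $\Delta$. (2) For any $\varepsilon>0$ there exists $\delta_0$ (depending only on $\varepsilon$) such that $G$ has a fractional colouring in which each $u$ is coloured with a subset of the smaller of the two intervals \[ \Bigl[0,(1+\varepsilon)\max\Bigl\{(\omega_u-2)\frac{\deg(u)\log\log\deg(u)}{\log\deg(u)},\ (\omega_u-2)\frac{\delta_0\log\log\delta_0}{\log\delta_0}\Bigr\}\Bigr), \] \[ \Bigl[0,(1+\varepsilon)\max\Bigl\{2\deg(u)\sqrt{\frac{\log(\omega_u-1)}{\log\deg(u)}},\ 2\delta_0\sqrt{\frac{\log(\omega_u-1)}{\log\delta_0}}\Bigr\}\Bigr). \] In particular $\chi_f(G)\le(1+o(1))\min\bigl\{(\omega-2)\frac{\Delta\log\log\Delta}{\log\Delta},\ 2\Delta\sqrt{\log(\omega-1)/\log\Delta}\bigr\}$ as $\Delta\to\infty$. (3) For any $\varepsilon>0$ there exist $\delta_0,\Delta_0$ (depending only on $\varepsilon$)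 such that the following holds for all $\Delta\ge\Delta_0$, with $\delta=\delta_0k$ and \[ k=\min\Bigl\{\bigl(e^2\log(8\Delta^4)\bigr)^{\omega-1},\ \exp\Bigl(\sqrt{4\log(\omega-1)\cdot(1+\varepsilon)\log(8\Delta^4)}\Bigr)\Bigr\}. \] If $\mathscr H=(L,H)$ is a cover of $G$ such that, for each $u$, $|L(u)|$ is at least the smaller of \[ (1+\varepsilon)\max\Bigl\{(\omega_u-2)\frac{\deg(u)\log\log(\deg(u)/k)}{\log(\deg(u)/k)},\ (\omega_u-2)\frac{\delta\log\log(\delta/k)}{\log(\delta/k)}\Bigr\} \] and \[ (1+\varepsilon)\max\Bigl\{2\deg(u)\sqrt{\frac{\log(\omega_u-1)}{\log(\deg(u)/k)}},\ 2\delta\sqrt{\frac{\log(\omega_u-1)}{\log(\delta/k)}}\Bigr\}, \] then $G$ is $\mathscr H$-colourable. In particular \[ \chi_c(G)\le(1+o(1))\min\Bigl\{(\omega-2)\frac{\Delta\log\log\Delta}{\log\Delta},\ 5\Delta\sqrt{\frac{\log(\omega-1)}{\log\Delta}}\Bigr\}\quad\text{as }\Delta\to\infty. \]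
   Context: All graphs are finite and simple; $\log$ is the natural logarithm. $Z_G(\lambda)=\sum_I\lambda^{|I|}$ over independent sets of $G$ (including $\varnothing$), $Z_G'$ its derivative. A fractional colouring of $G$ is an assignment $w$ of pairwise disjoint measurable subsets of $[0,\infty)$ to the independent sets of $G$ with $\sum_{I\ni v}|w(I)|=1$ for every vertex $v$; vertex $v$ is coloured with $c(v)=\bigcup_{I\ni v}w(I)$. $\chi_f(G)$ is the least $k$ for which a fractional colouring with all $w(I)\subseteq[0,k)$ exists. A cover of $G$ is a pair $\mathscr H=(L,H)$ where $H$ is a graph and $L:V(G)\to 2^{V(H)}$ is such that: the sets $L(u)$ partition $V(H)$; each $H[L(u)]$ is complete; edges of $H$ between $L(u)$ and $L(v)$, $u\ne v$, exist only if $uv\in E(G)$; and for $uv\in E(G)$ these edges form a matching. An $\mathscr H$-colouring is an independent set of $H$ of size $|V(G)|$. $\chi_c(G)$ is the least $k$ such that $G$ has an $\mathscr H$-colouring for every cover with $|L(u)|=k$ for all $u$. *)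

(* Defs.v *)
From mathcomp Require Import all_boot.
From Stdlib Require Import Reals.

Set Implicit Arguments.
Unset Strict Implicit.
Unset Printing Implicit Defensive.

Definition simple_graph (V : finType) (adj : rel V) : Prop :=
  (forall x y, adj x y = adj y x) /\ (forall x, adj x x = false).

Definition independent (V : finType) (adj : rel V) (S : {set V}) : bool :=
  [forall x in S, forall y in S, ~~ adj x y].

Definition clique (V : finType) (adj : rel V) (S : {set V}) : bool :=
  [forall x in S, forall y in S, (x != y) ==> adj x y].

Definition deg (V : finType) (adj : rel V) (u : V) : nat := #|[set v | adj u v]|.

Definition maxdeg (V : finType) (adj : rel V) : nat := (\max_(u : V) deg adj u)%N.

Definition clique_bounded (V : finType) (adj : rel V) (om : V -> nat) : Prop :=
  (forall u, 3 <= om u)%N /\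
  (forall (u : V) (S : {set V}), u \in S -> clique adj S -> (#|S| <= om u)%N).

Definition omega_max (V : finType) (om : V -> nat) : nat := (\max_(u : V) om u)%N.

Open Scope R_scope.

Definition ZG (V : finType) (adj : rel V) (lam : R) : R :=
  \big[Rplus/0]_(I : {set V} | independent adj I) lam ^ #|I|.

Definition ZG' (V : finType) (adj : rel V) (lam : R) : R :=
  \big[Rplus/0]_(I : {set V} | independent adj I) (INR #|I| * lam ^ (#|I| - 1)).

(* Fractional colourings.  Each independent set I receives a finite
   union of half-open intervals [a,b) of [0,oo), given as a list of
   pairs (a,b); its measure is the sum of the lengths. *)
Definition in_ivs (s : list (R * R)) (x : R) : Prop :=
  exists p, List.In p s /\ fst p <= x < snd p.

Definition ivs_len (s : list (R * R)) : R :=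
  List.fold_right (fun p acc => (snd p - fst p) + acc) 0 s.

Definition ivs_wf (s : list (R * R)) : Prop :=
  (forall p, List.In p s -> 0 <= fst p <= snd p) /\
  (forall i j, (i < length s)%nat -> (j < length s)%nat -> i <> j ->
     forall x, ~ (in_ivs (List.nth i s (0,0) :: nil) x /\
                  in_ivs (List.nth j s (0,0) :: nil) x)).

Definition frac_colouring (V : finType) (adj : rel V)
    (w : {set V} -> list (R * R)) : Prop :=
  (forall I, ~~ independent adj I -> w I = nil) /\
  (forall I, ivs_wf (w I)) /\
  (forall I J, I <> J -> forall x, ~ (in_ivs (w I) x /\ in_ivs (w J) x)) /\
  (forall v : V, \big[Rplus/0]_(I : {set V} | v \in I) ivs_len (w I) = 1).

Definition colour_of (V : finType) (w : {set V} -> list (R * R)) (v : V) (x : R) : Prop :=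
  exists I : {set V}, v \in I /\ in_ivs (w I) x.

Definition frac_k_colourable (V : finType) (adj : rel V) (k : R) : Prop :=
  exists w, frac_colouring adj w /\ forall I x, in_ivs (w I) x -> x < k.

Definition is_chi_f (V : finType) (adj : rel V) (r : R) : Prop :=
  frac_k_colourable adj r /\ forall k, frac_k_colourable adj k -> r <= k.

Definition is_cover (V : finType) (adj : rel V)
    (W : finType) (hadj : rel W) (L : V -> {set W}) : Prop :=
  simple_graph hadj /\
  (forall x : W, exists u, x \in L u) /\
  (forall u v, u <> v -> [disjoint L u & L v]) /\
  (forall u x y, x \in L u -> y \in L u -> x <> y -> hadj x y) /\
  (forall u v x y, u <> v -> x \in L u -> y \in L v -> hadj x y -> adj u v) /\
  (forall u v x y y', adj u v -> x \in L u -> y \in L v -> y' \in L v ->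
      hadj x y -> hadj x y' -> y = y').

Definition cover_colourable (V : finType) (W : finType) (hadj : rel W) : Prop :=
  exists S : {set W}, independent hadj S /\ #|S| = #|V|.

Definition all_k_covers_colourable (V : finType) (adj : rel V) (k : nat) : Prop :=
  forall (W : finType) (hadj : rel W) (L : V -> {set W}),
    is_cover adj hadj L -> (forall u, #|L u| = k) -> cover_colourable V hadj.

Definition is_chi_c (V : finType) (adj : rel V) (k : nat) : Prop :=
  all_k_covers_colourable adj k /\
  forall k', all_k_covers_colourable adj k' -> (k <= k')%nat.

Definition bound1 (D om : R) : R :=
  Rmax (ln D / ((om - 2) * D * ln (ln D)))
       (1 / (2 * D) * sqrt (ln D / ln (om - 1))).

Definition fA (om d : R) : R := (om - 2) * (d * ln (ln d) / ln d).
Definition fB (om d : R) : R := 2 * d * sqrt (ln (om - 1) / ln d).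

Definition gA (om d k : R) : R := (om - 2) * (d * ln (ln (d / k)) / ln (d / k)).
Definition gB (om d k : R) : R := 2 * d * sqrt (ln (om - 1) / ln (d / k)).

Definition kpar (eps D : R) (om : nat) : R :=
  Rmin ((exp 2 * ln (8 * D ^ 4)) ^ (om - 1)%nat)
       (exp (sqrt (4 * ln (INR om - 1) * ((1 + eps) * ln (8 * D ^ 4))))).

(* Main.v *)
(** Everything rests on one dichotomy.  Let [F] be a graph of clique number at most [r] with
    hard-core partition function [Z], and let [t] be [log D / ((r-1) log log D)] or
    [sqrt (log D / log r) / 2].  Rankin's trick bounds the weight of the independent sets with fewer
    than [(1-eps) t] vertices; if that bound is not below [eps D / log D] then [F] has many vertices,
    so [Z] is large by Ramsey's theorem (first [t]) or by a greedy count of independent sets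
    (second [t]), and these small sets carry at most a fraction [eps] of [Z].  So a neighbourhood
    either has small partition function or its random independent sets typically have at least
    about [t] vertices.

    Applied to the neighbourhood of [u] this gives [beta P(u in I) + gamma E|I /\ N(u)| >= 1] for the
    hard-core model on every induced subgraph, with [beta + gamma d <= (1+eps) d / t].  Summing over
    [u] yields (1), and repeatedly colouring the unsaturated vertices according to the hard-core
    measure yields (2).

    For (3), take a uniformly random independent set [I] of the cover, restricted to the vertices
    with at most [deg u] colours (the others are coloured greedily at the end).  Given [I] outside
    the lists of [N(u)], the same dichotomy shows that [u], if uncoloured, very likely keeps many
    colours: at most [deg u / t] of its colours can meet [I] in [t] vertices or more, and a further
    colour survives with conditional probability at least [1 / Z].  A surviving colour rarely has [k]
    surviving neighbours, because an independent set of a graph on [k] vertices is rarely empty.  The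
    lopsided local lemma makes this hold for all [u], and a second application of it completes the
    colouring.  The counting bound is stronger than needed by a factor close to [2] in [log Z], which
    leaves room in the definition of [k]. *)
Require Import Defs.
From HB Require Import structures.
From mathcomp Require Import all_boot.
From Stdlib Require Import Reals Lra Lia.
From mathcomp Require Import zify.
Set Implicit Arguments.
Unset Strict Implicit.
Unset Printing Implicit Defensive.
Open Scope R_scope.

(** * Sums over independent sets *)

(** The threshold [eps D / log D] is what the argument can afford. Both rates satisfy [t <= log D],
    so an error of that order is an [eps] fraction of the target [D / t]; in (1) and (2) it goes
    into the coefficient [beta]. In (3) the dichotomy is used at [D = d / k]. Given that fewer than
    [t] neighbours of a colour are chosen, none is chosen with conditional probability one over the
    weight of the small sets. In the first case of the dichotomy this is at least
    [k log (d/k) / (eps d)], so a list of at least [d / log (d/k)] colours keeps of order [k / eps]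
    of them. This outnumbers the roughly [k] surviving neighbours allowed to each colour by the
    constant factor that independent transversals require, which is why [d / k] replaces [d] inside
    the logarithms. The local statements are about arbitrary subsets of a neighbourhood, because
    nothing is known about what stays available once the rest of the random set is fixed. *)

HB.instance Definition _ := Monoid.isComLaw.Build R 0 Rplus
  (fun x y z => esym (Rplus_assoc x y z)) Rplus_comm Rplus_0_l.
HB.instance Definition _ := Monoid.isComLaw.Build R 1 Rmult
  (fun x y z => esym (Rmult_assoc x y z)) Rmult_comm Rmult_1_l.
HB.instance Definition _ := Monoid.isMulLaw.Build R 0 Rmult Rmult_0_l Rmult_0_r.
HB.instance Definition _ :=
  Monoid.isAddLaw.Build R Rmult Rplus Rmult_plus_distr_r Rmult_plus_distr_l.

Lemma Rsum_le (I : Type) (s : seq I) (P : pred I) (F G : I -> R) :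
  (forall i, P i -> F i <= G i) ->
  \big[Rplus/0]_(i <- s | P i) F i <= \big[Rplus/0]_(i <- s | P i) G i.
Proof.
move=> h; elim/big_ind2: _ => //; first lra.
by move=> *; apply: Rplus_le_compat.
Qed.

Lemma Rsum_ge0 (I : Type) (s : seq I) (P : pred I) (F : I -> R) :
  (forall i, P i -> 0 <= F i) -> 0 <= \big[Rplus/0]_(i <- s | P i) F i.
Proof. by move=> h; elim/big_ind: _ => //; [lra | move=> *; lra]. Qed.

Lemma Rsum_subset (I : finType) (P Q : pred I) (F : I -> R) :
  (forall i, Q i -> 0 <= F i) -> (forall i, P i -> Q i) ->
  \big[Rplus/0]_(i | P i) F i <= \big[Rplus/0]_(i | Q i) F i.
Proof.
move=> F0 PQ; rewrite big_mkcond [X in _ <= X]big_mkcond.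
apply: Rsum_le => i _; case: ifP => [/PQ -> | _]; first lra.
by case: ifP => [/F0 | _]; lra.
Qed.

Lemma Rsum_ge_term (I : finType) (P : pred I) (F : I -> R) i :
  (forall j, P j -> 0 <= F j) -> P i -> F i <= \big[Rplus/0]_(j | P j) F j.
Proof.
move=> F0 Pi; rewrite (bigD1 i) //=.
have := @Rsum_ge0 I (index_enum I) (fun j => P j && (j != i)) F _.
by move=> h; have := h (fun j hj => F0 j (proj1 (andP hj))); lra.
Qed.

Lemma Rsum_const (I : finType) (P : pred I) (c : R) :
  \big[Rplus/0]_(i | P i) c = INR #|[pred i | P i]| * c.
Proof.
rewrite -sum1_card; elim/big_ind2: _ => //=; first lra.
- by move=> x n y m -> ->; rewrite plus_INR; lra.
- by move=> *; lra.
Qed.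

Lemma INR_leq (m n : nat) : (m <= n)%nat -> INR m <= INR n.
Proof. by move=> h; apply: le_INR; lia. Qed.

Lemma INR_ltn (m n : nat) : (m < n)%nat -> INR m < INR n.
Proof. by move=> h; apply: lt_INR; lia. Qed.

Lemma leq_INR (m n : nat) : INR m <= INR n -> (m <= n)%nat.
Proof. by move=> h; have := INR_le _ _ h; lia. Qed.

Lemma INR_sum (I : finType) (P : pred I) (F : I -> nat) :
  INR (\sum_(i | P i) F i) = \big[Rplus/0]_(i | P i) INR (F i).
Proof. by elim/big_ind2: _ => //= x n y m <- <-; rewrite plus_INR. Qed.

Lemma Rprod_const (I : finType) (P : pred I) (c : R) :
  \big[Rmult/1]_(i | P i) c = c ^ #|[pred i | P i]|.
Proof.
rewrite -sum1_card; elim/big_ind2: _ => //=; last by move=> *; lra.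
by move=> x n y m -> ->; rewrite pow_add.
Qed.

(** Expand the product over all [i] of [[i in A] * y + 1]: a set not inside [A] contributes a zero
    factor. *)
Lemma Rsum_pow_card (T : finType) (A : {set T}) (y : R) :
  \big[Rplus/0]_(J : {set T} | J \subset A) y ^ #|J| = (1 + y) ^ #|A|.
Proof.
have := @bigA_distr R 0 1 Rmult Rplus T (fun i => if i \in A then y else 0)
  (fun _ : T => 1).
rewrite (bigID (mem A)) /= (eq_bigr (fun=> 1 + y)); last by move=> i ->; lra.
rewrite Rprod_const [X in _ * X]big1; last by move=> i /negPf ->; lra.
rewrite Rmult_1_r => ->; rewrite [RHS](bigID (fun J : {set T} => J \subset A)) /=.
rewrite [X in _ = _ + X]big1 ?Rplus_0_r; last first.
  move=> J /subsetPn[x xJ /negPf xA]; rewrite (bigD1 x) //= xJ xA; lra.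
apply: eq_bigr => J sJA.
rewrite (bigID (mem J)) /= (eq_bigr (fun=> y)); last by move=> i iJ; rewrite iJ (subsetP sJA).
rewrite Rprod_const [X in _ * X]big1; last by move=> i /negPf ->.
by rewrite Rmult_1_r; congr (_ ^ _); apply: eq_card.
Qed.

Lemma ln_mono x y : 0 < x -> x <= y -> ln x <= ln y.
Proof.
by move=> x0 [xy|<-]; [apply/Rlt_le/ln_increasing | apply: Rle_refl].
Qed.

Lemma exp_mono x y : x <= y -> exp x <= exp y.
Proof. by move=> [xy|->]; [apply/Rlt_le/exp_increasing | apply: Rle_refl]. Qed.

Lemma leq_card_cup (I T : finType) (P : pred I) (F : I -> {set T}) :
  (#|\bigcup_(i | P i) F i| <= \sum_(i | P i) #|F i|)%nat.
Proof.
elim/big_ind2: _ => [|A m B n hA hB|//]; first by rewrite cards0.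
by rewrite cardsU; apply: leq_trans (leq_subr _ _) (leq_add hA hB).
Qed.

Section Graph.
Variables (V : finType) (adj : rel V).

Lemma indepP (S : {set V}) :
  reflect (forall x y, x \in S -> y \in S -> ~~ adj x y) (independent adj S).
Proof.
apply: (iffP idP) => [/forall_inP h x y /h /forall_inP h' /h' // | h].
by apply/forall_inP => x xS; apply/forall_inP => y yS; apply: h.
Qed.

Lemma cliqueP (S : {set V}) :
  reflect (forall x y, x \in S -> y \in S -> x != y -> adj x y) (clique adj S).
Proof.
apply: (iffP idP) => [/forall_inP h x y /h /forall_inP h' /h' /implyP // | h].
by apply/forall_inP => x xS; apply/forall_inP => y yS; apply/implyP; apply: h.
Qed.

Lemma indep_sub (S T : {set V}) :
  S \subset T -> independent adj T -> independent adj S.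
Proof.
move=> /subsetP sST /indepP h; apply/indepP => x y /sST xT /sST yT; exact: h.
Qed.

Lemma indep0 : independent adj set0.
Proof. by apply/indepP => x y; rewrite inE. Qed.

Definition avail (X J : {set V}) := [set v in X | [forall w in J, ~~ adj v w]].

Lemma availP (X J : {set V}) v :
  reflect (v \in X /\ forall w, w \in J -> ~~ adj v w) (v \in avail X J).
Proof. by rewrite inE; apply: (iffP andP) => -[vX /forall_inP]. Qed.

Definition Zs (lam : R) (A : {set V}) : R :=
  \big[Rplus/0]_(I : {set V} | (I \subset A) && independent adj I) lam ^ #|I|.

Definition Zlt (lam : R) (tau : nat) (A : {set V}) : R :=
  \big[Rplus/0]_(I : {set V} | (I \subset A) && independent adj I && (#|I| < tau)%nat)
    lam ^ #|I|.

Definition omega_le (r : nat) (A : {set V}) :=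
  forall S : {set V}, S \subset A -> clique adj S -> (#|S| <= r)%nat.

Lemma omega_le_sub r (A B : {set V}) : A \subset B -> omega_le r B -> omega_le r A.
Proof. by move=> sAB h S sSA; apply: h; apply: subset_trans sSA sAB. Qed.

Hypothesis adj_sym : forall x y, adj x y = adj y x.
Hypothesis adj_irr : forall x, adj x x = false.

Lemma indepU (J T : {set V}) :
  independent adj (J :|: T) =
  [&& independent adj J, independent adj T & T \subset avail T J].
Proof.
apply/indepP/and3P => [h | [/indepP hJ /indepP hT /subsetP hJT] x y].
- split; [apply/indepP => x y xJ yJ | apply/indepP => x y xT yT | apply/subsetP => x xT].
  + by apply: h; rewrite inE ?xJ ?yJ.
  + by apply: h; rewrite inE ?xT ?yT orbT.
  + by apply/availP; split=> // w wJ; apply: h; rewrite inE ?xT ?wJ ?orbT.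
- rewrite !inE => /orP[xJ|xT] /orP[yJ|yT]; first exact: hJ; last exact: hT.
  + by rewrite adj_sym; have /availP[_] := hJT _ yT; apply.
  + by have /availP[_] := hJT _ xT; apply.
Qed.

(* Spatial Markov property: an independent set is revealed first outside [B], then inside. *)
Lemma indep_sum_split (S : Type) (idx : S) (op : Monoid.com_law idx)
    (A B : {set V}) (f : {set V} -> S) :
  \big[op/idx]_(I : {set V} | (I \subset A) && independent adj I) f I =
  \big[op/idx]_(J : {set V} | (J \subset A :\: B) && independent adj J)
    \big[op/idx]_(T : {set V} | (T \subset avail (A :&: B) J) && independent adj T)
      f (J :|: T).
Proof.
rewrite (partition_big (fun I => I :\: B)
   (fun J => (J \subset A :\: B) && independent adj J)); last first.
  move=> I /andP[sIA iI]; rewrite setSD //=.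
  by apply: indep_sub iI; apply: subsetDl.
apply: eq_bigr => J /andP[sJ iJ].
rewrite (reindex_onto (fun T => J :|: T) (fun I => I :&: B)); last first.
  by move=> I /andP[_ /eqP <-]; rewrite setUC setID.
apply: eq_bigl => T; rewrite indepU iJ /=.
move: sJ; rewrite subsetD => /andP[sJA dJB].
have JB0 : J :&: B = set0 by apply/eqP; rewrite setI_eq0.
have JDB : J :\: B = J by apply/setDidPl.
rewrite setDUl JDB setIUl JB0 set0U.
apply/idP/idP.
- case/andP => /andP[/andP[sA /andP[iT sav]] _] /eqP TB; rewrite iT andbT.
  apply/subsetP => x xT; have /availP[_ hx] := subsetP sav _ xT.
  apply/availP; split=> //; rewrite inE (subsetP sA) ?inE ?xT ?orbT //=.
  by move: xT; rewrite -TB inE => /andP[].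
- case/andP => /subsetP sT iT.
  have sTB : T \subset B by apply/subsetP => x /sT /availP[]; rewrite inE => /andP[].
  have sTA : T \subset A by apply/subsetP => x /sT /availP[]; rewrite inE => /andP[].
  rewrite subUset sJA sTA iT /=; apply/andP; split; last by rewrite (setIidPl sTB).
  apply/andP; split.
    by apply/subsetP => x xT; apply/availP; split=> //; have /availP[] := sT _ xT.
  have -> : T :\: B = set0 by apply/eqP; rewrite setD_eq0.
  by rewrite setU0.
Qed.

Lemma Zs_ge1 lam A : 0 <= lam -> 1 <= Zs lam A.
Proof.
move=> l0; have e : 1 = lam ^ #|(set0 : {set V})| by rewrite cards0.
rewrite [X in X <= _]e.
apply: (Rsum_ge_term (F := fun I : {set V} => lam ^ #|I|)).
  by move=> *; apply: pow_le.
by rewrite sub0set indep0.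
Qed.

Lemma Zlt1 lam A : Zlt lam 1 A = 1.
Proof.
rewrite /Zlt (big_pred1 set0) ?cards0 // => I /=.
rewrite ltnS leqn0 cards_eq0; case: eqP => [->|]; rewrite ?andbF //.
by rewrite sub0set indep0.
Qed.

Lemma Zs_ge_indep lam (A I : {set V}) : 0 <= lam ->
  I \subset A -> independent adj I -> (1 + lam) ^ #|I| <= Zs lam A.
Proof.
move=> l0 sIA iI; rewrite -Rsum_pow_card; apply: Rsum_subset => J.
  by move=> _; apply: pow_le.
by move=> sJI; rewrite (subset_trans sJI sIA) (indep_sub sJI iI).
Qed.

Lemma Zs_le_pow lam A : 0 <= lam -> Zs lam A <= (1 + lam) ^ #|A|.
Proof.
move=> l0; rewrite -Rsum_pow_card; apply: Rsum_subset => J.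
  by move=> _; apply: pow_le.
by case/andP.
Qed.

Lemma pow_le_exp y n : 0 <= y -> (1 + y) ^ n <= exp (y * INR n).
Proof.
move=> y0; elim: n => [|n IH]; first by rewrite /= Rmult_0_r exp_0; lra.
rewrite S_INR Rmult_plus_distr_l Rmult_1_r exp_plus /= Rmult_comm.
apply: Rmult_le_compat; rewrite ?exp_ineq1_le //; try lra; first by apply: pow_le; lra.
exact: exp_ineq1_le.
Qed.

Lemma pow_exp x n : 0 < x -> x ^ n = exp (INR n * ln x).
Proof.
move=> x0; elim: n => [|n IH]; first by rewrite /= Rmult_0_l exp_0.
by rewrite S_INR Rmult_plus_distr_r Rmult_1_l exp_plus exp_ln //= IH; lra.
Qed.

(* Rankin's trick: weights of sets with few elements are compared with those at fugacity [lam * x]. *)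
Lemma Zlt_rankin lam tau A t x : 0 < lam -> 0 < x <= 1 ->
  (forall j, (j < tau)%nat -> INR j <= t) ->
  Zlt lam tau A <= exp (lam * x * INR #|A| - t * ln x).
Proof.
move=> l0 [x0 x1] jt.
have lnx : ln x <= 0 by rewrite -ln_1; apply: ln_mono.
have e0 := exp_pos (t * ln x).
apply: (Rmult_le_reg_r (exp (t * ln x))) => //.
rewrite -exp_plus; replace (_ - _ + _) with (lam * x * INR #|A|) by lra.
apply: (Rle_trans _ (Zs (lam * x) A)); last first.
  apply: Rle_trans (Zs_le_pow _ _) (pow_le_exp _ _); nra.
rewrite /Zlt Rmult_comm big_distrr /=.
apply: (Rle_trans _ (\big[Rplus/0]_(I : {set V} |
   (I \subset A) && independent adj I && (#|I| < tau)%nat) (lam * x) ^ #|I|)).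
  apply: Rsum_le => I /andP[_ /jt h]; rewrite Rpow_mult_distr Rmult_comm.
  apply: Rmult_le_compat_l; first by apply: pow_le; lra.
  rewrite pow_exp //; apply: exp_mono; nra.
apply: Rsum_subset => I; last by case/andP.
by move=> _; apply: pow_le; nra.
Qed.

(** A largest independent set [I] dominates [A], so the closed neighbourhoods of its vertices cover
    [A]. Each open neighbourhood has smaller clique number and no independent set larger than [I].
    The inductive bound is strict, so it still holds weakly after adding the centre, and only [#|I|]
    closed neighbourhoods are summed against a factor [#|I| + 1]. *)
Lemma ramsey r A : omega_le r A ->
  exists I : {set V}, [/\ I \subset A, independent adj I & (#|A| < expn (#|I|.+1) r)%nat].
Proof.
elim: r A => [|r IH] A hA.
  exists set0; rewrite sub0set indep0 expn0; split=> //.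
  rewrite ltnS leqn0 cards_eq0; apply/eqP/setP => x; rewrite inE; apply/negP => xA.
  have := hA [set x]; rewrite sub1set xA cards1 => /(_ isT); case/(_ _)/negPf => //.
  by apply/cliqueP => y z /set1P -> /set1P ->; rewrite eqxx.
pose P (I : {set V}) := (I \subset A) && independent adj I.
have P0 : P set0 by rewrite /P sub0set indep0.
case: (arg_maxnP (fun I : {set V} => #|I|) P0) => I /andP[sIA iI] Imax.
exists I; split=> //.
have cov : A \subset \bigcup_(v in I) (v |: [set w in A | adj v w]).
  apply/subsetP => w wA; apply/bigcupP; case: (boolP (w \in I)) => [wI|wI].
    by exists w => //; rewrite !inE eqxx.
  case: (boolP [exists v in I, adj v w]) => [/exists_inP[v vI vw]|/exists_inPn nw].
    by exists v => //; rewrite !inE wA vw orbT.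
  have /Imax : P (w |: I).
    rewrite /P subUset sub1set wA sIA /=; apply/indepP => x y.
    rewrite !inE => /orP[/eqP->|xI] /orP[/eqP->|yI].
    - by rewrite adj_irr.
    - by rewrite adj_sym nw.
    - by rewrite nw.
    - by move/indepP: iI; apply.
  by rewrite cardsU1 wI add1n /= ltnn.
apply: (@leq_ltn_trans (\sum_(v in I) expn (#|I|.+1) r)).
  apply: leq_trans (subset_leq_card cov) _.
  apply: leq_trans (leq_card_cup _ _) _.
  apply: leq_sum => v vI.
  have [|J [sJ iJ cJ]] := IH [set w in A | adj v w].
    move=> S sS cS; have := hA (v |: S).
    have vS : v \notin S by apply/negP => /(subsetP sS); rewrite inE adj_irr andbF.
    rewrite cardsU1 vS add1n ltnS; apply.
      rewrite subUset sub1set (subsetP sIA) //=; apply: subset_trans sS _.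
      by apply/subsetP => x; rewrite inE => /andP[].
    apply/cliqueP => x y; rewrite !inE => /orP[/eqP->|xS] /orP[/eqP->|yS].
    - by rewrite eqxx.
    - by have := subsetP sS _ yS; rewrite inE => /andP[].
    - by have := subsetP sS _ xS; rewrite inE adj_sym => /andP[].
    - by move/cliqueP: cS; apply.
  have {}/Imax hJ : P J.
    rewrite /P iJ andbT; apply: subset_trans sJ _.
    by apply/subsetP => x; rewrite inE => /andP[].
  rewrite cardsU1; apply: (@leq_trans (#|[set w in A | adj v w]|.+1)).
    by case: (_ \notin _).
  by apply: leq_trans cJ _; case: (r) => // r'; rewrite leq_exp2r // ltnS.
by rewrite sum_nat_const expnS ltn_mul2r expn_gt0 /=.
Qed.

End Graph.

(** * Counting independent sets of bounded clique number *)

Section Counting.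
Variables (V : finType) (adj : rel V).
Hypothesis adj_sym : forall x y, adj x y = adj y x.
Hypothesis adj_irr : forall x, adj x x = false.

(** If every vertex had fewer than [#|A| / r] non-neighbours (itself included), the non-neighbours
    of a clique on at most [r] vertices could not cover [A], so the clique would extend, up to
    [r + 1] vertices. *)
Lemma turan_nonneighbours r (A : {set V}) : omega_le adj r A -> A != set0 ->
  exists2 v, v \in A & (#|A| <= r * #|[set w in A | ~~ adj v w]|)%nat.
Proof.
move=> hA A0; pose nn v := [set w in A | ~~ adj v w].
case: (boolP [exists v in A, (#|A| <= r * #|nn v|)%nat]) => [/exists_inP[v]|/exists_inPn nv].
  by exists v.
suff H : forall i, (i <= r.+1)%nat ->
    exists S : {set V}, [/\ S \subset A, clique adj S & #|S| = i].
  have [S [sS cS S_card]] := H r.+1 (leqnn _).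
  by have := hA S sS cS; rewrite S_card ltnn.
elim=> [|i IH] hi.
  exists set0; rewrite sub0set cards0; split=> //.
  by apply/cliqueP => x y; rewrite inE.
have [S [sS cS cardS]] := IH (ltnW hi).
pose Un := \bigcup_(v in S) nn v.
have lt : (#|Un| < #|A|)%nat.
  have h1 : (#|Un| <= \sum_(v in S) #|nn v|)%nat by apply: leq_card_cup.
  case: (posnP i) => [i0|i0].
    have S0 : S = set0 by apply/eqP; rewrite -cards_eq0 cardS i0.
    by rewrite /Un S0 big_set0 cards0 card_gt0.
  have h2 : (\sum_(v in S) (r * #|nn v|).+1 <= \sum_(v in S) #|A|)%nat.
    by apply: leq_sum => v vS; rewrite ltnNge; apply: nv; apply: (subsetP sS).
  rewrite sum_nat_const cardS in h2.
  rewrite (eq_bigr (fun v => r * #|nn v| + 1)%nat) in h2; last by move=> *; rewrite addn1.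
  rewrite big_split /= -big_distrr /= sum_nat_const cardS muln1 in h2.
  have r0 : (0 < r)%nat by lia.
  rewrite -(ltn_pmul2l r0); nia.
have /subsetPn[w wA wU] : ~~ (A \subset Un).
  by apply/negP => /subset_leq_card; rewrite leqNgt lt.
have adjw v : v \in S -> adj v w.
  move=> vS; apply/negPn/negP => h; move/bigcupP: wU; apply.
  by exists v => //; rewrite inE wA.
have wS : w \notin S by apply/negP => /adjw; rewrite adj_irr.
exists (w |: S); rewrite cardsU1 wS cardS add1n; split=> //.
  by rewrite subUset sub1set wA.
apply/cliqueP => x y; rewrite !inE => /orP[/eqP->|xS] /orP[/eqP->|yS].
- by rewrite eqxx.
- by rewrite adj_sym adjw.
- by rewrite adjw.
- by move/cliqueP: cS; apply.
Qed.

Definition indeps (s : nat) (A : {set V}) : {set {set V}} :=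
  [set I : {set V} | [&& I \subset A, independent adj I & #|I| == s]].

Lemma indepsP s (A I : {set V}) :
  reflect [/\ I \subset A, independent adj I & #|I| = s] (I \in indeps s A).
Proof.
by rewrite inE; apply: (iffP and3P) => -[h1 h2 /eqP h3]; split=> //; apply/eqP.
Qed.

(** Double counting of the pairs [(v, I)] with [v] in an independent set [I] of size [s + 1]. *)
Lemma indeps_rec s (A : {set V}) :
  (\sum_(v in A) #|indeps s [set w in A | ~~ adj v w & w != v]|
    <= s.+1 * #|indeps s.+1 A|)%nat.
Proof.
apply: (@leq_trans (\sum_(v in A) \sum_(I in indeps s.+1 A) (v \in I))%nat).
  apply: leq_sum => v vA.
  rewrite -big_mkcondr /= sum1_card -[X in (X <= _)%nat](card_in_imset (f := fun I => v |: I)).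
    apply: subset_leq_card; apply/subsetP => _ /imsetP[I /indepsP[sI iI cI] ->].
    rewrite unfold_in /= in_setU1 eqxx andbT.
    have vI : v \notin I by apply/negP => /(subsetP sI); rewrite !inE eqxx !andbF.
    apply/indepsP; rewrite cardsU1 vI cI; split=> //.
      rewrite subUset sub1set vA; apply: subset_trans sI _.
      by apply/subsetP => x; rewrite inE => /and3P[].
    have nv x : x \in I -> ~~ adj v x by move/(subsetP sI); rewrite inE => /and3P[].
    apply/indepP => x y; rewrite !inE => /orP[/eqP->|xI] /orP[/eqP->|yI].
    - by rewrite adj_irr.
    - exact: nv.
    - by rewrite adj_sym nv.
    - by move/indepP: iI; apply.
  have vn (J : {set V}) : J \in indeps s [set w in A | ~~ adj v w & w != v] -> v \notin J.
    by move=> /indepsP[sJ _ _]; apply/negP => /(subsetP sJ); rewrite !inE eqxx !andbF.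
  move=> I J /vn vI /vn vJ e.
  by rewrite -(setU1K vI) -(setU1K vJ) e.
rewrite exchange_big /= mulnC -sum_nat_const; apply: leq_sum => I /indepsP[_ _ cI].
rewrite -big_mkcondr /= sum1_card -cI; apply: subset_leq_card.
by apply/subsetP => v; rewrite unfold_in => /andP[].
Qed.

(* Greedy choice: at least a tenth of the vertices have degree small enough to leave a fraction
   [4 / (5 r)] of the remaining vertices available. *)
Lemma indeps_lower_bound r S s (A : {set V}) x :
  (1 <= r)%nat -> (s < S)%nat -> omega_le adj r A -> 0 < x <= INR #|A| ->
  let q := 5 / 4 * INR r in
  s = 0%nat \/ 10 * INR r * q ^ s <= x * q ->
  x ^ s.+1 <= INR #|indeps s.+1 A| * ((10 * INR S) ^ s.+1 * q ^ (binomial.binomial s.+1 2)).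
Proof.
move=> r1 sS hA hx q hq.
have r1' : 1 <= INR r by apply: (INR_leq r1).
have q1 : 5 / 4 <= q by rewrite /q; lra.
have S1 : 1 <= INR S by apply: (@INR_leq 1); lia.
elim: s A x sS hA hx hq => [|s IH] A x sS hA hx hq.
  have <- : #|A| = #|indeps 1 A|.
    rewrite -(card_imset (mem A) (@set1_inj V)); apply: eq_card => I.
    apply/imsetP/indepsP => [[v vA ->]|[sI _ /eqP/cards1P[v e]]].
      rewrite sub1set cards1; split=> //.
      by apply/indepP => y z /set1P -> /set1P ->; rewrite adj_irr.
    by exists v => //; move: sI; rewrite e sub1set.
  by rewrite bin_small //=; nra.
have {hq} hq : 10 * INR r * q ^ s <= x.
  case: hq => // hq; rewrite /= in hq.
  by apply: (Rmult_le_reg_r q); lra.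
have qs1 : 1 <= q ^ s by apply: pow_R1_Rle; lra.
have hx10 : 10 * INR r <= x by nra.
have qx : x / q * q = x by field; lra.
have xq0 : 0 < x / q by apply: Rdiv_lt_0_compat; lra.
pose NB v := [set w in A | ~~ adj v w & w != v].
pose good := [set v in A | if Rle_dec (x / q) (INR #|NB v|) then true else false].
(* Otherwise more than [9 x / 10] vertices are not good, and Turan's bound gives one of them with at
   least [9 x / (10 r) - 1] non-neighbours besides itself. As [10 r <= x], this is at least
   [4 x / (5 r) = x / q], a contradiction. *)
have good_big : x / 10 <= INR #|good|.
  pose B := A :\: good.
  have cB : (#|A| = #|good| + #|B|)%nat.
    rewrite -(cardsID good A) (setIidPr _) //.
    by apply/subsetP => v; rewrite inE => /andP[].
  apply: Rnot_lt_le => lt.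
  have hB : 9 / 10 * x < INR #|B| by move: hx; rewrite cB plus_INR; lra.
  have B0 : B != set0.
    by apply/eqP => B0; move: hB; rewrite B0 cards0 /=; lra.
  have sBA : B \subset A by apply: subsetDl.
  have [v vB hv] := turan_nonneighbours (omega_le_sub sBA hA) B0.
  have vA := subsetP sBA v vB.
  have c1 : (#|[set w in B | ~~ adj v w]| <= #|NB v|.+1)%nat.
    apply: (@leq_trans #|v |: NB v|); last first.
      by rewrite cardsU1; case: (_ \notin _); rewrite ?add1n ?add0n.
    apply: subset_leq_card; apply/subsetP => w; rewrite !inE => /andP[/andP[_ wA] ->].
    by rewrite wA; case: eqP.
  have h : INR #|B| <= INR r * (INR #|NB v| + 1).
    rewrite -S_INR -mult_INR; apply: INR_leq; apply: leq_trans hv _.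
    by rewrite leq_mul2l c1 orbT.
  have : ~~ (v \in good) by move: vB; rewrite inE => /andP[].
  rewrite inE vA /=; case: Rle_dec => // nle _.
  apply: nle; apply: (Rmult_le_reg_r q); first lra.
  rewrite qx /q; nra.
set M := (10 * INR S) ^ s.+1 * q ^ (binomial.binomial s.+1 2).
have M0 : 0 < M.
  by apply: Rmult_lt_0_compat; apply: pow_lt; lra.
have each v : v \in good -> (x / q) ^ s.+1 <= INR #|indeps s.+1 (NB v)| * M.
  rewrite inE => /andP[vA]; case: Rle_dec => // le _.
  apply: IH => //; first exact: ltnW.
    by apply: omega_le_sub hA; apply/subsetP => w; rewrite inE => /and3P[].
  by right; rewrite qx.
have total : x / 10 * (x / q) ^ s.+1 <= INR S * INR #|indeps s.+2 A| * M.
  have xqs : 0 <= (x / q) ^ s.+1 by apply: pow_le; lra.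
  apply: (Rle_trans _ (INR #|good| * (x / q) ^ s.+1)); first by apply: Rmult_le_compat_r.
  have -> : INR #|good| * (x / q) ^ s.+1 = \big[Rplus/0]_(v in good) (x / q) ^ s.+1.
    by rewrite Rsum_const.
  apply: (Rle_trans _ (\big[Rplus/0]_(v in good) (INR #|indeps s.+1 (NB v)| * M))).
    exact: Rsum_le.
  rewrite -big_distrl /= -INR_sum; apply: Rmult_le_compat_r; first lra.
  rewrite -mult_INR; apply: INR_leq.
  apply: (@leq_trans (\sum_(v in A) #|indeps s.+1 (NB v)|)%nat).
    rewrite [X in (_ <= X)%nat](bigID (mem good)) /=.
    apply: (leq_trans _ (leq_addr _ _)); apply: eq_leq; apply: eq_bigl => v.
    by rewrite inE andbA andbb.
  by apply: leq_trans (indeps_rec _ _) _; rewrite leq_mul2r sS orbT.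
have e : x ^ s.+2 = 10 * q ^ s.+1 * (x / 10 * (x / q) ^ s.+1).
  rewrite -[in LHS]qx Rpow_mult_distr.
  have -> : x / 10 = x / q * q / 10 by rewrite qx.
  by rewrite /=; lra.
rewrite e.
apply: (Rle_trans _ (10 * q ^ s.+1 * (INR S * INR #|indeps s.+2 A| * M))).
  apply: Rmult_le_compat_l total; apply: Rmult_le_pos; first lra; apply: pow_le; lra.
rewrite binS bin1 pow_add /M; apply: Req_le.
have -> : (10 * INR S) ^ s.+2 = 10 * INR S * (10 * INR S) ^ s.+1 by [].
ring.
Qed.

End Counting.

(** * Lower bound on the partition function *)

Definition evt (P : R -> Prop) := exists x0, forall x, x0 <= x -> P x.

Definition to_infty (f : R -> R) := forall c, evt (fun x => c <= f x).

Lemma evt_and P Q : evt P -> evt Q -> evt (fun x => P x /\ Q x).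
Proof.
move=> [a ha] [b hb]; exists (Rmax a b) => x hx.
have := Rmax_l a b; have := Rmax_r a b.
by split; [apply: ha | apply: hb]; lra.
Qed.

Lemma evt_mono (P Q : R -> Prop) : (forall x, P x -> Q x) -> evt P -> evt Q.
Proof. by move=> h [a ha]; exists a => x /ha /h. Qed.

Lemma evt_ge c : evt (fun x => c <= x).
Proof. by exists c. Qed.

Lemma evt_comp P f : to_infty f -> evt P -> evt (fun x => P (f x)).
Proof. by move=> hf [a ha]; apply: evt_mono (hf a) => x /ha. Qed.

Lemma to_infty_comp f g : to_infty f -> to_infty g -> to_infty (fun x => f (g x)).
Proof. by move=> hf hg c; apply: (evt_comp hg (hf c)). Qed.

Lemma to_infty_ln : to_infty ln.
Proof.
move=> c; exists (exp c) => x hx; rewrite -[c]ln_exp.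
by apply: ln_mono => //; apply: exp_pos.
Qed.

Lemma ln_le_sub1 x : 0 < x -> ln x <= x - 1.
Proof. by move=> x0; have := exp_ineq1_le (ln x); rewrite exp_ln //; lra. Qed.

(** Uses [ln x = 2 * ln (sqrt x) <= 2 * sqrt x], which is at most [c * x] once [4 / c^2 <= x]. *)
Lemma evt_ln_le c : 0 < c -> evt (fun x => ln x <= c * x).
Proof.
move=> c0; exists (Rmax 1 (4 / (c * c))) => x hx.
have x1 : 1 <= x by have := Rmax_l 1 (4 / (c * c)); lra.
have hc : 4 / (c * c) <= x by have := Rmax_r 1 (4 / (c * c)); lra.
have s0 : 0 < sqrt x by apply: sqrt_lt_R0; lra.
have sx : sqrt x * sqrt x = x by apply: sqrt_sqrt; lra.
rewrite -{1}sx ln_mult //.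
have h := ln_le_sub1 s0.
suff : 2 <= c * sqrt x by nra.
have : 4 <= c * c * x.
  have := Rmult_le_compat_l (c * c) _ _ (Rlt_le _ _ (Rmult_lt_0_compat _ _ c0 c0)) hc.
  have -> : c * c * (4 / (c * c)) = 4 by field; lra.
  by [].
move=> h4; rewrite -{}sx in h4; apply: Rnot_lt_le => lt.
have p := Rmult_lt_0_compat _ _ c0 s0.
have e : c * c * (sqrt x * sqrt x) = (c * sqrt x) * (c * sqrt x) by ring.
rewrite e in h4; nra.
Qed.

Lemma ln_nat_ge2 (r : nat) : (2 <= r)%nat -> / 2 < ln (INR r).
Proof.
move=> r2; apply: (Rlt_le_trans _ (ln 2)); first exact: ln_lt_2.
by apply: ln_mono; [lra | apply: (@INR_leq 2)].
Qed.

(** The default value of [ln]. It lets a positive lower bound on [ln x] yield [0 < x]. *)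
Lemma ln_nonpos x : x <= 0 -> ln x = 0.
Proof. by rewrite /ln => x0; case: Rlt_dec => // h; exfalso; lra. Qed.

Lemma ln_reg x y : 0 < x -> 0 < y -> ln x <= ln y -> x <= y.
Proof. by move=> x0 y0 /exp_mono; rewrite !exp_ln. Qed.

Lemma ln_div x y : 0 < x -> 0 < y -> ln (x / y) = ln x - ln y.
Proof. by move=> x0 y0; rewrite ln_mult ?ln_Rinv //; apply: Rinv_0_lt_compat. Qed.

Lemma ln_pow_nat x n : 0 < x -> ln (x ^ n) = INR n * ln x.
Proof. by move=> x0; rewrite pow_exp // ln_exp. Qed.

(** So [s.+1] is the ceiling of [y]. Taken as [tau], it is at least [y], while every [j < tau] is at
    most [y], as Rankin's bound asks. *)
Lemma nat_below y : 0 < y -> exists s : nat, INR s < y <= INR s + 1.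
Proof.
move=> y0; have [n hn] := INR_unbounded y.
elim: n hn => [|n IH] hn; first by move: hn; rewrite /=; lra.
case: (Rlt_le_dec (INR n) y) => h; last first.
  by case: (Rle_lt_or_eq_dec _ _ h) => [|e]; [exact: IH | exists n.-1;
    case: n hn h e {IH} => [|n] hn h e; move: e y0; rewrite ?S_INR /= => *; lra].
by exists n; move: hn; rewrite S_INR; lra.
Qed.

Lemma INR_binomial2 s : 2 * INR (binomial.binomial s.+1 2) = INR s * (INR s + 1).
Proof.
elim: s => [|s IH]; first by rewrite bin_small //=; lra.
by rewrite binS bin1 plus_INR Rmult_plus_distr_l IH !S_INR; ring.
Qed.

(** Write [X] for the logarithm of the number of vertices. The main term of the logarithm of the
    number of independent sets of size [s + 1] is [(s + 1) * X]. The factor [q ^ binomial(s + 1, 2)]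
    costs at most a third of it, and lower order factors cost [11 / 100] of it. What is left is at
    least [55 / 100 * X] per element, and [s + 1] is at least [X / (2 rho)], hence [11 / 40]. The
    margin over [1 / 4] is used in [dichotomyB] and [kpar_large]. *)
Lemma Zs_lower_bound lam : 0 < lam ->
  exists N0, forall (V : finType) (adj : rel V) (r : nat) (A : {set V}),
    (forall x y, adj x y = adj y x) -> (forall x, adj x x = false) ->
    (2 <= r)%nat -> omega_le adj r A -> N0 <= ln (INR #|A|) ->
    11 / 40 * (ln (INR #|A|)) ^ 2 / ln (INR r) <= ln (Zs adj lam A).
Proof.
move=> l0.
have /(evt_and (evt_ge (3 * ln 10 + 1))) : evt (fun X => ln (10 * (X + 1)) - ln lam <= 11 / 100 * X).
  have [a ha] := evt_ln_le (c := 5 / 1000) ltac:(lra).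
  exists (Rmax (Rmax a 1) (100 * (1 - ln lam))) => X hX.
  have h1 := Rmax_l (Rmax a 1) (100 * (1 - ln lam)).
  have h2 := Rmax_r (Rmax a 1) (100 * (1 - ln lam)).
  have h3 := Rmax_l a 1; have h4 := Rmax_r a 1.
  have := ha (10 * (X + 1)) ltac:(lra); lra.
move=> [N0 HN]; exists N0 => V adj r A adj_sym adj_irr r2 hA /HN {HN} [X10 Xln].
set X := ln (INR #|A|) in X10 Xln *; set rho := ln (INR r).
have r2' : 2 <= INR r by apply: (@INR_leq 2).
have rho0 : / 2 < rho by apply: ln_nat_ge2.
have ln10 : 0 < ln 10 by rewrite -ln_1; apply: ln_increasing; lra.
have n0 : 0 < INR #|A|.
  case: (posnP #|A|) => h; last by apply: (@INR_ltn 0).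
  by move: X10; rewrite /X h (ln_nonpos (Rle_refl 0)) /=; lra.
(* [s + 1], about [log n / (2 log r)], is the size of the independent sets that are counted. *)
have [s [s1 s2]] : exists s : nat, INR s < X / (2 * rho) <= INR s + 1.
  by apply: nat_below; apply: Rdiv_lt_0_compat; lra.
have sX : INR s * (2 * rho) < X.
  by have := Rmult_lt_compat_r (2 * rho) _ _ ltac:(lra) s1; rewrite Rmult_assoc Rinv_l; lra.
have Xs : X <= (INR s + 1) * (2 * rho).
  by have := Rmult_le_compat_r (2 * rho) _ _ ltac:(lra) s2; rewrite Rmult_assoc Rinv_l; lra.
have s0 := pos_INR s.
pose q := 5 / 4 * INR r.
have q0 : 0 < q by rewrite /q; lra.
(* Because [(5/4)^3 = 125/64 < 2 <= r]. *)
have lnq : ln q <= 4 / 3 * rho.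
  have : ln (q ^ 3) <= ln (INR r ^ 4).
    apply: ln_mono; first exact: pow_lt.
    have -> : INR r ^ 4 = INR r ^ 3 * INR r by ring.
    have -> : q ^ 3 = INR r ^ 3 * (125 / 64) by rewrite /q; field.
    by apply: Rmult_le_compat_l; [apply: pow_le | ]; lra.
  rewrite !ln_pow_nat //; last lra.
  rewrite -/rho /=; lra.
have cond : s = 0%nat \/ 10 * INR r * q ^ s <= INR #|A| * q.
  case: s s0 s1 s2 sX Xs => [|s] s0 s1 s2 sX Xs; [by left | right].
  have -> : 10 * INR r * q ^ s.+1 = (10 * INR r * q ^ s) * q by rewrite /=; ring.
  apply: Rmult_le_compat_r; first lra.
  rewrite S_INR in sX.
  have h : ln (10 * INR r * q ^ s) <= X.
    rewrite (ln_mult (10 * INR r)) ?(ln_mult 10) ?ln_pow_nat -/rho //; try lra; last by apply: pow_lt.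
    have := Rmult_le_compat_l (INR s) _ _ (pos_INR s) lnq; lra.
  apply: ln_reg => //.
  by apply: Rmult_lt_0_compat; [lra | apply: pow_lt].
have := indeps_lower_bound adj_sym adj_irr (r := r) (S := s.+1) (s := s) (A := A) (x := INR #|A|) _ _ hA _ cond.
move=> /(_ ltac:(lia) ltac:(lia) ltac:(lra)) main.
have S1 : 1 <= INR s.+1 by rewrite S_INR; lra.
have i0 : 0 < INR #|indeps adj s.+1 A|.
  case: (posnP #|indeps adj s.+1 A|) => [e|]; last by move=> h; apply: (@INR_ltn 0).
  by move: main; rewrite e Rmult_0_l; have := pow_lt _ s.+1 n0; lra.
have Zi : INR #|indeps adj s.+1 A| * lam ^ s.+1 <= Zs adj lam A.
  have -> : INR #|indeps adj s.+1 A| * lam ^ s.+1 =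
      \big[Rplus/0]_(I in indeps adj s.+1 A) lam ^ #|I|.
    rewrite (eq_bigr (fun=> lam ^ s.+1)) ?Rsum_const //.
    by move=> I /indepsP[_ _ ->].
  apply: Rsum_subset => I; first by move=> _; apply: pow_le; lra.
  by move=> /indepsP[-> ->].
have lp : 0 < lam ^ s.+1 by apply: pow_lt.
have lnZ : ln (INR #|indeps adj s.+1 A|) + (INR s + 1) * ln lam <= ln (Zs adj lam A).
  rewrite -S_INR -ln_pow_nat // -ln_mult //; apply: ln_mono => //.
  exact: Rmult_lt_0_compat.
have lnm : (INR s + 1) * X <= ln (INR #|indeps adj s.+1 A|) +
   ((INR s + 1) * ln (10 * INR s.+1) + INR (binomial.binomial s.+1 2) * ln q).
  have p1 : 0 < (10 * INR s.+1) ^ s.+1 by apply: pow_lt; lra.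
  have p2 : 0 < q ^ (binomial.binomial s.+1 2) by apply: pow_lt.
  have p3 := Rmult_lt_0_compat _ _ p1 p2.
  have := ln_mono _ main; rewrite ln_pow_nat // => /(_ (pow_lt _ _ n0)).
  rewrite ln_mult // ln_mult // ln_pow_nat; last lra.
  by rewrite ln_pow_nat // S_INR.
have b2 := INR_binomial2 s.
have lnS : ln (10 * INR s.+1) <= ln (10 * (X + 1)).
  apply: ln_mono; first lra.
  by rewrite S_INR; nra.
have bq : INR (binomial.binomial s.+1 2) * ln q <= (INR s + 1) * (X / 3).
  have h1 : INR (binomial.binomial s.+1 2) * ln q <= INR (binomial.binomial s.+1 2) * (4 / 3 * rho).
    by apply: Rmult_le_compat_l => //; apply: pos_INR.
  apply: Rle_trans h1 _; nra.
have h55 : (INR s + 1) * (55 / 100 * X) <= ln (Zs adj lam A) by nra.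
apply: Rle_trans h55.
have e : 11 / 40 * X ^ 2 / rho = 55 / 100 * X * (X / (2 * rho)) by field; lra.
rewrite e Rmult_comm; apply: Rmult_le_compat_r; lra.
Qed.

(** * Independent sets of small size are rare *)

Definition graph_omega (V : finType) (adj : rel V) (r : nat) (A : {set V}) :=
  [/\ forall x y, adj x y = adj y x, forall x, adj x x = false & omega_le adj r A].

(* [tA] and [tB] are the lower bounds on the average size of an independent set of a graph with
   clique number [r] and partition function [D]. *)
Definition tA (D : R) (r : nat) : R := ln D / ((INR r - 1) * ln (ln D)).
Definition tB (D : R) (r : nat) : R := / 2 * sqrt (ln D / ln (INR r)).

(** Rankin's bound at its optimum [x = t / (lam * #|A|)], or at [x = 1] if that value exceeds 1; the
    maximum with 0 merges the two cases. *)
Lemma Zlt_le_exp (V : finType) (adj : rel V) lam tau (A : {set V}) t :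
  0 < lam -> 0 < t -> (forall j, (j < tau)%nat -> INR j <= t) ->
  Zlt adj lam tau A <= exp (t * (1 + Rmax 0 (ln (lam * INR #|A| / t)))).
Proof.
move=> l0 t0 jt; have n0 := pos_INR #|A|.
case: (Rle_lt_dec (lam * INR #|A|) t) => h.
  apply: Rle_trans (Zlt_rankin adj A l0 (x := 1) _ jt) _; first lra.
  apply: exp_mono; rewrite ln_1; have := Rmax_l 0 (ln (lam * INR #|A| / t)); nra.
have p : 0 < lam * INR #|A| by lra.
have e : t / (lam * INR #|A|) * (lam * INR #|A| / t) = 1.
  by field; repeat split; nra.
have x0 : 0 < t / (lam * INR #|A|) by apply: Rdiv_lt_0_compat.
have y0 : 0 < lam * INR #|A| / t by apply: Rdiv_lt_0_compat.
have x1 : t / (lam * INR #|A|) <= 1.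
  apply: (Rmult_le_reg_r (lam * INR #|A|)) => //.
  by rewrite /Rdiv Rmult_assoc Rinv_l; lra.
apply: Rle_trans (Zlt_rankin adj A l0 (conj x0 x1) jt) _.
apply: exp_mono.
have le : ln (t / (lam * INR #|A|)) = - ln (lam * INR #|A| / t).
  by have := ln_mult _ _ x0 y0; rewrite e ln_1; lra.
rewrite le; have := Rmax_r 0 (ln (lam * INR #|A| / t)).
have -> : lam * (t / (lam * INR #|A|)) * INR #|A| = t by field; nra.
nra.
Qed.

Lemma small_power_bound eps D : 0 < eps < 1 -> 1 <= ln D ->
  ln (ln D) - ln eps <= eps / 2 * ln D -> exp ((1 - eps / 2) * ln D) <= eps * D / ln D.
Proof.
move=> he l1 h.
have D0 : 0 < D by apply: Rnot_le_lt => /ln_nonpos e; lra.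
have q0 : 0 < eps * D / ln D by apply: Rdiv_lt_0_compat; nra.
apply: (ln_reg (exp_pos _) q0); rewrite ln_exp ln_div; [|nra|lra].
rewrite ln_mult; lra.
Qed.

Section Dichotomy.
Variables (lam eps : R).
Hypothesis (lam0 : 0 < lam) (eps0 : 0 < eps < / 2).

Lemma dichotomyA : evt (fun D => forall r, (2 <= r)%nat ->
  exists tau, [/\ (1 <= tau)%nat, (1 - eps) * tA D r <= INR tau &
    forall (V : finType) (adj : rel V) (A : {set V}), graph_omega adj r A ->
      Zlt adj lam tau A <= eps * D / ln D \/ Zlt adj lam tau A <= eps * Zs adj lam A]).
Proof.
pose b := ln (1 + lam).
have b0 : 0 < b by rewrite /b -ln_1; apply: ln_increasing; lra.
pose c1 := 1 + ln lam - ln (1 - eps).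
have E1 : evt (fun l => 1 <= l /\ ln l - ln eps <= eps / 2 * l /\ b - ln eps <= l).
  apply: evt_and (evt_ge 1) (evt_and _ (evt_ge _)).
  have e4 : 0 < eps / 4 by lra.
  apply: evt_mono (evt_and (evt_ln_le e4) (evt_ge (- ln eps / (eps / 4)))) => l [h1 h2].
  have := Rmult_le_compat_l (eps / 4) _ _ (Rlt_le _ _ e4) h2.
  by have -> : eps / 4 * (- ln eps / (eps / 4)) = - ln eps by [field; lra]; lra.
have E2 : evt (fun ll => 4 <= ll /\ 3 <= b * exp (eps / 8 * ll - ln ll - 1 - Rabs c1)).
  apply: evt_and (evt_ge 4) _.
  have e4 : 0 < eps / 16 by lra.
  apply: evt_mono (evt_and (evt_ln_le e4)
    (evt_ge ((1 + Rabs c1 + ln (3 / b)) / (eps / 16)))) => l [h1 h2].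
  have := Rmult_le_compat_l (eps / 16) _ _ (Rlt_le _ _ e4) h2.
  have -> : eps / 16 * ((1 + Rabs c1 + ln (3 / b)) / (eps / 16)) =
    1 + Rabs c1 + ln (3 / b) by field; lra.
  move=> h3; have : 3 / b <= exp (eps / 8 * l - ln l - 1 - Rabs c1).
    by rewrite -[3 / b]exp_ln; [apply: exp_mono; lra | apply: Rdiv_lt_0_compat; lra].
  move/(Rmult_le_compat_l b _ _ (Rlt_le _ _ b0)).
  by have -> : b * (3 / b) = 3 by field; lra.
apply: evt_mono (evt_and (evt_comp to_infty_ln E1)
  (evt_comp to_infty_ln (evt_comp to_infty_ln E2))) => D.
set l := ln D; set ll := ln l => -[[l1 [hl1 hl2]] [ll4 hE]] r r2.
have r2' : 2 <= INR r by apply: (@INR_leq 2).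
pose rho := INR r - 1.
have lll0 : 0 <= ln ll by rewrite -ln_1; apply: ln_mono; lra.
pose t := (1 - eps) * tA D r.
have et : t = (1 - eps) * (l / (rho * ll)) by [].
have rl0 : 0 < rho * ll by rewrite /rho; nra.
have t0 : 0 < t.
  rewrite et; apply: Rmult_lt_0_compat; first lra.
  by apply: Rdiv_lt_0_compat; lra.
have [s [s1 s2]] := nat_below t0.
exists s.+1; split=> //; first by rewrite S_INR.
move=> V adj A [adj_sym adj_irr hA].
have jt j : (j < s.+1)%nat -> INR j <= t.
  by rewrite ltnS => /INR_leq; lra.
have hZ := Zlt_le_exp adj A lam0 t0 jt.
set y := Rmax 0 _ in hZ.
case: (Rle_lt_dec (t * (1 + y)) ((1 - eps / 2) * l)) => [small|large].
  left; apply: Rle_trans hZ _; apply: Rle_trans (exp_mono small) _.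
  by apply: small_power_bound => //; lra.
right.
(* The exponent in Rankin's bound is [(1 - eps) * l * th], so [th] measures by how much that bound
   exceeds [D ^ (1 - eps)]. In the present case [th >= 1 + eps / 2]. *)
pose th := (1 + y) / (rho * ll).
have ey : 1 + y = th * (rho * ll) by rewrite /th; field; nra.
have etl : t * (1 + y) = (1 - eps) * l * th.
  by rewrite ey et; field; rewrite /rho; nra.
have th1 : 1 + eps / 2 <= th.
  rewrite etl in large; apply: Rnot_lt_le => h.
  have : (1 - eps) * l * th <= (1 - eps) * l * (1 + eps / 2).
    by apply: Rmult_le_compat_l; nra.
  nra.
have rho1 : 1 <= rho by rewrite /rho; lra.
have rl4 : 4 <= rho * ll by nra.
have y0 : 0 < y by nra.
have n0 := pos_INR #|A|.
have ln_y : y = ln (lam * INR #|A| / t).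
  by move: y0; rewrite /y /Rmax; case: Rle_dec; lra.
have npos : 0 < INR #|A|.
  case: n0 => // e; move: y0; rewrite ln_y -e Rmult_0_r /Rdiv Rmult_0_l ln_nonpos; lra.
have ln_t : ln t = ln (1 - eps) + ll - ln rho - ln ll.
  rewrite et ln_mult; [|lra|by apply: Rdiv_lt_0_compat; lra].
  by rewrite ln_div; [rewrite ln_mult; rewrite -/ll; lra|lra|lra].
have ln_n : ln (INR #|A|) = ln t - ln lam + y.
  rewrite ln_y ln_div; [|nra|lra]; rewrite ln_mult; lra.
(* Up to lower order terms [ln #|A|] is [ll + th * rho * ll = (rho + 1) * ll + (th - 1) * rho * ll].
   Ramsey's theorem divides this by [r = rho + 1], and [rho / (rho + 1) >= 1 / 2] gives the main
   terms of [w]. So there is an independent set of size about [exp w], larger than [l = exp ll]. *)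
pose w := ll + (th - 1) * ll / 2 - 1 - ln ll - Rabs c1.
have hw : INR r * w <= ln (INR #|A|).
  have -> : INR r = rho + 1 by rewrite /rho; lra.
  have h1 := ln_le_sub1 (x := rho) ltac:(lra).
  have h2 := Rle_abs c1; have h3 := Rabs_pos c1.
  have h4 : 0 <= rho * ln ll by apply: Rmult_le_pos; lra.
  have h5 : 0 <= rho * Rabs c1 by apply: Rmult_le_pos; lra.
  have h6 : 0 <= ll * ((th - 1) * (rho - 1)).
    by apply: Rmult_le_pos; [lra | apply: Rmult_le_pos; lra].
  have ey' : y = th * (rho * ll) - 1 by lra.
  rewrite ln_n ln_t ey' /w /c1 in h2 h3 h5 *; nra.
have [I [sI iI cI]] := ramsey adj_sym adj_irr hA.
have hI : exp w <= INR #|I| + 1.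
  have hp : INR #|A| <= (INR #|I| + 1) ^ r.
    rewrite -S_INR; apply: (Rle_trans _ (INR (expn #|I|.+1 r))); first by apply: INR_leq; exact: ltnW.
    apply: Req_le; elim: (r) => [|k IH] //=.
    by rewrite expnS mult_INR IH.
  have I0 := pos_INR #|I|.
  have := ln_mono npos hp; rewrite ln_pow_nat; last lra.
  move=> h; have {}h := Rle_trans _ _ _ hw h.
  have {}h := Rmult_le_reg_l (INR r) _ _ ltac:(lra) h.
  by rewrite -[_ + 1]exp_ln; [apply: exp_mono | lra].
have lnZ : (exp w - 1) * b <= ln (Zs adj lam A).
  have := Zs_ge_indep (lam := lam) ltac:(lra) sI iI.
  move/(ln_mono (pow_lt (1 + lam) #|I| ltac:(lra))).
  rewrite ln_pow_nat -/b; last lra; nra.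
(* The gain [(th - 1) * ll / 2] is at least [eps / 4 * ll]. The part [eps / 8 * ll] goes into [E]
   and absorbs the lower order terms of [w]; with [ll >= 4], the remainder beats the factor [th]. *)
have hE2 : 3 * l * th <= b * exp w.
  pose E := exp (eps / 8 * ll - ln ll - 1 - Rabs c1).
  have -> : exp w = l * exp ((th - 1) * ll / 2 - eps / 8 * ll) * E.
    have {1}-> : l = exp ll by rewrite exp_ln; lra.
    rewrite /E -!exp_plus /w; congr exp; lra.
  have hth : th <= exp ((th - 1) * ll / 2 - eps / 8 * ll).
    apply: Rle_trans (exp_ineq1_le _); nra.
  have lth : l * th <= l * exp ((th - 1) * ll / 2 - eps / 8 * ll).
    by apply: Rmult_le_compat_l; lra.
  have -> : b * (l * exp ((th - 1) * ll / 2 - eps / 8 * ll) * E)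
     = (l * exp ((th - 1) * ll / 2 - eps / 8 * ll)) * (b * E) by ring.
  rewrite -/E in hE; have := Rmult_le_compat _ _ _ _ _ _ lth hE; nra.
have Z1 := Zs_ge1 adj A (Rlt_le _ _ lam0).
apply: Rle_trans hZ _.
have -> : eps * Zs adj lam A = exp (ln eps + ln (Zs adj lam A)).
  by rewrite exp_plus !exp_ln; lra.
apply: exp_mono; rewrite etl.
have u1 : l * 1 <= l * th by apply: Rmult_le_compat_l; lra.
have u2 : (1 - eps) * (l * th) <= 1 * (l * th) by apply: Rmult_le_compat_r; lra.
lra.
Qed.

Lemma dichotomyB : evt (fun D => forall r, (2 <= r)%nat ->
  exists tau, [/\ (1 <= tau)%nat, (1 - eps) * tB D r <= INR tau &
    forall (V : finType) (adj : rel V) (A : {set V}), graph_omega adj r A ->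
      Zlt adj lam tau A <= eps * D / ln D \/ Zlt adj lam tau A <= eps * Zs adj lam A]).
Proof.
have [N0 HN0] := Zs_lower_bound lam0.
pose K := 50 * (1 + Rabs (ln lam)) + Rabs N0 * 2 + 2.
have E1 : evt (fun l => 1 <= l /\ ln l - ln eps <= eps / 2 * l /\ - ln eps <= 5 / 100 * l /\ K ^ 2 <= l).
  apply: evt_and (evt_ge 1) (evt_and _ (evt_and _ (evt_ge _))).
  have e4 : 0 < eps / 4 by lra.
  apply: evt_mono (evt_and (evt_ln_le e4) (evt_ge (- ln eps / (eps / 4)))) => l [h1 h2].
  have := Rmult_le_compat_l (eps / 4) _ _ (Rlt_le _ _ e4) h2.
  by have -> : eps / 4 * (- ln eps / (eps / 4)) = - ln eps by [field; lra]; lra.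
  by exists (20 * (- ln eps)) => x; lra.
apply: evt_mono (evt_comp to_infty_ln E1) => D.
set l := ln D => -[l1 [hl1 [hl2 hl3]]] r r2.
have r2' : 2 <= INR r by apply: (@INR_leq 2).
set rho := ln (INR r) in HN0 *.
have rho0 : / 2 < rho by apply: ln_nat_ge2.
pose t := (1 - eps) * tB D r.
have et : t = (1 - eps) * (/ 2 * sqrt (l / rho)) by [].
have lr0 : 0 < l / rho by apply: Rdiv_lt_0_compat; lra.
have sq0 : 0 < sqrt (l / rho) by apply: sqrt_lt_R0.
have sq2 : sqrt (l / rho) * sqrt (l / rho) * rho = l.
  by rewrite sqrt_sqrt; [field; lra | lra].
have t0 : 0 < t by rewrite et; nra.
have [s [s1 s2]] := nat_below t0.
exists s.+1; split=> //; first by rewrite S_INR.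
move=> V adj A [adj_sym adj_irr hA].
have spb : exp ((1 - eps / 2) * l) <= eps * D / l by apply: small_power_bound => //; lra.
(* When [r] is large compared with [D] the rate [tB] drops below 1. Then [tau = 1] and only the
   empty set is counted. The other case has [ln t >= 0]. *)
case: (Rle_lt_dec t 1) => t1.
  left; have s0 : s = 0%nat by case: s s1 s2 => // s; rewrite S_INR; have := pos_INR s; lra.
  rewrite s0 Zlt1; apply: Rle_trans spb; rewrite -[X in X <= _]exp_0; apply: exp_mono; nra.
have jt j : (j < s.+1)%nat -> INR j <= t.
  by rewrite ltnS => /INR_leq; lra.
have hZ := Zlt_le_exp adj A lam0 t0 jt.
set y := Rmax 0 _ in hZ.
case: (Rle_lt_dec (t * (1 + y)) ((1 - eps / 2) * l)) => [small|large].
  by left; apply: Rle_trans hZ _; apply: Rle_trans (exp_mono small) _.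
right.
(* The size of [t * (1 + y)] forces [(1 + y)^2 >= 4 * l * rho >= 2 * l], so [y] is large uniformly
   in [r]. The constant [K] is chosen so that [ln lam] is then negligible and the threshold [N0] is
   passed. *)
have Y1 : 2 * sqrt (l / rho) * rho <= 1 + y.
  apply: Rnot_lt_le => h.
  have : t * (1 + y) <= t * (2 * sqrt (l / rho) * rho) by apply: Rmult_le_compat_l; lra.
  rewrite {2}et; nra.
have Y2 : 4 * l * rho <= (1 + y) ^ 2.
  have -> : 4 * l * rho = (2 * sqrt (l / rho) * rho) ^ 2 by rewrite -{1}sq2; ring.
  apply: pow_incr; split=> //; nra.
have y0 : 0 <= y by apply: Rmax_l.
have N0abs := Rle_abs N0; have N0pos := Rabs_pos N0.
have lamabs := Rle_abs (ln lam); have lampos := Rabs_pos (ln lam).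
have YK : K <= 1 + y.
  apply: Rnot_lt_le => h; have : (1 + y) ^ 2 < K ^ 2 by rewrite /=; nra.
  nra.
have {}y0 : 0 < y by rewrite /K in YK; lra.
have n0 := pos_INR #|A|.
have ln_y : y = ln (lam * INR #|A| / t).
  by move: y0; rewrite /y /Rmax; case: Rle_dec; lra.
have npos : 0 < INR #|A|.
  case: n0 => // e; move: y0; rewrite ln_y -e Rmult_0_r /Rdiv Rmult_0_l ln_nonpos; lra.
have ln_n : ln (INR #|A|) = ln t - ln lam + y.
  rewrite ln_y ln_div; [|nra|lra]; rewrite ln_mult; lra.
have ln_t : 0 <= ln t by rewrite -ln_1; apply: ln_mono; lra.
have nY : 98 / 100 * (1 + y) <= ln (INR #|A|) by rewrite ln_n; rewrite /K in YK; lra.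
have := HN0 V adj r A adj_sym adj_irr r2 hA _.
rewrite -/rho; move=> /(_ ltac:(rewrite /K in YK; lra)) hlnZ.
have Z1 := Zs_ge1 adj A (Rlt_le _ _ lam0).
apply: Rle_trans hZ _.
have -> : eps * Zs adj lam A = exp (ln eps + ln (Zs adj lam A)).
  by rewrite exp_plus !exp_ln; lra.
apply: exp_mono.
(* This is the origin of the factor [1 / 2] in [tB]: it makes the required lower bound on [ln Z]
   about [(1 + y)^2 / (4 rho)], below the [11 / 40] that counting provides. *)
have tY : t * (1 + y) * rho <= / 4 * (1 + y) ^ 2.
  have u0 : 0 < sqrt (l / rho) * rho by apply: Rmult_lt_0_compat; lra.
  have u1 : (1 - eps) * (sqrt (l / rho) * rho) <= 1 * (sqrt (l / rho) * rho).
    by apply: Rmult_le_compat_r; lra.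
  have : t * rho <= / 4 * (1 + y) by rewrite et; lra.
  move=> h; have := Rmult_le_compat_r (1 + y) _ _ ltac:(lra) h; lra.
have n2 : 96 / 100 * (1 + y) ^ 2 <= ln (INR #|A|) ^ 2.
  have c0 : 0 <= 98 / 100 * (1 + y) by lra.
  have := pow_incr (98 / 100 * (1 + y)) (ln (INR #|A|)) 2 (conj c0 nY).
  have -> : (98 / 100 * (1 + y)) ^ 2 = 9604 / 10000 * (1 + y) ^ 2 by field.
  have := pow2_ge_0 (1 + y); lra.
have hfin : (t * (1 + y) - ln eps) * rho <= ln (Zs adj lam A) * rho.
  have rp : 0 <= rho by lra.
  have h := Rmult_le_compat_r rho _ _ rp hlnZ; move: h.
  have -> : 11 / 40 * ln (INR #|A|) ^ 2 / rho * rho = 11 / 40 * ln (INR #|A|) ^ 2 by field; lra.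
  nra.
have rp : 0 < rho by lra.
have := Rmult_le_reg_r _ _ _ rp hfin; lra.
Qed.

End Dichotomy.

(** * Local occupancy *)

Definition is_rate (t D : R) (r : nat) := t = tA D r \/ t = tB D r.

Lemma rate_bounds : evt (fun D => forall r t, (2 <= r)%nat -> is_rate t D r ->
  0 < t <= ln D).
Proof.
apply: evt_mono (evt_and (evt_comp to_infty_ln (evt_ge 1))
  (evt_comp to_infty_ln (evt_comp to_infty_ln (evt_ge 1)))) => D [l1 ll1] r t r2.
have r2' : 2 <= INR r by apply: (@INR_leq 2).
have rho0 := ln_nat_ge2 r2.
case=> ->.
  have h : 1 <= (INR r - 1) * ln (ln D) by nra.
  rewrite /tA; split; first by apply: Rdiv_lt_0_compat; lra.
  apply: (Rmult_le_reg_r ((INR r - 1) * ln (ln D))); first lra.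
  by rewrite /Rdiv Rmult_assoc Rinv_l; nra.
have q0 : 0 < ln D / ln (INR r) by apply: Rdiv_lt_0_compat; lra.
have s0 := sqrt_lt_R0 _ q0.
rewrite /tB; split; first lra.
have q1 : ln D / ln (INR r) <= (2 * ln D) ^ 2.
  apply: (Rmult_le_reg_r (ln (INR r))); first lra.
  by rewrite /Rdiv Rmult_assoc Rinv_l; nra.
have := sqrt_le_1_alt _ _ q1; rewrite sqrt_pow2; lra.
Qed.

(** Divided by [Zs], this is the expected size of a hard-core random independent set of [A]. *)
Definition Zsize (V : finType) (adj : rel V) lam (A : {set V}) : R :=
  \big[Rplus/0]_(I : {set V} | (I \subset A) && independent adj I) (INR #|I| * lam ^ #|I|).

(** Markov's inequality, multiplied by the partition function. *)
Lemma Zsize_lower (V : finType) (adj : rel V) lam tau (A : {set V}) : 0 <= lam ->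
  INR tau * (Zs adj lam A - Zlt adj lam tau A) <= Zsize adj lam A.
Proof.
move=> l0; rewrite /Zs (bigID (fun I : {set V} => (#|I| < tau)%nat)) /=.
rewrite -/(Zlt adj lam tau A).
set X := (X in _ + X - _).
have -> : Zlt adj lam tau A + X - Zlt adj lam tau A = X by lra.
rewrite /X big_distrr /= /Zsize [X in _ <= X](bigID (fun I : {set V} => (#|I| < tau)%nat)) /=.
set Y := (Y in _ <= Y + _).
have Y0 : 0 <= Y.
  by apply: Rsum_ge0 => I _; apply: Rmult_le_pos; [apply: pos_INR | apply: pow_le].
suff : forall a b, a <= b -> a <= Y + b by apply; apply: Rsum_le => I /andP[_ h];
  apply: Rmult_le_compat_r; [apply: pow_le | apply: INR_leq; rewrite leqNgt].
by move=> a b; lra.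
Qed.

(** Take [gamma] slightly above [1 / tau]. By Markov's inequality [gamma * Zsize] then pays for the
    sets with at least [tau] vertices. The smaller sets are paid for by [beta] if their weight is at
    most [e * d / ln d], and otherwise by the surplus [2 * e] in [gamma], since they are then only a
    fraction [e] of the total. *)
Lemma local_occupancy_parameters lam eps : 0 < lam -> 0 < eps ->
  evt (fun d => forall r t, (2 <= r)%nat -> is_rate t d r -> exists beta gamma,
    [/\ 0 <= beta, 0 <= gamma, beta + gamma * d <= (1 + eps) * (d / t) &
      forall (V : finType) (adj : rel V) (A : {set V}), graph_omega adj r A ->
        Zs adj lam A <= (beta - 1) * lam + gamma * Zsize adj lam A]).
Proof.
move=> l0 e0.
have il0 : 0 < / lam by apply: Rinv_0_lt_compat.
(* In units of [e * (d / t)], the coefficient [beta] costs [1 + 2 / lam] and [gamma * d] exceeds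
   [d / t] by at most 6. *)
pose e := Rmin (/ 4) (eps / (7 + 2 / lam)).
have c0 : 0 < 7 + 2 / lam by rewrite /Rdiv; lra.
have ep0 : 0 < eps / (7 + 2 / lam) by apply: Rdiv_lt_0_compat.
have he4 : e <= / 4 by apply: Rmin_l.
have hee : e * (7 + 2 / lam) <= eps.
  have -> : eps = eps / (7 + 2 / lam) * (7 + 2 / lam) by field; lra.
  by apply: Rmult_le_compat_r; [lra | apply: Rmin_r].
have he0 : 0 < e by apply: Rmin_glb_lt; lra.
have he : 0 < e < / 2 by lra.
apply: evt_mono (evt_and (evt_and (dichotomyA l0 he) (dichotomyB l0 he))
  (evt_and rate_bounds (evt_and (evt_ln_le he0) (evt_comp to_infty_ln (evt_ge 1))))).
move=> d [[hA hB] [hr [ln_d l1]]] r t r2 ht.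
have [t0 tl] := hr r t r2 ht.
have [tau [tau1 htau dich]] : exists tau, [/\ (1 <= tau)%nat, (1 - e) * t <= INR tau &
    forall (V : finType) (adj : rel V) (A : {set V}), graph_omega adj r A ->
      Zlt adj lam tau A <= e * d / ln d \/ Zlt adj lam tau A <= e * Zs adj lam A].
  by case: ht => ->; [apply: hA | apply: hB].
have d0 : 0 < d by apply: Rnot_le_lt => /ln_nonpos ?; lra.
have tau0 : 1 <= INR tau by apply: (@INR_leq 1).
pose beta := 1 + 2 * (e * d / ln d) / lam.
pose gamma := (1 + 2 * e) / INR tau.
have dl0 : 0 < d / ln d by apply: Rdiv_lt_0_compat; lra.
have edl : e * d / ln d = e * (d / ln d) by rewrite /Rdiv; ring.
have b1 : 0 <= beta - 1.
  by rewrite /beta edl /Rdiv; have : 0 < e * (d * / ln d) * / lam; [ | nra];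
   apply: Rmult_lt_0_compat => //; apply: Rmult_lt_0_compat.
exists beta, gamma; split; first lra.
- by apply: Rmult_le_pos; [lra | left; apply: Rinv_0_lt_compat; lra].
- have dt0 : 0 < d / t by apply: Rdiv_lt_0_compat.
  have dlt : d / ln d <= d / t.
    by apply: Rmult_le_compat_l; [lra | apply: Rinv_le_contravar].
  have one : 1 <= e * (d / ln d).
    apply: (Rmult_le_reg_r (ln d)); first lra.
    have -> : e * (d / ln d) * ln d = e * d by field; lra.
    lra.
  have g1 : gamma * d <= (1 + 6 * e) * (d / t).
    have -> : gamma * d = (1 + 2 * e) * d * / INR tau by rewrite /gamma /Rdiv; ring.
    have -> : (1 + 6 * e) * (d / t) = (1 + 6 * e) * (1 - e) * d * / ((1 - e) * t) by field; lra.
    apply: Rmult_le_compat; [nra | left; apply: Rinv_0_lt_compat; lra | nra |].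
    by apply: Rinv_le_contravar => //; nra.
  have b2 : beta <= (e + 2 * e / lam) * (d / t).
    rewrite /beta edl.
    have h1 : 1 <= e * (d / t) by nra.
    have h2 : 2 * (e * (d / ln d)) / lam <= 2 * e / lam * (d / t).
      have -> : 2 * (e * (d / ln d)) / lam = 2 * e / lam * (d / ln d) by rewrite /Rdiv; ring.
      by apply: Rmult_le_compat_l => //; rewrite /Rdiv; nra.
    lra.
  have -> : (1 + eps) * (d / t) = d / t + eps * (d / t) by ring.
  have : e * (7 + 2 / lam) * (d / t) <= eps * (d / t) by apply: Rmult_le_compat_r; lra.
  have -> : e * (7 + 2 / lam) * (d / t) = (e + 2 * e / lam) * (d / t) + 6 * e * (d / t).
    by rewrite /Rdiv; ring.
  lra.
- move=> V adj A hG.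
  have Z1 := Zs_ge1 adj A (Rlt_le _ _ l0).
  have hS := Zsize_lower adj tau A (Rlt_le _ _ l0).
  have g : (1 + 2 * e) * (Zs adj lam A - Zlt adj lam tau A) <= gamma * Zsize adj lam A.
    have -> : 1 + 2 * e = gamma * INR tau by rewrite /gamma; field; lra.
    rewrite Rmult_assoc; apply: Rmult_le_compat_l => //.
    by apply: Rmult_le_pos; [lra | left; apply: Rinv_0_lt_compat; lra].
  have eb : (beta - 1) * lam = 2 * (e * d / ln d) by rewrite /beta; field; lra.
  case: (dich V adj A hG) => hl.
    rewrite eb; have : 0 <= e * d / ln d by rewrite edl; nra.
    have : (1 + 2 * e) * Zlt adj lam tau A <= (1 + 2 * e) * (e * d / ln d).
      by apply: Rmult_le_compat_l; lra.
    nra.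
  have : 0 <= (beta - 1) * lam by apply: Rmult_le_pos; lra.
  have : (1 + 2 * e) * Zlt adj lam tau A <= (1 + 2 * e) * (e * Zs adj lam A).
    by apply: Rmult_le_compat_l; lra.
  have : 0 <= e * (1 - 2 * e) * Zs adj lam A by apply: Rmult_le_pos; [nra | lra].
  lra.
Qed.

Section HardCore.
Variables (V : finType) (adj : rel V).
Hypothesis adj_sym : forall x y, adj x y = adj y x.
Hypothesis adj_irr : forall x, adj x x = false.
Variable lam : R.
Hypothesis lam0 : 0 < lam.

Definition nbrs (u : V) : {set V} := [set v | adj u v].

(** With [F] the set of available neighbours, the random set inside the closed neighbourhood of [u]
    is [{u}], of weight [lam], or an independent set of [F]. The inequality is
    [beta P(u in I) + gamma E|I /\ N(u)| >= 1] for this conditional distribution, with denominators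
    cleared. *)
Definition local_occupancy (u : V) (beta gamma : R) :=
  forall F : {set V}, F \subset nbrs u ->
    Zs adj lam F <= (beta - 1) * lam + gamma * Zsize adj lam F.

(** Fix the random set outside the closed neighbourhood of [u]. Then [u] is still available, the
    only independent set containing it is [{u}], and all others lie in a subset of [nbrs u], where
    local occupancy applies. *)
Lemma hardcore_local_occupancy (A : {set V}) u beta gamma :
  u \in A -> local_occupancy u beta gamma ->
  Zs adj lam A <=
    \big[Rplus/0]_(I : {set V} | (I \subset A) && independent adj I)
      ((beta * INR (u \in I) + gamma * INR #|I :&: nbrs u|) * lam ^ #|I|).
Proof.
move=> uA lo.
suff : 0 <= \big[Rplus/0]_(I : {set V} | (I \subset A) && independent adj I)
      ((beta * INR (u \in I) + gamma * INR #|I :&: nbrs u| - 1) * lam ^ #|I|).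
  rewrite (eq_bigr (fun I : {set V} => (beta * INR (u \in I) + gamma * INR #|I :&: nbrs u|)
     * lam ^ #|I| + (- 1) * lam ^ #|I|)); last by move=> I _; ring.
  rewrite big_split /= -big_distrr /= -/(Zs adj lam A); lra.
rewrite (indep_sum_split adj_sym _ A (u |: nbrs u)).
apply: Rsum_ge0 => J /andP[sJ iJ].
set X := avail _ _ _.
have uB : u \in u |: nbrs u by rewrite !inE eqxx.
have nJ w : w \in J -> (w \in A) && (w \notin u |: nbrs u).
  by move=> /(subsetP sJ); rewrite inE andbC.
have XB w : w \in X -> (w \in A) && (w \in u |: nbrs u).
  by case/availP; rewrite inE.
have uX : u \in X.
  apply/availP; rewrite inE uA uB; split=> // w /nJ /andP[_].
  by rewrite !inE negb_or => /andP[].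
rewrite (eq_bigr (fun T : {set V} => lam ^ #|J| *
   ((beta * INR (u \in T) + gamma * INR #|T :&: nbrs u| - 1) * lam ^ #|T|))); last first.
  move=> T /andP[sT iT].
  have dJT : [disjoint J & T].
    rewrite disjoint_subset; apply/subsetP => w /nJ /andP[_ wB]; rewrite inE.
    by apply: contra wB => /(subsetP sT) /XB /andP[].
  have uJ : (u \in J) = false by apply/negP => /nJ /andP[_]; rewrite uB.
  have JN : J :&: nbrs u = set0.
    apply/setP => w; rewrite inE [RHS]inE; apply/negP => /andP[/nJ /andP[_ h] wN].
    by move: h; rewrite !inE negb_or => /andP[_]; rewrite inE in wN; rewrite wN.
  rewrite inE uJ /= setIUl JN set0U cardsU (disjoint_setI0 dJT) cards0 subn0 pow_add; ring.
rewrite -big_distrr /=; apply: Rmult_le_pos; first by apply: pow_le; lra.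
rewrite (bigD1 [set u]) /=; last first.
  by rewrite sub1set uX /=; apply/indepP => x y /set1P -> /set1P ->; rewrite adj_irr.
have -> : [set u] :&: nbrs u = set0.
  by apply/setP => w; rewrite !inE; apply/negP => /andP[/eqP ->]; rewrite adj_irr.
rewrite inE eqxx cards0 cards1 /=.
have sXN : X :\ u \subset nbrs u.
  by apply/subsetP => w; rewrite inE in_set1 => /andP[wu /XB /andP[_]]; rewrite in_setU1 (negPf wu).
have := lo _ sXN.
rewrite (eq_bigl (fun T : {set V} => (T \subset X :\ u) && independent adj T)); last first.
  move=> T; rewrite subsetD1; case: (boolP (T \subset X)) => //= sT.
  case: (boolP (independent adj T)) => iT; rewrite ?andbF //= andbT.
  case: (boolP (u \in T)) => uT /=; last first.
    by apply/eqP => e; move: uT; rewrite e inE eqxx.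
  apply/negbTE; rewrite negbK eqEsubset sub1set uT andbT.
  apply/subsetP => w wT; rewrite inE; apply/negPn/negP => wu.
  have /XB /andP[_] := subsetP sT _ wT; rewrite !inE (negPf wu) /= => uw.
  by move/indepP: iT => /(_ u w uT wT); rewrite uw.
rewrite (eq_bigr (fun T : {set V} => gamma * (INR #|T| * lam ^ #|T|) + (- 1) * lam ^ #|T|)).
  by rewrite big_split /= -!big_distrr /= -/(Zs _ _ _) -/(Zsize _ _ _); lra.
move=> T /andP[sT iT].
have -> : (u \in T) = false by apply/negP => /(subsetP sT); rewrite !inE eqxx.
have -> : T :&: nbrs u = T by apply/setIidPl; apply: subset_trans sT sXN.
rewrite /=; ring.
Qed.

End HardCore.

(** * Occupancy fraction and greedy fractional colouring *)

Section Occupancy.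
Variables (V : finType) (adj : rel V).
Hypothesis adj_sym : forall x y, adj x y = adj y x.
Hypothesis adj_irr : forall x, adj x x = false.
Variable lam : R.
Hypothesis lam0 : 0 < lam.

Lemma leq_maxdeg u : (deg adj u <= maxdeg adj)%nat.
Proof. exact: (leq_bigmax (F := deg adj)). Qed.

Lemma sum_INR_mem (I : {set V}) (P : pred V) :
  \big[Rplus/0]_(u | P u) INR (u \in I) = INR #|[set u in I | P u]|.
Proof.
rewrite -INR_sum -big_mkcondr /= sum1_card; congr INR.
by apply: eq_card => u; rewrite !inE unfold_in andbC.
Qed.

(** Sum over all [u] and exchange the sums: each vertex of [I] lies in at most [maxdeg adj]
    neighbourhoods. *)
Lemma Zsize_lower_of_local_occupancy beta gamma : 0 <= gamma ->
  (forall u, local_occupancy adj lam u beta gamma) ->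
  INR #|V| * ZG adj lam <= (beta + gamma * INR (maxdeg adj)) * (lam * ZG' adj lam).
Proof.
move=> g0 lo.
have eZ : ZG adj lam = Zs adj lam setT.
  by apply: eq_bigl => I; rewrite subsetT.
have eZ' : lam * ZG' adj lam = Zsize adj lam setT.
  rewrite /ZG' big_distrr /=; apply: eq_big => I; first by rewrite subsetT.
  case: #|I| => [|n] _; first by rewrite /=; ring.
  by rewrite subSS subn0 /=; ring.
rewrite eZ eZ' -(Rsum_const predT).
apply: (Rle_trans _ (\big[Rplus/0]_(u : V)
   \big[Rplus/0]_(I : {set V} | (I \subset setT) && independent adj I)
      ((beta * INR (u \in I) + gamma * INR #|I :&: nbrs adj u|) * lam ^ #|I|))).
  by apply: Rsum_le => u _; apply: hardcore_local_occupancy.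
rewrite exchange_big /= /Zsize big_distrr /=; apply: Rsum_le => I _.
rewrite -big_distrl /= -Rmult_assoc; apply: Rmult_le_compat_r; first by apply: pow_le; lra.
rewrite big_split /= -!big_distrr /= sum_INR_mem Rmult_plus_distr_r.
have -> : [set u in I | true] = I by apply/setP => u; rewrite inE andbT.
apply: Rplus_le_compat_l; rewrite Rmult_assoc; apply: Rmult_le_compat_l => //.
rewrite -INR_sum -mult_INR; apply: INR_leq.
apply: (@leq_trans (\sum_(u : V) \sum_(v in I) (adj u v))%nat).
  apply: leq_sum => u _; rewrite -big_mkcondr /= sum1_card; apply: subset_leq_card.
  by apply/subsetP => v; rewrite !inE unfold_in.
rewrite exchange_big /= -[X in (_ <= X)%nat]/(muln (maxdeg adj) #|I|) mulnC -sum_nat_const.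
apply: leq_sum => v _.
apply: leq_trans (leq_maxdeg v); rewrite -big_mkcond /= sum1_card; apply: subset_leq_card.
by apply/subsetP => u; rewrite inE unfold_in adj_sym.
Qed.

End Occupancy.

(** * Laying out a fractional colouring as consecutive intervals *)

Section Pieces.
Variables (V : finType) (adj : rel V).

(* A list of pieces [(I, l)] describes consecutive half-open intervals, the one of length [l]
   being given to [I]. *)
Fixpoint ivs (tau : R) (s : seq ({set V} * R)) (I : {set V}) : list (R * R) :=
  if s is (J, l) :: s' then
    if J == I then (tau, tau + l) :: ivs (tau + l) s' I else ivs (tau + l) s' I
  else nil.

Fixpoint ends_ok (B : V -> R) (tau : R) (s : seq ({set V} * R)) : Prop :=
  if s is (J, l) :: s' then
    (forall v, v \in J -> tau + l <= B v) /\ ends_ok B (tau + l) s'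
  else True.

Definition mass (s : seq ({set V} * R)) (v : V) : R :=
  \big[Rplus/0]_(p <- s) (if v \in p.1 then p.2 else 0).

Definition total (s : seq ({set V} * R)) : R := \big[Rplus/0]_(p <- s) p.2.

Definition pieces_ok (U : {set V}) (s : seq ({set V} * R)) :=
  forall p, p \in map fst s -> (p \subset U) && independent adj p.

Fixpoint nonneg_lengths (s : seq ({set V} * R)) : Prop :=
  if s is p :: s' then 0 <= p.2 /\ nonneg_lengths s' else True.

Lemma in_ivs_cons (p : R * R) s x :
  in_ivs (p :: s)%SEQ x <-> (fst p <= x < snd p \/ in_ivs s x).
Proof.
split=> [[q [[<-|qs] hq]]|[hp|[q [qs hq]]]]; first by left.
- by right; exists q.
- by exists p; split=> //; left.
- by exists q; split=> //; right.
Qed.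

Lemma in_ivs_ge tau s I x : nonneg_lengths s -> in_ivs (ivs tau s I) x -> tau <= x.
Proof.
elim: s tau => [|[J l] s IH] tau /=; first by move=> _ [p [[]]].
move=> [l0 hs]; case: eqP => _; last by move/(IH _ hs); lra.
by move/in_ivs_cons => [/= []|/(IH _ hs)]; lra.
Qed.

Lemma in_ivs_lt B tau s (I : {set V}) x v : ends_ok B tau s -> v \in I ->
  in_ivs (ivs tau s I) x -> x < B v.
Proof.
move=> hs vI; elim: s tau hs => [|[J l] s IH] tau /=; first by move=> _ [p [[]]].
move=> [h1 h2]; case: eqP => [e|_]; last exact: IH.
move/in_ivs_cons => [/= [_ xl]|]; last exact: IH.
by have := h1 v; rewrite e => /(_ vI); lra.
Qed.

Lemma ivs_disjoint tau s I J x : nonneg_lengths s -> I <> J ->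
  in_ivs (ivs tau s I) x -> in_ivs (ivs tau s J) x -> False.
Proof.
move=> + IJ; elim: s tau => [|[K l] s IH] tau /=; first by move=> _ [p [[]]].
move=> [l0 hs]; case: eqP => [e1|_]; case: eqP => [e2|_].
- by case: IJ; rewrite -e1 -e2.
- move/in_ivs_cons => [/= [h1 h2] /(in_ivs_ge hs)|]; [lra | exact: IH].
- move=> h; move/in_ivs_cons => [/= [h1 h2]|]; last by apply: IH.
  by move/(in_ivs_ge hs): h; lra.
- exact: IH.
Qed.

Lemma ivs_wf_ivs tau s I : 0 <= tau -> nonneg_lengths s -> ivs_wf (ivs tau s I).
Proof.
move=> + hs; elim: s tau hs => [|[K l] s IH] tau /= hs tau0; first by split=> // p [].
have {IH} [||IH1 IH2] := IH (tau + l); [by case: hs | by case: hs => /=; lra |].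
case: eqP => _; last by [].
have l0 : 0 <= l by case: hs.
have tl (j : nat) x : (j < length (ivs (tau + l) s I))%nat ->
    in_ivs (List.nth j (ivs (tau + l) s I) (0, 0) :: nil)%list x -> tau + l <= x.
  move=> hj /in_ivs_cons [h|[? [[]]]]; apply: (@in_ivs_ge _ s I); first by case: hs.
  by exists (List.nth j (ivs (tau + l) s I) (0, 0)); split=> //; apply: List.nth_In; lia.
split=> [p [<-|/IH1 //]|]; first by rewrite /=; lra.
move=> [|i] [|j] //= hi hj ij x [].
- move=> /in_ivs_cons [/= h|[? [[]]]] // /tl; move/(_ hj); lra.
- move=> h /in_ivs_cons [/= h'|[? [[]]]] //; move/tl: h => /(_ hi); lra.
- by move=> h1 h2; apply: (IH2 i j _ _ _ x) => // e; apply: ij; rewrite e.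
Qed.

Lemma ivs_mass tau s v :
  \big[Rplus/0]_(I : {set V} | v \in I) ivs_len (ivs tau s I) = mass s v.
Proof.
elim: s tau => [|[J l] s IH] tau; rewrite /mass; first by rewrite big_nil big1.
rewrite big_cons -/(mass s v) -(IH (tau + l)).
rewrite (eq_bigr (fun I => (if J == I then l else 0) + ivs_len (ivs (tau + l) s I))); last first.
  by move=> I _ /=; case: eqP => _ /=; lra.
rewrite big_split /=; congr (_ + _); rewrite -big_mkcondr /=.
case: ifP => vJ.
  by rewrite (big_pred1 J) // => I /=; rewrite eq_sym; case: eqP => [->|]; rewrite ?vJ ?andbF.
by rewrite big1 // => I /andP[vI /eqP e]; move: vJ; rewrite e vI.
Qed.

Lemma ends_ok_cat B tau s1 s2 :
  ends_ok B tau s1 -> ends_ok B (tau + total s1) s2 -> ends_ok B tau (s1 ++ s2).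
Proof.
elim: s1 tau => [|[J l] s1 IH] tau /=; first by rewrite /total big_nil Rplus_0_r.
move=> [h1 h2] h3; split=> //; apply: IH => //.
by rewrite Rplus_assoc; rewrite /total big_cons in h3.
Qed.

Lemma total_ge0 s : nonneg_lengths s -> 0 <= total s.
Proof.
elim: s => [|p s IH] /=; rewrite /total ?big_nil ?big_cons; first lra.
by move=> [h /IH]; rewrite /total; lra.
Qed.

Lemma ends_ok_total B tau s : nonneg_lengths s ->
  (forall (J : {set V}) v, J \in map fst s -> v \in J -> tau + total s <= B v) -> ends_ok B tau s.
Proof.
elim: s tau => [|[J l] s IH] tau //= [l0 hs] h.
have t0 := total_ge0 hs.
have e : total ((J, l) :: s) = l + total s by rewrite /total big_cons.
split=> [v vJ|].
  by have := h J v; rewrite inE eqxx e => /(_ isT vJ); lra.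
by apply: IH => // K v Ks vK; have := h K v; rewrite inE Ks orbT e => /(_ isT vK); lra.
Qed.

Lemma frac_colouring_of_pieces U B s : nonneg_lengths s -> pieces_ok U s ->
  (forall v, mass s v = 1) -> ends_ok B 0 s ->
  exists w, frac_colouring adj w /\
    forall u x, colour_of w u x -> 0 <= x < B u.
Proof.
move=> hs ps ms es; exists (ivs 0 s); split; last first.
  by move=> u x [I [uI hx]]; split; [apply: in_ivs_ge hx | apply: in_ivs_lt hx].
split; [|split; [|split]].
- move=> I iI; move: ps; rewrite /pieces_ok; generalize 0.
  elim: (s) => [|[J l] s' IH] tau //= ps.
  rewrite IH; last by move=> p ps'; apply: ps; rewrite inE ps' orbT.
  case: eqP => // e; move: (ps J); rewrite inE eqxx e => /(_ isT).
  by rewrite (negPf iI) andbF.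
- by move=> I; apply: ivs_wf_ivs => //; lra.
- by move=> I J IJ x [h1 h2]; apply: (ivs_disjoint hs IJ h1 h2).
- by move=> v; rewrite ivs_mass.
Qed.

End Pieces.

Lemma exists_argmin (T : finType) (A : {set T}) (f : T -> R) : A != set0 ->
  exists2 x, x \in A & forall y, y \in A -> f x <= f y.
Proof.
have [n] := ubnP #|A|; elim: n A => // n IH A; rewrite ltnS => cA /set0Pn[x xA].
case: (boolP (A :\ x == set0)) => [/eqP e|ne].
  exists x => // y yA; case: (eqVneq y x) => [->|yx]; first lra.
  by have : y \in A :\ x; [rewrite !inE yx | rewrite e inE].
have [|z] := IH (A :\ x) _ ne.
  by apply: leq_trans cA; rewrite [X in (_ < X)%nat](cardsD1 x) xA.
rewrite !inE => /andP[zx zA] hz.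
case: (Rle_lt_dec (f x) (f z)) => h; [exists x | exists z] => // y yA;
  case: (eqVneq y x) => [->|yx]; try lra;
  by have := hz y; rewrite !inE yx yA => /(_ isT); lra.
Qed.

(** * Greedy fractional colouring by hard-core measures *)

Section Greedy.
Variables (V : finType) (adj : rel V).
Hypothesis adj_sym : forall x y, adj x y = adj y x.
Hypothesis adj_irr : forall x, adj x x = false.
Variables (lam : R) (beta gamma B : V -> R).
Hypothesis lam0 : 0 < lam.
Hypothesis beta0 : forall u, 0 <= beta u.
Hypothesis gamma0 : forall u, 0 <= gamma u.
Hypothesis lo : forall u, local_occupancy adj lam u (beta u) (gamma u).
Hypothesis hB : forall u, beta u + gamma u * INR (deg adj u) <= B u.

Let nbr_sum (c : V -> R) v := \big[Rplus/0]_(u in nbrs adj v) c u.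

(** Here [c v] is the measure received by [v] so far, [tau] the length already used and [U] the set
    of unsaturated vertices. A round gives each independent [I] inside [U] an interval of length
    [h * lam ^ #|I|], with [h] the largest value for which no vertex overshoots, so some vertex
    leaves [U]. By local occupancy, [beta v * c v + gamma v * nbr_sum c v] grows for every [v] in
    [U] by at least the length of the round, hence stays above [tau]. It never exceeds
    [beta v + gamma v * deg v], so no interval given to [v] ends beyond [B v]. *)
Lemma greedy_pieces n (U : {set V}) (c : V -> R) tau : (#|U| < n)%nat -> 0 <= tau ->
  (forall v, 0 <= c v <= 1) -> (forall v, v \in U <-> c v < 1) ->
  (forall v, v \in U -> tau <= beta v * c v + gamma v * nbr_sum c v) ->
  exists s, [/\ nonneg_lengths s, pieces_ok adj U s, ends_ok B tau s &
    forall v, c v + mass s v = 1].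
Proof.
elim: n U c tau => // n IH U c tau; rewrite ltnS => cU tau0 c01 hU ht.
case: (boolP (U == set0)) => [/eqP U0|UN0].
  exists [::]; split=> // v; rewrite /mass big_nil.
  case: (Rle_lt_or_eq_dec _ _ (proj2 (c01 v))) => [/hU|->]; [by rewrite U0 inE | lra].
pose P v := \big[Rplus/0]_(I : {set V} | (I \subset U) && independent adj I && (v \in I))
   lam ^ #|I|.
have P0 v : 0 <= P v by apply: Rsum_ge0 => I _; apply: pow_le; lra.
have Ppos v : v \in U -> 0 < P v.
  move=> vU; apply: (Rlt_le_trans _ (lam ^ #|[set v]|)); first exact: pow_lt.
  apply: (Rsum_ge_term (F := fun I : {set V} => lam ^ #|I|)).
    by move=> *; apply: pow_le; lra.
  rewrite sub1set vU inE eqxx andbT /=; apply/indepP => x y /set1P -> /set1P ->.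
  by rewrite adj_irr.
have PnU v : v \notin U -> P v = 0.
  move=> vU; rewrite /P big1 // => I /andP[/andP[sI _] vI].
  by case/negP: vU; apply: (subsetP sI).
have [x xU hx] := exists_argmin (fun v => (1 - c v) / P v) UN0.
pose h := (1 - c x) / P x.
have h0 : 0 < h.
  by apply: Rdiv_lt_0_compat (Ppos _ xU); have /hU := xU; lra.
have hP v : v \in U -> h * P v <= 1 - c v.
  move=> vU; have Pv := Ppos v vU.
  have -> : 1 - c v = (1 - c v) / P v * P v by field; lra.
  by apply: Rmult_le_compat_r; [lra | apply: hx].
pose c' v := c v + h * P v.
have c'01 v : 0 <= c' v <= 1.
  have := c01 v; rewrite /c'; case: (boolP (v \in U)) => [vU|/PnU ->]; last by lra.
  by have := hP v vU; have := Ppos v vU; nra.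
pose U' := [set v in U | if Rlt_dec (c' v) 1 then true else false].
have hU' v : v \in U' <-> c' v < 1.
  rewrite inE; case: Rlt_dec => h1; rewrite ?andbT ?andbF; split=> // _.
  by apply/hU; move: h1; rewrite /c'; have := P0 v; nra.
have xU' : x \notin U'.
  apply/negP => /hU'; rewrite /c' /h; have Px := Ppos x xU.
  have -> : (1 - c x) / P x * P x = 1 - c x by field; lra.
  lra.
have sU' : U' \subset U by apply/subsetP => v; rewrite inE => /andP[].
have cU' : (#|U'| < n)%nat.
  apply: leq_trans cU; apply: proper_card; apply/properP; split=> //; by exists x.
pose tau' := tau + h * Zs adj lam U.
have Z1 := Zs_ge1 adj U (Rlt_le _ _ lam0).
have ht' v : v \in U -> tau' <= beta v * c' v + gamma v * nbr_sum c' v.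
  move=> vU; have := hardcore_local_occupancy adj_sym adj_irr lam0 vU (@lo v).
  rewrite (eq_bigr (fun I : {set V} => beta v * (if v \in I then lam ^ #|I| else 0) +
      gamma v * \big[Rplus/0]_(u in nbrs adj v) (if u \in I then lam ^ #|I| else 0))); last first.
    move=> I _; rewrite Rmult_plus_distr_r; congr (_ + _).
      by case: (v \in I) => /=; ring.
    rewrite Rmult_assoc; congr (_ * _); rewrite -big_mkcondr Rsum_const /=.
    by congr (INR _ * _); apply: eq_card => u; rewrite inE andbC.
  rewrite big_split /= -!big_distrr /= exchange_big /= -big_mkcondr /= -/(P v).
  rewrite (eq_bigr P); last by move=> u _; rewrite -big_mkcondr.
  move=> hZ; have := ht v vU; rewrite /tau' /nbr_sum /c' big_split /= -big_distrr /=.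
  have := Rmult_le_compat_l h _ _ (Rlt_le _ _ h0) hZ; nra.
have [s2 [n2 p2 e2 m2]] := IH U' c' tau' cU' ltac:(rewrite /tau'; nra) c'01 hU'
  (fun v vU' => ht' v (subsetP sU' v vU')).
pose indU : {pred {set V}} := fun I => (I \subset U) && independent adj I.
pose s1 := map (fun I : {set V} => (I, h * lam ^ #|I|)) (enum indU).
have n1 : nonneg_lengths s1.
  rewrite /s1; elim: (enum _) => [|I r IHr] //=; split=> //.
  by apply: Rmult_le_pos; [lra | apply: pow_le; lra].
have t1 : total s1 = h * Zs adj lam U.
  by rewrite /total big_map /= big_enum /= -big_distrr.
have m1 v : mass s1 v = h * P v.
  rewrite /mass big_map /= big_enum /= /P big_distrr /= [RHS]big_mkcondr /=.
  by apply: eq_big.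
have f1 (I : {set V}) : I \in map fst s1 -> (I \subset U) && independent adj I.
  by rewrite /s1 -map_comp map_id_in // mem_enum.
exists (s1 ++ s2); split.
- by elim: (s1) n1 => //= p r IHr [p0 /IHr].
- move=> I; rewrite map_cat mem_cat => /orP[/f1 //|/p2 /andP[sI ->]].
  by rewrite (subset_trans sI).
- apply: ends_ok_cat; last by rewrite t1.
  apply: ends_ok_total => // J v /f1 /andP[/subsetP sJ _] /sJ vU.
  rewrite t1 -/tau'; apply: Rle_trans (ht' v vU) _; apply: Rle_trans (hB v).
  apply: Rplus_le_compat.
    by have := c'01 v; have := beta0 v; nra.
  apply: Rmult_le_compat_l => //.
  rewrite /nbr_sum -[INR _]Rmult_1_r -/(nbrs adj v) -(Rsum_const (mem (nbrs adj v))).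
  by apply: Rsum_le => u _; have := c'01 u; lra.
- move=> v; rewrite -(m2 v) /mass big_cat -/(mass s1 v) m1 /c' /=; lra.
Qed.

Lemma greedy_frac_colouring :
  exists w, frac_colouring adj w /\ forall u x, colour_of w u x -> 0 <= x < B u.
Proof.
have [|||||s [ns ps es ms]] := @greedy_pieces #|V|.+1 setT (fun=> 0) 0.
- by rewrite cardsT.
- lra.
- by move=> v; lra.
- by move=> v; rewrite inE; split=> // _; lra.
- by move=> v _; rewrite /nbr_sum big1 //; lra.
apply: (frac_colouring_of_pieces ns ps _ es) => v.
by have := ms v; lra.
Qed.

End Greedy.

(** * Parts (1) and (2) *)

Lemma evt_nat P : evt P -> exists N : nat, forall n, (N <= n)%nat -> P (INR n).
Proof.
move=> [a ha]; have [N hN] := INR_unbounded a.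
by exists N => n /INR_leq h; apply: ha; lra.
Qed.

Lemma nbrs_graph_omega (V : finType) (adj : rel V) (om : V -> nat) (u : V) (k : nat)
    (F : {set V}) :
  simple_graph adj -> clique_bounded adj om -> (om u <= k)%nat ->
  F \subset nbrs adj u -> graph_omega adj k.-1 F.
Proof.
move=> [adj_sym adj_irr] [_ cb] hk /subsetP sF; split=> // S /subsetP sS cS.
have nS x : x \in S -> adj u x by move/sS/sF; rewrite inE.
have uS : u \notin S by apply/negP => /nS; rewrite adj_irr.
have := cb u (u |: S); rewrite in_setU1 eqxx cardsU1 uS add1n => /(_ isT) h.
suff : (#|S| < om u)%nat by move=> h2; have := leq_trans h2 hk; case: (k).
apply: h; apply/cliqueP => x y; rewrite !in_setU1 => /orP[/eqP->|xS] /orP[/eqP->|yS].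
- by rewrite eqxx.
- by move=> _; apply: nS.
- by move=> _; rewrite adj_sym; apply: nS.
- by move/cliqueP: cS; apply.
Qed.

Lemma INR_pred_om (om : nat) : (3 <= om)%nat -> INR om.-1 = INR om - 1.
Proof. by case: om => // n _; rewrite S_INR /=; lra. Qed.

Lemma rate_numerics d r : 1 < ln d -> (2 <= r)%nat -> 0 < ln (ln d) /\ 0 < ln (INR r) /\
  2 <= INR r.
Proof.
move=> l1 r2; split; first by rewrite -ln_1; apply: ln_increasing; lra.
by have := ln_nat_ge2 r2; split; [lra | apply: (@INR_leq 2)].
Qed.

Lemma fA_rate om d : (3 <= om)%nat -> 1 < ln d -> fA (INR om) d = d / tA d om.-1.
Proof.
move=> om3 l1; have [ll [lr r2]] := rate_numerics (r := om.-1) l1 ltac:(lia).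
rewrite /fA /tA; rewrite INR_pred_om // in r2 *.
by field; lra.
Qed.

Lemma fB_rate om d : (3 <= om)%nat -> 1 < ln d -> fB (INR om) d = d / tB d om.-1.
Proof.
move=> om3 l1; have [ll [lr r2]] := rate_numerics (r := om.-1) l1 ltac:(lia).
rewrite /fB /tB; rewrite INR_pred_om // in r2 lr *.
have s1 := sqrt_lt_R0 _ lr; have s2 : 0 < sqrt (ln d) by apply: sqrt_lt_R0; lra.
rewrite !sqrt_div_alt //; last lra.
by field; lra.
Qed.

Lemma smaller_bound_rate (om : nat) d : (3 <= om)%nat -> 1 < ln d ->
  exists t, is_rate t d om.-1 /\ Rmin (fA (INR om) d) (fB (INR om) d) = d / t.
Proof.
move=> om3 l1; rewrite fA_rate // fB_rate // /Rmin; case: Rle_dec => _.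
  by exists (tA d om.-1); split=> //; left.
by exists (tB d om.-1); split=> //; right.
Qed.

Lemma occupancy_lower_bound lam eps : 0 < lam -> 0 < eps ->
  exists D0 : nat,
  forall (V : finType) (adj : rel V) (om : V -> nat),
    simple_graph adj -> clique_bounded adj om -> (D0 <= maxdeg adj)%nat ->
    (1 - eps) * bound1 (INR (maxdeg adj)) (INR (omega_max om))
      <= / INR #|V| * (lam * ZG' adj lam / ZG adj lam).
Proof.
move=> l0 e0.
have [N HN] := evt_nat (evt_and (local_occupancy_parameters l0 e0)
  (evt_and rate_bounds (evt_comp to_infty_ln (evt_ge 2)))).
exists N.+1 => V adj om sg cb hD.
have [hpar [hr l2]] := HN _ (ltnW hD).
set D := INR (maxdeg adj) in hpar hr l2 *.
have D0 : 0 < D by apply: (@INR_ltn 0); lia.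
have [v _] : exists v : V, true.
  case: (pickP (mem [set: V])) => [v _|h]; first by exists v.
  move: hD; rewrite /maxdeg big_pred0 // => v; have := h v.
  by rewrite /= in_setT.
have om3 : (3 <= omega_max om)%nat.
  by apply: leq_trans (proj1 cb v) _; apply: (leq_bigmax (F := om)).
have V0 : 0 < INR #|V| by apply: (@INR_ltn 0); apply/card_gt0P; exists v.
set om' := omega_max om in om3 *.
have om2 : (2 <= om'.-1)%nat by lia.
have [adj_sym adj_irr] := sg.
have Z1 : 1 <= ZG adj lam.
  have -> : ZG adj lam = Zs adj lam setT by apply: eq_bigl => I; rewrite subsetT.
  by apply: Zs_ge1; lra.
have main t : is_rate t D om'.-1 -> (1 - eps) * (t / D) <=
    / INR #|V| * (lam * ZG' adj lam / ZG adj lam).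
  move=> ht; have [t0 _] := hr _ _ om2 ht.
  have [be [ga [be0 ga0 hbg lo]]] := hpar _ _ om2 ht.
  have := Zsize_lower_of_local_occupancy adj_sym adj_irr l0 ga0 (beta := be).
  move=> /(_ _) h; have {h} := h (fun u F sF => lo V adj F (nbrs_graph_omega sg cb
     (leq_bigmax (F := om) u) sF)).
  set X := lam * ZG' _ _; rewrite -/D => h.
  have Dt0 : 0 < D / t by apply: Rdiv_lt_0_compat.
  have X0 : 0 <= X.
    apply: Rmult_le_pos; first lra; apply: Rsum_ge0 => I _.
    by apply: Rmult_le_pos; [apply: pos_INR | apply: pow_le; lra].
  have h2 : INR #|V| * ZG adj lam <= (1 + eps) * (D / t) * X.
    by apply: Rle_trans h _; apply: Rmult_le_compat_r.
  have VZ : 0 < INR #|V| * ZG adj lam by apply: Rmult_lt_0_compat; lra.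
  apply: (Rmult_le_reg_r (INR #|V| * ZG adj lam)) => //.
  have -> : / INR #|V| * (X / ZG adj lam) * (INR #|V| * ZG adj lam) = X by field; lra.
  have tD0 : 0 < t / D by apply: Rdiv_lt_0_compat.
  case: (Rle_lt_dec eps 1) => e1; last first.
    suff : 0 <= (eps - 1) * (t / D) * (INR #|V| * ZG adj lam) by lra.
    by apply: Rmult_le_pos; [apply: Rmult_le_pos|]; lra.
  apply: (Rle_trans _ ((1 - eps) * (t / D) * ((1 + eps) * (D / t) * X))).
    by apply: Rmult_le_compat_l => //; apply: Rmult_le_pos; lra.
  have -> : (1 - eps) * (t / D) * ((1 + eps) * (D / t) * X) = (1 - eps * eps) * X by field; lra.
  nra.
have [ll [lr r2]] := rate_numerics (d := D) (r := om'.-1) ltac:(lra) ltac:(lia).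
rewrite INR_pred_om // in r2 lr.
rewrite /bound1 /Rmax; case: Rle_dec => _.
  have := main _ (or_intror erefl); rewrite /tB INR_pred_om //.
  suff -> : 1 / (2 * D) * sqrt (ln D / ln (INR om' - 1)) =
    / 2 * sqrt (ln D / ln (INR om' - 1)) / D by [].
  by field; lra.
have := main _ (or_introl erefl); rewrite /tA INR_pred_om //.
suff -> : ln D / ((INR om' - 2) * D * ln (ln D)) =
   ln D / ((INR om' - 1 - 1) * ln (ln D)) / D by [].
by field; lra.
Qed.

(** Degrees are raised to [d u] to keep them above the threshold: part (2) takes the maximum of the
    degree and [delta0], the bound on [chi_f] the maximum degree everywhere. *)
Lemma local_frac_colouring eps : 0 < eps ->
  exists delta0 : R,
  forall (V : finType) (adj : rel V) (om : V -> nat) (d : V -> R),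
    simple_graph adj -> clique_bounded adj om ->
    (forall u, INR (deg adj u) <= d u /\ delta0 <= d u) ->
    exists w, frac_colouring adj w /\
      forall u x, colour_of w u x ->
        0 <= x < (1 + eps) * Rmin (fA (INR (om u)) (d u)) (fB (INR (om u)) (d u)).
Proof.
move=> e0; have l0 : 0 < 1 by lra.
have [a ha] := evt_and (local_occupancy_parameters l0 e0) (evt_comp to_infty_ln (evt_ge 2)).
exists a => V adj om d sg cb hd.
have [adj_sym adj_irr] := sg.
have par u : exists bg : R * R, [/\ 0 <= bg.1, 0 <= bg.2,
   bg.1 + bg.2 * INR (deg adj u) <= (1 + eps) * Rmin (fA (INR (om u)) (d u)) (fB (INR (om u)) (d u))
   & local_occupancy adj 1 u bg.1 bg.2].
  have [hdu du] := hd u; have [hpar l2] := ha _ du.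
  have om3 := proj1 cb u.
  have [t [ht ->]] := smaller_bound_rate om3 (d := d u) ltac:(lra).
  have om2 : (2 <= (om u).-1)%nat by lia.
  have [be [ga [be0 ga0 hbg lo]]] := hpar _ _ om2 ht.
  exists (be, ga); split=> //=.
    by apply: Rle_trans hbg; apply: Rplus_le_compat_l; apply: Rmult_le_compat_l.
  by move=> F sF; apply: lo; apply: nbrs_graph_omega sg cb _ sF.
have [bg hbg] := fin_all_exists par.
apply: (greedy_frac_colouring adj_sym adj_irr (lam := 1) (beta := fun u => (bg u).1)
  (gamma := fun u => (bg u).2)) => // u; by case: (hbg u).
Qed.

Lemma ivs_wf_nil : ivs_wf nil.
Proof. by split=> [p []|i j]. Qed.

(* What is given to [set0] colours no vertex, hence is not bounded by the local intervals. *)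
Lemma frac_colouring_erase (V : finType) (adj : rel V) w : frac_colouring adj w ->
  frac_colouring adj (fun I => if I == set0 then nil else w I).
Proof.
move=> [h1 [h2 [h3 h4]]]; split; [|split; [|split]].
- by move=> I /h1 ->; case: ifP.
- by move=> I; case: ifP => // _; apply: ivs_wf_nil.
- move=> I J IJ x; case: ifP => _; first by case=> [[p [[]]]].
  by case: ifP => _; [case=> [_ [p [[]]]] | apply: h3].
- move=> v; rewrite -[RHS](h4 v); apply: eq_bigr => I vI.
  by case: eqP => // e; move: vI; rewrite e inE.
Qed.

Lemma frac_colouring_max eps : 0 < eps ->
  exists D0 : nat,
  forall (V : finType) (adj : rel V) (om : V -> nat),
    simple_graph adj -> clique_bounded adj om -> (D0 <= maxdeg adj)%nat ->
    forall r : R, is_chi_f adj r ->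
      r <= (1 + eps) * Rmin (fA (INR (omega_max om)) (INR (maxdeg adj)))
                            (fB (INR (omega_max om)) (INR (maxdeg adj))).
Proof.
move=> e0; have [d0 hd0] := local_frac_colouring e0.
have [N HN] := evt_nat (evt_ge d0); exists N => V adj om sg cb hD r [_]; apply.
have cb' : clique_bounded adj (fun=> omega_max om) \/ #|V| = 0%nat.
  case: (posnP #|V|) => V0; [by right | left].
  have omu u : (om u <= omega_max om)%nat by apply: (leq_bigmax (F := om)).
  split=> [u|u S uS cS]; first exact: leq_trans (proj1 cb u) (omu u).
  exact: leq_trans (proj2 cb u S uS cS) (omu u).
have {cb'} [w [hw hx]] : exists w, frac_colouring adj w /\ forall (u : V) x, colour_of w u x ->
   0 <= x < (1 + eps) * Rmin (fA (INR (omega_max om)) (INR (maxdeg adj)))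
                            (fB (INR (omega_max om)) (INR (maxdeg adj))).
  case: cb' => [cb'|V0].
    have [|w hw] := hd0 V adj _ (fun=> INR (maxdeg adj)) sg cb'; last by exists w.
    by move=> u; split; [apply: INR_leq; apply: leq_maxdeg | apply: HN].
  have nV (v : V) : False by have := card0_eq V0 v; rewrite inE.
  exists (fun=> nil); split=> [|u]; last by case: (nV u).
  split=> //; split; last split; last by move=> v; case: (nV v).
  - by move=> I; apply: ivs_wf_nil.
  - by move=> I J IJ x [[p [[]]]].
exists (fun I => if I == set0 then nil else w I); split; first exact: frac_colouring_erase.
move=> I x; case: eqP => [_ [p [[]]]|/eqP/set0Pn[v vI] h].
by have [] := hx v x; first by exists I.
Qed.

(** * The lopsided local lemma and independent transversals *)

Section LocalLemma.
Variables (O T : finType) (Om : {set O}) (bad : T -> {set O}).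

Definition avoiding (S : {set T}) : {set O} :=
  [set o in Om | [forall t in S, o \notin bad t]].

Lemma avoidingP (S : {set T}) o :
  reflect (o \in Om /\ forall t, t \in S -> o \notin bad t) (o \in avoiding S).
Proof. by rewrite inE; apply: (iffP andP) => -[h /forall_inP]. Qed.

Variables (Gam : T -> {set T}) (q D : nat).
Hypothesis Om0 : (0 < #|Om|)%nat.
Hypothesis cardG : forall t, (#|Gam t| <= D)%nat.
Hypothesis q0 : (2 < q)%nat.
Hypothesis qD : (4 * D <= q)%nat.
Hypothesis cond : forall t (S : {set T}), [disjoint S & Gam t] ->
  (q * #|bad t :&: avoiding S| <= #|avoiding S|)%nat.

(** For a uniform element of [Om]: the probability of [bad t] given that [S] is avoided is at most
    [2 / q]. Given that [S2], the part of [S] outside [Gam t], is avoided, [bad t] has probability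
    at most [1 / q] by [cond], and by induction some event of [S1] occurs with probability at most
    [2 * D / q <= 1 / 2], so conditioning on [S1] as well costs at most a factor 2. *)
Lemma lopsided_conditional t (S : {set T}) :
  (q * #|bad t :&: avoiding S| <= 2 * #|avoiding S|)%nat.
Proof.
have [n] := ubnP #|S|; elim: n S t => // n IH S t; rewrite ltnS => cS.
pose S1 := S :&: Gam t; pose S2 := S :\: Gam t.
have dS2 : [disjoint S2 & Gam t].
  by rewrite -setI_eq0; apply/eqP/setP => x; rewrite !inE; case: (x \in Gam t); rewrite ?andbF.
have sub : avoiding S \subset avoiding S2.
  apply/subsetP => o /avoidingP[oO h]; apply/avoidingP; split=> // s.
  by rewrite inE => /andP[_ /h].
case: (eqVneq S1 set0) => [S10|S1N].
  have eS : S = S2.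
    by apply/setP => s; move/setP/(_ s): S10; rewrite !inE; case: (s \in S); case: (s \in Gam t).
  by move: (cond dS2); rewrite -eS; lia.
have cS2 : (#|S2| < n)%nat.
  apply: leq_trans cS; rewrite -(cardsID (Gam t) S) -/S1 -/S2.
  by rewrite -card_gt0 in S1N; lia.
have cov : (#|avoiding S2| <= #|avoiding S| + \sum_(v in S1) #|bad v :&: avoiding S2|)%nat.
  apply: (@leq_trans #|avoiding S :|: \bigcup_(v in S1) (bad v :&: avoiding S2)|); last first.
    by rewrite cardsU; apply: leq_trans (leq_subr _ _) _; rewrite leq_add2l leq_card_cup.
  apply: subset_leq_card; apply/subsetP => o oS2; rewrite in_setU.
  case: (boolP (o \in avoiding S)) => //= oS; apply/bigcupP.
  have /avoidingP[oO h2] := oS2.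
  have : ~~ [forall s in S, o \notin bad s].
    by apply: contra oS => h; rewrite inE oO.
  case/forall_inPn => s sS; rewrite negbK => os.
  exists s; last by rewrite inE os.
  by rewrite inE sS; apply/negPn/negP => sG; move: (h2 s); rewrite inE sG sS os => /(_ isT).
have bnd : (\sum_(v in S1) (q * #|bad v :&: avoiding S2|) <= D * (2 * #|avoiding S2|))%nat.
  apply: (@leq_trans (\sum_(v in S1) (2 * #|avoiding S2|))%nat).
    by apply: leq_sum => v _; apply: IH.
  rewrite sum_nat_const leq_mul2r; apply/orP; right.
  by apply: leq_trans (cardG t); apply: subset_leq_card; apply: subsetIr.
rewrite -big_distrr /= in bnd.
have half : (#|avoiding S2| <= 2 * #|avoiding S|)%nat by nia.
apply: leq_trans half; apply: leq_trans (cond dS2).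
by rewrite leq_mul2l; apply/orP; right; apply: subset_leq_card; apply: setIS.
Qed.

Lemma lopsided_local_lemma : exists2 o, o \in Om & forall t, o \notin bad t.
Proof.
suff H : forall n (S : {set T}), (#|S| = n)%nat -> (0 < #|avoiding S|)%nat.
  have /card_gt0P[o /avoidingP[oO h]] := H _ setT erefl.
  by exists o => // t; apply: h; rewrite inE.
elim=> [|n IH] S cS.
  have -> : S = set0 by apply/eqP; rewrite -cards_eq0 cS.
  have -> // : avoiding set0 = Om.
  apply/setP => o; apply/avoidingP/idP => [[] //|oO]; split=> // t; by rewrite inE.
have [t tS] : exists t, t \in S by apply/card_gt0P; rewrite cS.
have cS' : #|S :\ t| = n by move: cS; rewrite (cardsD1 t) tS; lia.
have pos := IH _ cS'.
have h := lopsided_conditional t (S :\ t).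
have : (#|avoiding (S :\ t)| <= #|bad t :&: avoiding (S :\ t)| + #|avoiding S|)%nat.
  apply: (@leq_trans #|(bad t :&: avoiding (S :\ t)) :|: avoiding S|); last first.
    by rewrite cardsU leq_subr.
  apply: subset_leq_card; apply/subsetP => o oS; rewrite in_setU in_setI oS andbT.
  case: (boolP (o \in bad t)) => //= ot; have /avoidingP[oO h2] := oS.
  apply/avoidingP; split=> // s sS; case: (eqVneq s t) => [->//|st].
  by apply: h2; rewrite !inE st.
nia.
Qed.

End LocalLemma.

Section Transversal.
Variables (V W : finType) (hadj : rel W) (pi : W -> V).
Hypothesis hadj_sym : forall x y, hadj x y = hadj y x.
Variables (V0 : {set V}) (L : V -> {set W}) (l d : nat).
Hypothesis l0 : (1 < l)%nat.
Hypothesis ld : (16 * d <= l)%nat.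
Hypothesis piL : forall u x, x \in L u -> pi x = u.
Hypothesis cardL : forall u, u \in V0 -> #|L u| = l.

Let valid (x y : W) :=
  [&& pi x \in V0, pi y \in V0, x \in L (pi x), y \in L (pi y), pi x != pi y & hadj x y].

Hypothesis degL : forall x, x \in L (pi x) -> pi x \in V0 ->
  (#|[set y | valid x y]| <= d)%nat.

Lemma valid_sym x y : valid x y = valid y x.
Proof.
rewrite /valid hadj_sym eq_sym.
by case: (pi x \in V0); case: (pi y \in V0); case: (x \in L _); case: (y \in L _).
Qed.

Lemma card_valid_at u :
  (#|[set p : W * W | valid p.1 p.2 && (pi p.1 == u)]| <= l * d)%nat.
Proof.
case: (boolP (u \in V0)) => uV; last first.
  rewrite (_ : [set _ | _] = set0) ?cards0 //; apply/setP => -[x y]; rewrite !inE /=.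
  by apply/negP => /andP[/and5P[h _ _ _ _] /eqP e]; rewrite -e h in uV.
apply: (@leq_trans #|\bigcup_(x in L u) ((fun y => (x, y)) @: [set y | valid x y])|).
  apply: subset_leq_card; apply/subsetP => -[x y]; rewrite inE /= => /andP[v /eqP e].
  apply/bigcupP; exists x; first by move: v; rewrite /valid e => /and5P[].
  by apply/imsetP; exists y; rewrite ?inE.
apply: leq_trans (leq_card_cup _ _) _.
rewrite -(cardL uV) -sum_nat_const; apply: leq_sum => x xu.
apply: leq_trans (leq_imset_card _ _) _; apply: degL; rewrite (piL xu) //.
Qed.

(** Choose a colour from each list uniformly. A conflicting pair is chosen with probability
    [1 / l^2], and the pairs sharing a vertex with it number at most [4 * l * d], so the local lemma
    asks for [16 * l * d <= l^2]. *)
Lemma independent_transversal : exists R : {set W},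
  [/\ forall x, x \in R -> pi x \in V0 /\ x \in L (pi x),
      forall u, u \in V0 -> exists2 x, x \in R & pi x = u,
      forall x y, x \in R -> y \in R -> pi x = pi y -> x = y &
      forall x y, x \in R -> y \in R -> pi x != pi y -> ~~ hadj x y].
Proof.
case: (eqVneq V0 set0) => [e|/set0Pn[u0 u0V]].
  exists set0; split=> [x|u|x y|x y]; rewrite ?inE //; by rewrite e inE.
have [w0 w0L] : exists w0, w0 \in L u0 by apply/card_gt0P; rewrite cardL //; lia.
pose Om : {set {ffun V -> W}} := [set f : {ffun V -> W} | [forall u in V0, f u \in L u]].
pose bad (p : W * W) : {set {ffun V -> W}} :=
  [set f : {ffun V -> W} | [&& valid p.1 p.2, f (pi p.1) == p.1 & f (pi p.2) == p.2]].
pose at_ u := [set p : W * W | valid p.1 p.2 && (pi p.1 == u)].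
pose swap (p : W * W) := (p.2, p.1).
pose touch u := at_ u :|: swap @: at_ u.
have ctouch u : (#|touch u| <= 2 * (l * d))%nat.
  apply: (@leq_trans (#|at_ u| + #|swap @: at_ u|)); first by rewrite cardsU leq_subr.
  have h1 := card_valid_at u; have h2 := leq_imset_card swap (at_ u).
  by rewrite -/(at_ u) in h1; lia.
have in_touch p u : valid p.1 p.2 -> (pi p.1 == u) || (pi p.2 == u) -> p \in touch u.
  move=> v /orP[h|h]; rewrite in_setU; first by rewrite inE v h.
  by apply/orP; right; apply/imsetP; exists (p.2, p.1); [rewrite inE /= valid_sym v h | case: p v h].
have [|||||f fOm fbad] := @lopsided_local_lemma _ _ Om bad
   (fun p => touch (pi p.1) :|: touch (pi p.2)) (l * l) (4 * (l * d)).
- apply/card_gt0P; exists [ffun u => odflt w0 [pick x in L u]]; rewrite inE.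
  apply/forall_inP => u uV; rewrite ffunE; case: pickP => //= h.
  by have := cardL uV; rewrite eq_card0 //; lia.
- move=> p; rewrite cardsU; apply: leq_trans (leq_subr _ _) _.
  by have := ctouch (pi p.1); have := ctouch (pi p.2); lia.
- nia.
- nia.
- move=> [x y] S dS /=.
  case: (boolP (valid x y)) => vxy; last first.
    rewrite (_ : bad (x, y) = set0) ?set0I ?cards0 ?muln0 //.
    by apply/setP => f; rewrite !inE /= (negPf vxy).
  have /and5P[xV yV xL yL /andP[xy hxy]] := vxy.
  pose u := pi x; pose v := pi y.
  (* Resampling: replacing the values at [u] and [v] of a bad [f] by any of the [l^2] pairs of
     colours affects no event of [S]. The map is injective because a bad [f] has prescribed values
     at [u] and [v]. *)
  pose upd (t : {ffun V -> W} * (W * W)) : {ffun V -> W} :=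
    [ffun z => if z == u then t.2.1 else if z == v then t.2.2 else t.1 z].
  rewrite -{1}(cardL xV) -(cardL yV) -cardsX mulnC -cardsX.
  set X := setX _ _.
  rewrite -(card_in_imset (f := upd) (D := mem X)); last first.
    move=> [f [a b]] [g [a' b']].
    rewrite !in_setX /= => /andP[/setIP[fb _] _] /andP[/setIP[gb _] _] /ffunP e.
    have ea := e u; rewrite !ffunE eqxx /= in ea.
    have eb := e v; rewrite !ffunE eqxx eq_sym (negPf xy) /= in eb.
    rewrite ea eb; congr (_, _); apply/ffunP => z.
    move: fb gb; rewrite !inE /= => /and3P[_ /eqP fx /eqP fy] /and3P[_ /eqP gx /eqP gy].
    have := e z; rewrite !ffunE /=; case: eqP => [->|_]; first by rewrite fx gx.
    by case: eqP => [->|_]; rewrite ?fy ?gy.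
  apply: subset_leq_card; apply/subsetP => _ /imsetP[[f [a b]] + ->].
  rewrite !in_setX /= => /andP[/setIP[_ /avoidingP[fO fS]] /andP[aL bL]].
  apply/avoidingP; split.
    rewrite inE; apply/forall_inP => z zV; rewrite ffunE /=.
    case: eqP => [->//|_]; case: eqP => [->//|_].
    by move: fO; rewrite inE => /forall_inP; apply.
  move=> p pS; apply: contra (fS p pS); rewrite !inE => /and3P[vp].
  have nt z : (z == u) || (z == v) -> ~~ ((pi p.1 == z) || (pi p.2 == z)).
    move=> hz; apply/negP => /(in_touch _ _ vp) pt.
    move: dS; rewrite disjoint_subset => /subsetP/(_ p pS); rewrite inE in_setU negb_or => /andP[h1 h2].
    by case/orP: hz => /eqP e; rewrite e in pt; [case/negP: h1 | case/negP: h2].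
  have := nt u; have := nt v; rewrite !eqxx orbT /= => /(_ isT) + /(_ isT).
  rewrite !negb_or => /andP[/negPf n1 /negPf n2] /andP[/negPf n3 /negPf n4].
  by rewrite !ffunE n1 n2 n3 n4 vp => -> ->.
exists [set f u | u in V0]; split.
- move=> _ /imsetP[u uV ->]; move: fOm; rewrite inE => /forall_inP/(_ u uV) h.
  by rewrite (piL h).
- move=> u uV; exists (f u); first by apply/imsetP; exists u.
  by move: fOm; rewrite inE => /forall_inP/(_ u uV) /piL.
- move=> _ _ /imsetP[u uV ->] /imsetP[v vV ->].
  move: fOm; rewrite inE => /forall_inP fOm.
  by rewrite (piL (fOm u uV)) (piL (fOm v vV)) => ->.
- move=> _ _ /imsetP[u uV ->] /imsetP[v vV ->].
  move: fOm; rewrite inE => /forall_inP fOm.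
  have fu := fOm u uV; have fv := fOm v vV.
  rewrite (piL fu) (piL fv) => uv; apply/negP => h.
  have := fbad (f u, f v); rewrite inE /= /valid (piL fu) (piL fv) uV vV fu fv uv h !eqxx //.
Qed.

End Transversal.

(** * Two deviation bounds for a random independent set *)

Lemma exp_le_1p2x x : 0 <= x <= / 2 -> exp x <= 1 + 2 * x.
Proof.
move=> hx; have h1 := exp_ineq1_le (- x); have e0 := exp_pos x.
have e : exp x * exp (- x) = 1 by rewrite -exp_plus Rplus_opp_r exp_0.
have : exp x * (1 - x) <= 1 by nra.
nra.
Qed.

Lemma exp_pow x n : exp x ^ n = exp (INR n * x).
Proof. by rewrite pow_exp ?ln_exp //; apply: exp_pos. Qed.

Section Colours.
Variables (W : finType) (hadj : rel W).
Hypothesis hadj_sym : forall x y, hadj x y = hadj y x.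
Variables (A X : {set W}).

Local Notation N x := (nbrs hadj x).
Local Notation Z := (Zs hadj 1).

Hypothesis disjX : forall x x' y, x \in X -> x' \in X -> y \in A ->
  hadj x y -> hadj x' y -> x = x'.

Lemma ind_ge0 (b : bool) : 0 <= (if b then 1 else 0).
Proof. by case: b; lra. Qed.

Lemma Z1E F : Z F = \big[Rplus/0]_(T : {set W} | (T \subset F) && independent hadj T) 1.
Proof. by apply: eq_bigr => T _; rewrite pow1. Qed.

(** Fix the set outside [N x] and let [F] be the available part of [N x]. The colour [x] survives
    only if nothing of [F] is chosen, which has probability [1 / Z F], at most [1 / Q] when [F] has
    [kn] vertices. Then take a union bound over [X]. *)
Lemma crowded_colour_bound (kn : nat) (Q : R) : 0 <= Q ->
  (forall x (F : {set W}), x \in X -> F \subset A :&: N x -> (kn <= #|F|)%nat -> Q <= Z F) ->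
  Q * \big[Rplus/0]_(T : {set W} | (T \subset A) && independent hadj T)
     (if [exists x in X, (T :&: N x == set0) && (kn <= #|avail hadj (A :&: N x) T|)%nat]
      then 1 else 0)
   <= INR #|X| * Z A.
Proof.
move=> Q0 hQ.
have one x : x \in X ->
  Q * \big[Rplus/0]_(T : {set W} | (T \subset A) && independent hadj T)
     (if (T :&: N x == set0) && (kn <= #|avail hadj (A :&: N x) T|)%nat then 1 else 0) <= Z A.
  move=> xX; rewrite Z1E !(indep_sum_split hadj_sym _ A (N x)) big_distrr /=.
  apply: Rsum_le => J /andP[sJ iJ]; rewrite -Z1E.
  set F := avail _ _ J.
  have JN : J :&: N x = set0.
    by apply/eqP; rewrite setI_eq0; move: sJ; rewrite subsetD => /andP[].
  have FN : F \subset A :&: N x by apply/subsetP => y; rewrite inE => /andP[].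
  have T0 (T : {set W}) : T \subset F -> ((J :|: T) :&: N x == set0) = (T == set0).
    move=> sT; rewrite setIUl JN set0U (setIidPl _) //.
    by apply: subset_trans (subset_trans sT FN) _; apply: subsetIr.
  rewrite (bigD1 set0) /= ?sub0set ?indep0 // big1 ?Rplus_0_r; last first.
    by move=> T /andP[/andP[sT _] TN]; rewrite T0 // (negPf TN).
  rewrite T0 ?sub0set // setU0 eqxx /= -/F.
  case: ifP => h; first by have := hQ x F xX FN h; lra.
  by have := Zs_ge1 hadj F (lam := 1) ltac:(lra); lra.
have e : INR #|X| * Z A = \big[Rplus/0]_(x in X) Z A by rewrite Rsum_const.
rewrite e.
apply: (Rle_trans _ (\big[Rplus/0]_(x in X) (Q *
  \big[Rplus/0]_(T : {set W} | (T \subset A) && independent hadj T)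
     (if (T :&: N x == set0) && (kn <= #|avail hadj (A :&: N x) T|)%nat then 1 else 0))));
  last exact: Rsum_le.
rewrite -big_distrr /=; apply: Rmult_le_compat_l => //.
rewrite exchange_big /=; apply: Rsum_le => T _.
case: (boolP [exists x in X, _]) => [/exists_inP[x xX hx]|_].
  apply: (Rle_trans _ (if (T :&: N x == set0) && (kn <= #|avail hadj (A :&: N x) T|)%nat
     then 1 else 0)); first by rewrite hx; lra.
  apply: (Rsum_ge_term (F := fun x => if (T :&: N x == set0) &&
     (kn <= #|avail hadj (A :&: N x) T|)%nat then 1 else 0)) => // y _; exact: ind_ge0.
by apply: Rsum_ge0 => x _; apply: ind_ge0.
Qed.

Variables (tau : nat) (c eta : R).
Hypothesis tau1 : (1 <= tau)%nat.
Hypothesis c01 : 0 < c <= 1.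
Hypothesis eta0 : 0 < eta.
Hypothesis dich : forall x (F : {set W}), x \in X -> F \subset A :&: N x ->
  Zlt hadj 1 tau F <= / (2 * c) \/ Zlt hadj 1 tau F <= eta * Z F.

(* Weight of a colour whose neighbourhood meets the random set in [j] vertices; the product over all
   colours is an exponential moment favouring rarely used colours and penalising surviving ones. *)
Let g (j : nat) : R := (if (j < tau)%nat then 1 + c else 1) * (if j == 0%nat then / 2 else 1).

Lemma g_ge0 j : 0 <= g j.
Proof. by rewrite /g; case: ifP => _; case: ifP => _; lra. Qed.

(** Relative to weight 1, small sets add [c * Zlt] and halving the weight of the empty set saves
    [(1 + c) / 2]. In the first case of the dichotomy [c * Zlt <= 1 / 2] is covered by this saving;
    in the second it is at most [c * eta * Z F]. *)
Lemma weight_sum_le x (F : {set W}) : x \in X -> F \subset A :&: N x ->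
  \big[Rplus/0]_(T : {set W} | (T \subset F) && independent hadj T) g #|T| <=
  (1 + c * eta) * Z F.
Proof.
move=> xX sF.
have -> : \big[Rplus/0]_(T : {set W} | (T \subset F) && independent hadj T) g #|T| =
    Z F + c * Zlt hadj 1 tau F - (1 + c) / 2.
  rewrite Z1E /Zlt [X in _ + c * X - _]big_mkcondr /= big_distrr /= -big_split /=.
  rewrite (bigD1 set0) ?sub0set ?indep0 //= [X in _ = X - _](bigD1 set0) ?sub0set ?indep0 //=.
  rewrite cards0 /g tau1 /=.
  set S := (S in _ + S = _); set S' := (S' in _ = _ + S' - _).
  have -> : S = S'; last by rewrite /=; lra.
  apply: eq_bigr => T /andP[_]; rewrite -cards_eq0 => /negPf ->; rewrite pow1.
  by case: ifP => _; ring.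
have Z1 := Zs_ge1 hadj F (lam := 1) ltac:(lra).
case: (dich xX sF) => h.
  have : c * Zlt hadj 1 tau F <= c * / (2 * c) by apply: Rmult_le_compat_l; lra.
  have -> : c * / (2 * c) = / 2 by field; lra.
  have h2 : 0 <= c * eta * Z F by apply: Rmult_le_pos; [nra | lra].
  lra.
have : c * Zlt hadj 1 tau F <= c * (eta * Z F) by apply: Rmult_le_compat_l; lra.
lra.
Qed.

(** By [disjX] the neighbourhoods of different colours are disjoint inside [A]. Once the set outside
    [N x] is fixed, the factors of the other colours are constant, and [weight_sum_le] bounds the
    average of the factor of [x]. *)
Lemma weight_product_le (xs : seq W) : uniq xs -> {subset xs <= X} ->
  \big[Rplus/0]_(T : {set W} | (T \subset A) && independent hadj T)
    \big[Rmult/1]_(x <- xs) g #|T :&: N x| <= (1 + c * eta) ^ size xs * Z A.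
Proof.
elim: xs => [|x xs IH] /=.
  by move=> _ _; rewrite Rmult_1_l Z1E; apply: Rsum_le => T _; rewrite big_nil; lra.
move=> /andP[xxs uxs] sX.
have xX : x \in X by apply: sX; rewrite inE eqxx.
have sX' : {subset xs <= X} by move=> y yxs; apply: sX; rewrite inE yxs orbT.
have h := IH uxs sX'; rewrite Rmult_assoc.
have k0 : 0 <= 1 + c * eta by nra.
apply: Rle_trans (Rmult_le_compat_l _ _ _ k0 h).
rewrite !(indep_sum_split hadj_sym _ A (N x)) big_distrr /=.
apply: Rsum_le => J /andP[sJ iJ]; set F := avail _ _ J.
have JN : J :&: N x = set0.
  by apply/eqP; rewrite setI_eq0; move: sJ; rewrite subsetD => /andP[].
have JA : J \subset A by apply: subset_trans sJ (subsetDl _ _).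
have FN : F \subset A :&: N x by apply/subsetP => y; rewrite inE => /andP[].
have TN (T : {set W}) : T \subset F -> (J :|: T) :&: N x = T.
  move=> sT; rewrite setIUl JN set0U; apply/setIidPl.
  by apply: subset_trans (subset_trans sT FN) _; apply: subsetIr.
have TN' (T : {set W}) y : T \subset F -> y \in xs -> (J :|: T) :&: N y = J :&: N y.
  move=> sT yxs; rewrite setIUl; apply/setUidPl; apply/subsetP => w.
  rewrite inE => /andP[wT]; rewrite inE => yw.
  have := subsetP (subset_trans sT FN) _ wT; rewrite !inE => /andP[wA xw].
  by case/negP: xxs; rewrite (disjX xX (sX' _ yxs) wA xw yw).
pose P := \big[Rmult/1]_(y <- xs) g #|J :&: N y|.
have P0 : 0 <= P.
  by rewrite /P; elim/big_ind: _ => [|a b|y _]; [lra | exact: Rmult_le_pos | exact: g_ge0].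
have eP (T : {set W}) : T \subset F -> \big[Rmult/1]_(y <- xs) g #|(J :|: T) :&: N y| = P.
  by move=> sT; apply: eq_big_seq => y yxs; rewrite TN'.
rewrite (eq_bigr (fun T : {set W} => P * g #|T|)); last first.
  by move=> T /andP[sT _]; rewrite big_cons TN // eP //; ring.
rewrite [X in _ <= _ * X](eq_bigr (fun T : {set W} => P * 1)); last first.
  by move=> T /andP[sT _]; rewrite eP //; ring.
rewrite -!big_distrr /= -Z1E.
have -> : (1 + c * eta) * (P * Z F) = P * ((1 + c * eta) * Z F) by ring.
exact: (Rmult_le_compat_l P _ _ P0 (weight_sum_le xX FN)).
Qed.

Variables (eps3 : R) (dg l : nat).
Hypothesis eta3 : eta <= eps3 / 4.
Hypothesis few : forall T : {set W}, T \subset A -> independent hadj T -> (#|T| <= dg)%nat.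
Hypothesis bigX : INR dg <= (1 - eps3) * INR tau * INR #|X|.
Hypothesis lX : 2 * INR l <= c * eps3 * INR #|X| / 4.

(** Markov's inequality for the product of the weights. At most [dg / tau] colours meet [T] in [tau]
    vertices or more, so at least [eps3 * #|X|] factors contain [1 + c]. If fewer than [l] colours
    survive, fewer than [l] factors contain [1 / 2], and the product is at least [1 / K]. Its mean
    is at most [exp (c * eps3 * #|X| / 4)], so the total exponent is at most [l - 2 l = - l]. *)
Lemma few_colours_bound :
  \big[Rplus/0]_(T : {set W} | (T \subset A) && independent hadj T)
    (if (#|[set x in X | T :&: N x == set0]| < l)%nat then 1 else 0) <= exp (- INR l) * Z A.
Proof.
have wp := weight_product_le (enum_uniq X) (fun x h => etrans (esym (mem_enum X x)) h).
rewrite -cardE in wp.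
set K := exp (INR l - c * eps3 * INR #|X| / 2).
suff low (T : {set W}) : T \subset A -> independent hadj T ->
    (if (#|[set x in X | T :&: N x == set0]| < l)%nat then 1 else 0) <=
    K * \big[Rmult/1]_(x <- enum X) g #|T :&: N x|.
  apply: (Rle_trans _ (K * ((1 + c * eta) ^ #|X| * Z A))).
    apply: Rle_trans (Rmult_le_compat_l K _ _ (Rlt_le _ _ (exp_pos _)) wp).
    by rewrite big_distrr /=; apply: Rsum_le => T /andP[sT iT]; apply: low.
  rewrite -Rmult_assoc; apply: Rmult_le_compat_r.
    by have := Zs_ge1 hadj A (lam := 1) ltac:(lra); lra.
  have h1 : (1 + c * eta) ^ #|X| <= exp (c * eta * INR #|X|).
    by apply: pow_le_exp; nra.
  apply: (Rle_trans _ (K * exp (c * eta * INR #|X|))).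
    by apply: Rmult_le_compat_l => //; left; apply: exp_pos.
  rewrite /K -exp_plus; apply: exp_mono.
  have := pos_INR #|X|.
  have : c * eta * INR #|X| <= c * (eps3 / 4) * INR #|X|.
    by apply: Rmult_le_compat_r; [apply: pos_INR | apply: Rmult_le_compat_l; lra].
  lra.
move=> sT iT; case: ifP => hl; last first.
  apply: Rmult_le_pos; first by left; apply: exp_pos.
  by elim/big_ind: _ => [|a b|y _]; [lra | exact: Rmult_le_pos | exact: g_ge0].
rewrite big_enum /= big_split /= -!big_mkcondr /= !Rprod_const.
set n1 := #|_|; set n2 := #|_|.
have hn2 : (n2 < l)%nat.
  apply: leq_ltn_trans hl; apply: subset_leq_card; apply/subsetP => x.
  by rewrite unfold_in inE cards_eq0.
have hn1 : eps3 * INR #|X| <= INR n1.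
  have hv : (tau * (#|X| - n1) <= dg)%nat.
    apply: leq_trans (few sT iT).
    have -> : (#|X| - n1 = #|[set x in X | (tau <= #|T :&: N x|)%nat]|)%nat.
      rewrite -(cardsID [set x | (tau <= #|T :&: N x|)%nat] X).
      have -> : #|X :\: [set x | (tau <= #|T :&: N x|)%nat]| = n1.
        by apply: eq_card => x; rewrite in_setD inE -ltnNge [RHS]unfold_in andbC.
      by rewrite addnK; apply: eq_card => x; rewrite !inE.
    apply: (@leq_trans (\sum_(x in X) #|T :&: N x|)%nat).
      rewrite (bigID (fun x => tau <= #|T :&: N x|)%nat) /=.
      apply: leq_trans (leq_addr _ _); rewrite mulnC -sum_nat_const.
      rewrite (eq_bigl (fun x => (x \in X) && (tau <= #|T :&: N x|)%nat)); last by move=> x; rewrite inE.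
      by apply: leq_sum => x /andP[].
    rewrite -[X in (_ <= X)%nat]muln1 -sum_nat_const.
    apply: (@leq_trans (\sum_(x in X) \sum_(y in T) (hadj x y))%nat).
      apply: leq_sum => x _; rewrite -big_mkcondr /= sum1_card; apply: subset_leq_card.
      by apply/subsetP => y; rewrite !inE unfold_in.
    rewrite exchange_big /=; apply: leq_sum => y yT.
    rewrite -big_mkcondr /= sum1_card.
    apply/card_le1_eqP => x x'; rewrite !unfold_in => /andP[xX xy] /andP[xX' xy'].
    exact: disjX xX' xX (subsetP sT _ yT) xy' xy.
  have n1X : (n1 <= #|X|)%nat.
    by apply: subset_leq_card; apply/subsetP => z; rewrite unfold_in => /andP[].
  have : INR tau * (INR #|X| - INR n1) <= INR dg.
    by rewrite -minus_INR; [rewrite -mult_INR; apply: INR_leq | lia].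
  have t1 : 1 <= INR tau by apply: (@INR_leq 1).
  move=> h2; have h3 : INR tau * (INR #|X| - INR n1) <= INR tau * ((1 - eps3) * INR #|X|) by lra.
  by have := Rmult_le_reg_l (INR tau) _ _ ltac:(lra) h3; lra.
have p1 : exp (c * eps3 * INR #|X| / 2) <= (1 + c) ^ n1.
  apply: (Rle_trans _ (exp (c / 2) ^ n1)).
    rewrite exp_pow; apply: exp_mono.
    have c2 : 0 <= c / 2 by lra.
    have := Rmult_le_compat_l (c / 2) _ _ c2 hn1; lra.
  apply: pow_incr; split; first by left; apply: exp_pos.
  by have := @exp_le_1p2x (c / 2) ltac:(lra); lra.
have p2 : exp (- INR l) <= (/ 2) ^ n2.
  apply: (Rle_trans _ (exp (Ropp 1) ^ n2)).
    by rewrite exp_pow; apply: exp_mono; have := INR_ltn hn2; lra.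
  apply: pow_incr; split; first by left; apply: exp_pos.
  rewrite exp_Ropp; apply: Rinv_le_contravar; first lra.
  by have := exp_ineq1_le 1; lra.
have e : 1 = K * (exp (c * eps3 * INR #|X| / 2) * exp (- INR l)).
  by rewrite /K -!exp_plus -exp_0; congr exp; lra.
rewrite [X in X <= _]e; apply: Rmult_le_compat_l; first by left; apply: exp_pos.
by apply: Rmult_le_compat => //; left; apply: exp_pos.
Qed.

End Colours.

(** * Colouring a cover from a random independent set *)

Section Cover.
Variables (V W : finType) (adj : rel V) (hadj : rel W) (pi : W -> V).
Hypothesis adj_sym : forall x y, adj x y = adj y x.
Hypothesis hadj_sym : forall x y, hadj x y = hadj y x.
Hypothesis hadj_irr : forall x, hadj x x = false.
Hypothesis hlist : forall x y, pi x = pi y -> x <> y -> hadj x y.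
Hypothesis hedge : forall x y, pi x <> pi y -> hadj x y -> adj (pi x) (pi y).
Hypothesis hmatch : forall x y y', pi x <> pi y -> pi y = pi y' ->
  hadj x y -> hadj x y' -> y = y'.

Definition lst (u : V) : {set W} := [set x | pi x == u].

Definition covering (S : {set W}) := forall u, exists2 x, x \in S & pi x = u.

Lemma indep_inj_pi (S : {set W}) : independent hadj S -> {in S &, injective pi}.
Proof.
move=> /indepP iS x y xS yS e; case: (eqVneq x y) => [//|/eqP xy].
by have := iS x y xS yS; rewrite (hlist e xy).
Qed.

Lemma card_covering (S : {set W}) : independent hadj S -> covering S -> #|S| = #|V|.
Proof.
move=> iS cS; rewrite -(card_in_imset (indep_inj_pi iS)); apply: eq_card => u.
rewrite inE; apply/imsetP; have [x xS <-] := cS u; by exists x.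
Qed.

(** Greedy: since edges between two lists form a matching, each coloured neighbour of [u] blocks at
    most one colour of [u]. *)
Lemma extend_colouring (U : {set V}) (S : {set W}) :
  independent hadj S -> (forall u, u \in U -> exists2 x, x \in S & pi x = u) ->
  (forall u, u \notin U -> (deg adj u < #|lst u|)%nat) ->
  exists2 S' : {set W}, independent hadj S' & covering S'.
Proof.
have [n] := ubnP #|[set u | u \notin pi @: S]|.
elim: n S => // n IH S; rewrite ltnS => cn iS hS hU.
case: (eqVneq [set u | u \notin pi @: S] set0) => [e|/set0Pn[u]].
  exists S => // u; have : u \notin [set u | u \notin pi @: S] by rewrite e inE.
  by rewrite inE negbK => /imsetP[x xS ->]; exists x.
rewrite inE => uS.
have uU : u \notin U.
  by apply: contra uS => /hS[x xS <-]; apply: imset_f.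
have sub : ~~ (lst u \subset \bigcup_(y in S) (lst u :&: nbrs hadj y)).
  apply/negP => /subset_leq_card; apply/negP; rewrite -ltnNge.
  apply: leq_ltn_trans (hU u uU); apply: leq_trans (leq_card_cup _ _) _.
  apply: (@leq_trans (\sum_(y in S) (adj u (pi y)))%nat).
    apply: leq_sum => y yS.
    have piy : pi y <> u by move=> e; case/negP: uS; rewrite -e; apply: imset_f.
    case: (boolP (adj u (pi y))) => /= a.
      apply/card_le1_eqP => x x'; rewrite !inE => /andP[/eqP e h] /andP[/eqP e' h'].
      by apply: (@hmatch y) => //; rewrite ?e ?e'.
    rewrite leqn0 cards_eq0; apply/eqP/setP => x; rewrite !inE; apply/negP => /andP[/eqP e h].
    by case/negP: a; rewrite adj_sym -e; apply: hedge => //; rewrite e.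
  rewrite -big_mkcondr /= sum1_card /deg.
  rewrite -(card_in_imset (f := pi) (D := [pred y in S | adj u (pi y)])); last first.
    by move=> x y; rewrite !inE => /andP[xS _] /andP[yS _]; apply: (indep_inj_pi iS).
  by apply: subset_leq_card; apply/subsetP => _ /imsetP[y /andP[_ h] ->]; rewrite inE.
have /subsetPn[x xu xN] := sub.
have pix : pi x = u by move: xu; rewrite inE => /eqP.
have nx y : y \in S -> ~~ hadj y x.
  move=> yS; apply: contra xN => h; apply/bigcupP; exists y => //.
  by rewrite in_setI xu inE.
have [||||S' iS' cS'] := IH (x |: S); [ | | |exact: hU|by exists S'].
- apply: leq_trans cn; apply: proper_card; apply/properP; split.
    by apply/subsetP => v; rewrite !inE; apply: contra; apply/subsetP/imsetS/subsetUr.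
  by exists u; rewrite !inE // negbK -pix; apply: imset_f; rewrite in_setU1 eqxx.
- apply/indepP => a b; rewrite !in_setU1 => /orP[/eqP->|aS] /orP[/eqP->|bS].
  + by rewrite hadj_irr.
  + by rewrite hadj_sym nx.
  + exact: nx.
  + by move/indepP: iS; apply.
- by move=> v /hS[y yS yv]; exists y => //; rewrite in_setU1 yS orbT.
Qed.

Variables (U : {set V}) (l kn : nat).

Let WU : {set W} := [set x | pi x \in U].

(** If no vertex is bad, the surviving colours of the uncoloured vertices of [U], cut down to lists
    of size [l], meet the hypotheses of [independent_transversal]. *)
Definition bad_vertex (u : V) (I : {set W}) : bool :=
  [&& u \in U, I :&: lst u == set0 &
    (#|avail hadj (lst u) I| < l)%nat ||
    [exists x in avail hadj (lst u) I,
      (kn <= #|avail hadj [set y in WU | hadj x y && (pi y != u)] I|)%nat]].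

(* What [bad_vertex u] becomes for the part of the random set inside the lists of the neighbours of
   [u], once the rest of the random set has been fixed. *)
Definition local_bad (A : {set W}) (u : V) (T : {set W}) : bool :=
  (#|[set x in lst u | T :&: nbrs hadj x == set0]| < l)%nat ||
  [exists x in lst u, (T :&: nbrs hadj x == set0) &&
    (kn <= #|avail hadj (A :&: nbrs hadj x) T|)%nat].

Definition cN (u : V) : {set V} := u |: nbrs adj u.

Lemma cN_sym u v : (u \in cN v) = (v \in cN u).
Proof. by rewrite !inE eq_sym adj_sym. Qed.

Lemma cN_hadj x y : hadj x y -> pi y \in cN (pi x).
Proof.
move=> h; rewrite !inE; case: eqVneq => //= e; apply: hedge => //.
by apply/eqP; rewrite eq_sym.
Qed.

(** Whether [t] is bad depends on the random set only up to distance 2: the neighbours of a colour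
    of [t] sit at distance at most 1, and their survival is decided one step further. As the set is
    resampled on the closed neighbourhood of [u], only vertices within distance 3 are affected. *)
Definition ball3 (u : V) : {set V} := \bigcup_(v in cN u) \bigcup_(w in cN v) cN w.

Lemma card_cN u : (#|cN u| <= (maxdeg adj).+1)%nat.
Proof.
rewrite cardsU1; apply: leq_trans (leq_add (leq_b1 _) (leqnn _)) _.
by rewrite add1n ltnS; apply: leq_maxdeg.
Qed.

Lemma card_ball3 u : (#|ball3 u| <= (maxdeg adj).+1 * ((maxdeg adj).+1 * (maxdeg adj).+1))%nat.
Proof.
have step (F : V -> {set V}) m v : (forall w, (#|F w| <= m)%nat) ->
    (#|\bigcup_(w in cN v) F w| <= (maxdeg adj).+1 * m)%nat.
  move=> hF; apply: leq_trans (leq_card_cup _ _) _.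
  apply: (@leq_trans (\sum_(w in cN v) m)%nat); first exact: leq_sum.
  by rewrite sum_nat_const leq_mul2r card_cN orbT.
by apply: (step) => v; apply: step => w; apply: card_cN.
Qed.

Lemma availU (Y J T : {set W}) :
  (forall x w, x \in Y -> w \in T -> ~~ hadj x w) -> avail hadj Y (J :|: T) = avail hadj Y J.
Proof.
move=> h; apply/setP => x; apply/availP/availP => -[xY hx]; split=> // w.
  by move=> wJ; apply: hx; rewrite inE wJ.
by rewrite inE => /orP[/hx //|]; apply: h.
Qed.

Lemma bad_vertex_local t u (J T : {set W}) : t \notin ball3 u ->
  (forall w, w \in T -> pi w \in cN u) -> bad_vertex t (J :|: T) = bad_vertex t J.
Proof.
move=> tu hT.
have far a w : w \in T -> pi w \in cN a -> a \in cN t -> False.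
  move=> wT wa at_; case/negP: tu; apply/bigcupP; exists (pi w); first exact: hT.
  by apply/bigcupP; exists a; rewrite cN_sym.
have tt : t \in cN t by rewrite !inE eqxx.
have e1 : (J :|: T) :&: lst t = J :&: lst t.
  rewrite setIUl; apply/setUidPl/subsetP => w; rewrite !inE => /andP[wT /eqP e].
  by exfalso; apply: (far t w wT) => //; rewrite e.
have e2 : avail hadj (lst t) (J :|: T) = avail hadj (lst t) J.
  apply: availU => x w; rewrite inE => /eqP e wT; apply/negP => /cN_hadj.
  by rewrite e => /far; apply.
rewrite /bad_vertex e1 e2; do 2 congr (_ && _); congr (_ || _).
apply: eq_existsb => x; case: (boolP (x \in avail hadj (lst t) J)) => //= /availP[xt _].
rewrite availU // => y w; rewrite inE => /and3P[_ xy _] wT; apply/negP => yw.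
move: xt; rewrite inE => /eqP xt.
by apply: (far (pi y) w wT (cN_hadj yw)); rewrite -xt; apply: cN_hadj.
Qed.

Let bad (u : V) : {set {set W}} := [set I | bad_vertex u I].
Let Om : {set {set W}} := [set I : {set W} | (I \subset WU) && independent hadj I].

(** Fix the set [J] outside the closed neighbourhood of [u]. This decides all events of [S], so
    conditioning on avoiding them only restricts [J]. If [u] is uncoloured, the rest [T] lies in the
    available colours [A] of the neighbours of [u], and [hp] bounds the bad choices of [T] by those
    inside [A] alone. *)
Lemma bad_vertex_prob (q : nat) u (S : {set V}) : u \in U ->
  (forall A : {set W}, (forall y, y \in A -> adj u (pi y)) ->
    INR q * \big[Rplus/0]_(T : {set W} | (T \subset A) && independent hadj T)
      (if local_bad A u T then 1 else 0) <= Zs hadj 1 A) ->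
  [disjoint S & ball3 u] ->
  (q * #|bad u :&: avoiding Om bad S| <= #|avoiding Om bad S|)%nat.
Proof.
move=> uU hp dS.
pose G (I : {set W}) := [forall t in S, ~~ bad_vertex t I].
have card1 (P : pred {set W}) : INR #|[set I in Om | P I]| =
   \big[Rplus/0]_(I : {set W} | (I \subset WU) && independent hadj I) (if P I then 1 else 0).
  rewrite -big_mkcondr Rsum_const Rmult_1_r; congr INR.
  by apply: eq_card => I; rewrite in_set [RHS]unfold_in /= in_set.
have e1 : avoiding Om bad S = [set I in Om | G I].
  apply/setP => I; rewrite /avoiding [LHS]in_set [RHS]in_set; congr (_ && _).
  by apply: eq_forallb => t; rewrite inE.
have e2 : bad u :&: avoiding Om bad S = [set I in Om | G I && bad_vertex u I].
  by apply/setP => I; rewrite e1 !in_set andbC -andbA.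
apply: leq_INR; rewrite e2 e1 mult_INR !card1.
pose B : {set W} := [set w | pi w \in cN u].
rewrite !(indep_sum_split hadj_sym _ WU B) big_distrr /=.
apply: Rsum_le => J /andP[sJ iJ].
set X := avail _ _ J.
have XB w : w \in X -> (w \in WU) && (pi w \in cN u).
  by case/availP; rewrite in_setI => /andP[-> ]; rewrite inE.
have JB w : w \in J -> pi w \notin cN u.
  by move/(subsetP sJ); rewrite in_setD inE => /andP[].
have eG (T : {set W}) : T \subset X -> G (J :|: T) = G J.
  move=> /subsetP sT; apply: eq_forallb => t; case: (boolP (t \in S)) => //= tS.
  rewrite (bad_vertex_local (u := u)) //.
    by move: dS; rewrite disjoint_subset => /subsetP/(_ t tS).
  by move=> w /sT/XB/andP[].
case: (boolP (G J)) => GJ; last first.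
  rewrite big1; last by move=> T /andP[sT _]; rewrite eG // (negPf GJ).
  by rewrite Rmult_0_r; apply: Rsum_ge0 => T _; apply: ind_ge0.
pose A : {set W} := [set y in X | adj u (pi y)].
have sAX : A \subset X by apply/subsetP => y; rewrite inE => /andP[].
have hA y : y \in A -> adj u (pi y) by rewrite inE => /andP[].
apply: Rle_trans (Rle_trans _ _ _ (hp A hA) _).
  apply: Rmult_le_compat_l; first exact: pos_INR.
  rewrite -!big_mkcondr /=; apply: Rsum_subset => T; first by lra.
  move=> /andP[/andP[sT iT]]; rewrite eG // GJ /= => /and3P[_ /eqP bl bd].
  have TL w : w \in T -> pi w != u.
    move=> wT; apply/negP => wu; have : w \in (J :|: T) :&: lst u by rewrite !inE wT wu orbT.
    by rewrite bl inE.
  have sTA : T \subset A.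
    apply/subsetP => w wT; rewrite inE (subsetP sT) //=.
    have /andP[_] := XB w (subsetP sT w wT).
    by rewrite !inE (negPf (TL w wT)).
  rewrite sTA iT /=.
  have JL x w : x \in lst u -> w \in J -> ~~ hadj x w.
    rewrite inE => /eqP xu /JB; rewrite -xu; exact/contra/cN_hadj.
  have avE x : x \in lst u -> (x \in avail hadj (lst u) (J :|: T)) = (T :&: nbrs hadj x == set0).
    move=> xu; apply/availP/eqP => [[_ h]|h].
      apply/setP => w; rewrite !inE; apply/negP => /andP[wT].
      by have := h w; rewrite in_setU wT orbT => /(_ isT)/negP.
    split=> // w; rewrite in_setU => /orP[|wT]; first exact: JL.
    apply/negP => xw; have : w \in T :&: nbrs hadj x by rewrite !inE wT.
    by rewrite h inE.
  case/orP: bd => [bd|/exists_inP[x xav bd]]; apply/orP; [left|right].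
    apply: leq_ltn_trans bd; apply: subset_leq_card; apply/subsetP => x.
    by rewrite inE => /andP[xu h]; rewrite avE.
  have /availP[xu _] := xav.
  apply/exists_inP; exists x => //; rewrite -avE // xav /=.
  apply: leq_trans bd _; apply: subset_leq_card; apply/subsetP => y.
  move=> /availP[]; rewrite !inE => /and3P[yU xy yu] hy.
  have uy : adj u (pi y).
    move: xu; rewrite inE => /eqP xu; rewrite -xu; apply: hedge => //.
    by rewrite xu => e; rewrite -e eqxx in yu.
  rewrite uy xy yU (negPf yu) /= !andbT; apply/andP; split; apply/forall_inP => w wJ;
    by apply: hy; rewrite in_setU wJ ?orbT.
rewrite Z1E; apply: (Rle_trans _ (\big[Rplus/0]_(T : {set W} |
   (T \subset X) && independent hadj T) 1)).
  apply: Rsum_subset => T; first by lra.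
  by move=> /andP[sT ->]; rewrite (subset_trans sT sAX).
by apply: Rsum_le => T /andP[sT _]; rewrite eG // GJ; lra.
Qed.

Hypothesis l1 : (1 < l)%nat.
Hypothesis lkn : (16 * kn <= l)%nat.

Lemma colouring_of_good_set (I : {set W}) : I \in Om -> (forall u, ~~ bad_vertex u I) ->
  exists2 S : {set W}, independent hadj S &
    forall u, u \in U -> exists2 x, x \in S & pi x = u.
Proof.
rewrite inE => /andP[sI /indepP iI] good.
pose V0 := [set u in U | I :&: lst u == set0].
have lists u : exists L : {set W}, [/\ L \subset avail hadj (lst u) I & u \in V0 -> #|L| = l].
  case: (boolP (u \in V0)) => uV; last by exists set0; rewrite sub0set; split.
  have : (0 < binomial.binomial #|avail hadj (lst u) I| l)%nat.
    rewrite bin_gt0 leqNgt; apply: contra (good u) => h.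
    by move: uV; rewrite inE /bad_vertex => /andP[-> ->]; rewrite h.
  rewrite -cards_draws => /card_gt0P[L]; rewrite inE => /andP[sL /eqP cL].
  by exists L.
have [L hL] := fin_all_exists lists.
have Lav u x : x \in L u -> pi x = u /\ forall w, w \in I -> ~~ hadj x w.
  by case: (hL u) => /subsetP s _ /s /availP[]; rewrite inE => /eqP.
have [|||R [R1 R2 R3 R4]] := @independent_transversal _ _ hadj pi hadj_sym V0 L l kn l1 lkn.
- by move=> u x /Lav[].
- by move=> u; case: (hL u).
- move=> x xL xV; rewrite leqNgt; apply: contra (good (pi x)) => h.
  have [sL _] := hL (pi x); have xa := subsetP sL _ xL.
  move: (xV); rewrite inE /bad_vertex => /andP[-> ->] /=.
  apply/orP; right; apply/exists_inP; exists x => //.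
  apply: leq_trans (ltnW h) _; apply: subset_leq_card; apply/subsetP => y.
  rewrite inE => /and5P[_ yV _ yL /andP[xy hxy]].
  apply/availP; split; last by case: (Lav _ _ yL).
  by rewrite !inE hxy eq_sym xy; move: yV; rewrite inE => /andP[->].
exists (I :|: R).
  have IR x y : x \in I -> y \in R -> ~~ hadj y x.
    by move=> xI /R1[_ /Lav[_]]; apply.
  apply/indepP => x y; rewrite !in_setU => /orP[xI|xR] /orP[yI|yR].
  - exact: iI.
  - by rewrite hadj_sym IR.
  - exact: IR.
  - case: (eqVneq (pi x) (pi y)) => e; last exact: R4.
    by rewrite (R3 x y) // hadj_irr.
move=> u uU; case: (boolP (u \in V0)) => [/R2[x xR e]|].
  by exists x => //; rewrite inE xR orbT.
rewrite inE uU /= => /set0Pn[x]; rewrite !inE => /andP[xI /eqP e].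
by exists x => //; rewrite inE xI.
Qed.

Lemma cover_colouring (q : nat) :
  (4 * ((maxdeg adj).+1 * ((maxdeg adj).+1 * (maxdeg adj).+1)) <= q)%nat ->
  (forall u (A : {set W}), u \in U -> (forall y, y \in A -> adj u (pi y)) ->
    INR q * \big[Rplus/0]_(T : {set W} | (T \subset A) && independent hadj T)
      (if local_bad A u T then 1 else 0) <= Zs hadj 1 A) ->
  (forall u, u \notin U -> (deg adj u < #|lst u|)%nat) ->
  exists S : {set W}, independent hadj S /\ #|S| = #|V|.
Proof.
move=> hq hp hU.
have [|||||I IOm Igood] := @lopsided_local_lemma _ _ Om bad ball3 q
  ((maxdeg adj).+1 * ((maxdeg adj).+1 * (maxdeg adj).+1)).
- by apply/card_gt0P; exists set0; rewrite inE sub0set indep0.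
- exact: card_ball3.
- by apply: leq_trans hq; lia.
- exact: hq.
- move=> u S dS; case: (boolP (u \in U)) => uU.
    by apply: bad_vertex_prob => // A hA; apply: hp.
  rewrite (_ : bad u = set0) ?set0I ?cards0 ?muln0 //.
  by apply/setP => I; rewrite !inE /bad_vertex (negPf uU).
have [|S iS cS] := colouring_of_good_set IOm; first by move=> u; have := Igood u; rewrite inE.
have [S' iS' cS'] := extend_colouring iS cS hU.
by exists S'; split=> //; apply: card_covering.
Qed.

End Cover.

(** * Local list sizes *)

Section LocalBad.
Variables (V W : finType) (adj : rel V) (hadj : rel W) (pi : W -> V).
Hypothesis adj_sym : forall x y, adj x y = adj y x.
Hypothesis adj_irr : forall x, adj x x = false.
Hypothesis hadj_sym : forall x y, hadj x y = hadj y x.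
Hypothesis hadj_irr : forall x, hadj x x = false.
Hypothesis hlist : forall x y, pi x = pi y -> x <> y -> hadj x y.
Hypothesis hedge : forall x y, pi x <> pi y -> hadj x y -> adj (pi x) (pi y).
Hypothesis hmatch : forall x y y', pi x <> pi y -> pi y = pi y' ->
  hadj x y -> hadj x y' -> y = y'.
Variables (u : V) (A : {set W}) (r : nat).
Hypothesis hA : forall y, y \in A -> adj u (pi y).
Hypothesis hr : forall F : {set V}, F \subset nbrs adj u -> graph_omega adj r F.

Let Nu y : y \in A -> pi y <> u.
Proof. by move=> /hA h e; rewrite e adj_irr in h. Qed.

(** The edges from [x] into each other list are a matching, so [pi] is injective on the neighbours
    of [x] in [A] and maps cliques there to cliques among the neighbours of [u]. *)
Lemma list_nbrs_graph_omega x (F : {set W}) :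
  x \in lst pi u -> F \subset A :&: nbrs hadj x -> graph_omega hadj r F.
Proof.
rewrite inE => /eqP xu /subsetP sF; split=> // S /subsetP sS /cliqueP cS.
have SA y : y \in S -> y \in A /\ hadj x y.
  by move=> /sS/sF; rewrite !inE => /andP[].
have inj : {in S &, injective pi}.
  move=> y y' /SA[yA xy] /SA[y'A xy'] e.
  by apply: (hmatch (x := x)) => //; rewrite xu => e'; apply: (Nu yA).
have sub : pi @: S \subset nbrs adj u.
  by apply/subsetP => _ /imsetP[y /SA[/hA h _] ->]; rewrite inE.
have [_ _ h] := hr sub.
rewrite -(card_in_imset inj); apply: h => //.
apply/cliqueP => _ _ /imsetP[y yS ->] /imsetP[y' y'S ->] ne.
apply: hedge; first by apply/eqP.
by apply: cS => //; apply: contra ne => /eqP ->.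
Qed.

Lemma local_bad_bound (kn l tau : nat) (Q c eta eps3 : R) :
  0 < Q ->
  (forall F : {set W}, graph_omega hadj r F -> (kn <= #|F|)%nat -> Q <= Zs hadj 1 F) ->
  (1 <= tau)%nat -> 0 < c <= 1 -> 0 < eta -> eta <= eps3 / 4 ->
  (forall F : {set W}, graph_omega hadj r F ->
    Zlt hadj 1 tau F <= / (2 * c) \/ Zlt hadj 1 tau F <= eta * Zs hadj 1 F) ->
  INR (deg adj u) <= (1 - eps3) * INR tau * INR #|lst pi u| ->
  2 * INR l <= c * eps3 * INR #|lst pi u| / 4 ->
  \big[Rplus/0]_(T : {set W} | (T \subset A) && independent hadj T)
    (if local_bad hadj pi l kn A u T then 1 else 0)
  <= (exp (- INR l) + INR #|lst pi u| / Q) * Zs hadj 1 A.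
Proof.
move=> Q0 hQ tau1 c01 eta0 eta3 dich hX hl.
have disjX x x' y : x \in lst pi u -> x' \in lst pi u -> y \in A ->
    hadj x y -> hadj x' y -> x = x'.
  rewrite !inE => /eqP xu /eqP x'u yA xy x'y.
  apply: (hmatch (x := y)); rewrite ?xu ?x'u //; [exact: Nu | |]; by rewrite hadj_sym.
have few (T : {set W}) : T \subset A -> independent hadj T -> (#|T| <= deg adj u)%nat.
  move=> /subsetP sT iT; rewrite -(card_in_imset (indep_inj_pi hlist iT)).
  by apply: subset_leq_card; apply/subsetP => _ /imsetP[y /sT/hA h ->]; rewrite inE.
have b1 := few_colours_bound hadj_sym disjX tau1 c01 eta0
  (fun x F xX sF => dich F (list_nbrs_graph_omega xX sF)) eta3 few hX hl.
have b2 := crowded_colour_bound hadj_sym (Rlt_le _ _ Q0)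
  (fun x F xX sF => hQ F (list_nbrs_graph_omega xX sF)).
have {}b2 : \big[Rplus/0]_(T : {set W} | (T \subset A) && independent hadj T)
     (if [exists x in lst pi u, (T :&: nbrs hadj x == set0) &&
       (kn <= #|avail hadj (A :&: nbrs hadj x) T|)%nat]
      then 1 else 0) <= INR #|lst pi u| / Q * Zs hadj 1 A.
  apply: (Rmult_le_reg_l Q) => //; apply: Rle_trans b2 _.
  by apply: Req_le; field; lra.
rewrite Rmult_plus_distr_r; apply: Rle_trans (Rplus_le_compat _ _ _ _ b1 b2).
rewrite -big_split /=; apply: Rsum_le => T _; rewrite /local_bad.
have orb_le (a b : bool) :
    (if a || b then 1 else 0) <= (if a then 1 else 0) + (if b then 1 else 0).
  by case: a; case: b => /=; lra.
exact: orb_le.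
Qed.

End LocalBad.

(** The local lemma allows each vertex failure probability [1 / (4 (D + 1)^3)]. The second condition
    keeps the chance of too few surviving colours below half of this. The third does the same for
    crowded colours, after a union bound over at most [D] colours. *)
Definition large_k (k : R) (D r : nat) :=
  [/\ 1 <= k, ln (8 * INR D ^ 4) <= k &
    forall (W : finType) (hadj : rel W) (F : {set W}), graph_omega hadj r F -> k <= INR #|F| ->
      8 * INR D * (INR D + 1) ^ 3 <= Zs hadj 1 F].

Lemma dichotomy_rates eps : 0 < eps < / 2 -> evt (fun D => forall r t, (2 <= r)%nat ->
  is_rate t D r ->
  exists tau, [/\ (1 <= tau)%nat, (1 - eps) * t <= INR tau &
    forall (V : finType) (adj : rel V) (A : {set V}), graph_omega adj r A ->
      Zlt adj 1 tau A <= eps * D / ln D \/ Zlt adj 1 tau A <= eps * Zs adj 1 A]).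
Proof.
move=> he; have l0 : 0 < 1 by lra.
apply: evt_mono (evt_and (dichotomyA l0 he) (dichotomyB l0 he)) => D [hA hB] r t r2.
by case=> ->; [apply: hA | apply: hB].
Qed.

Lemma graph_omega_le (V : finType) (adj : rel V) (A : {set V}) r r' :
  (r <= r')%nat -> graph_omega adj r A -> graph_omega adj r' A.
Proof. by move=> hr [h1 h2 h3]; split=> // S sS cS; apply: leq_trans hr; apply: h3. Qed.

Lemma local_cover_colouring eps : 0 < eps ->
  exists (delta0 : R) (D0 : nat), 1 <= delta0 /\
  forall (V : finType) (adj : rel V) (om : V -> nat) (k : R),
    simple_graph adj -> clique_bounded adj om -> (D0 <= maxdeg adj)%nat ->
    large_k k (maxdeg adj) (omega_max om).-1 ->
    forall (W : finType) (hadj : rel W) (L : V -> {set W}),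
      is_cover adj hadj L ->
      (forall u : V, (deg adj u < #|L u|)%nat \/
         exists d t, [/\ INR (deg adj u) <= d, delta0 * k <= d, is_rate t (d / k) (om u).-1 &
           (1 + eps) * (d / t) <= INR #|L u|]) ->
      cover_colourable V hadj.
Proof.
move=> eps0.
pose e0 := Rmin eps 1.
have e00 : 0 < e0 by apply: Rmin_glb_lt; lra.
have e01 : e0 <= 1 by apply: Rmin_r.
have e0e : e0 <= eps by apply: Rmin_l.
(* The value 512 comes from [2 * l = 32 * kn <= 64 * k]: below, [c * #|L u|] is at least
   [k / (2 * e)], so [c * eps3 * #|L u| / 4] is at least [64 * k]. *)
pose eps3 := e0 / 4; pose e := eps3 / 512.
have he : 0 < e < / 2 by rewrite /e /eps3; lra.
have he0 : 0 < e by lra.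
have [a ha] := evt_and (evt_and (dichotomy_rates he) rate_bounds)
  (evt_and (evt_ln_le he0) (evt_and (evt_ge 1) (evt_comp to_infty_ln (evt_ge 1)))).
have [D0 hD0] := evt_nat (evt_ge 8).
exists (Rmax a 1), D0; split; first exact: Rmax_r.
move=> V adj om k sg cb hD [k1 kL kF] W hadj L cov hu.
have [adj_sym adj_irr] := sg.
have [[hadj_sym hadj_irr] [cov1 [cov2 [cov3 [cov4 cov5]]]]] := cov.
have [pi hpi] := fin_all_exists cov1.
have piL u x : x \in L u -> pi x = u.
  move=> xu; case: (eqVneq (pi x) u) => [//|/eqP ne].
  have := cov2 _ _ ne; rewrite disjoint_subset => /subsetP/(_ _ (hpi x)).
  by rewrite inE xu.
have lstL u : lst pi u = L u.
  by apply/setP => x; rewrite inE; apply/eqP/idP => [<-|/piL].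
have hlist x y : pi x = pi y -> x <> y -> hadj x y.
  by move=> exy; apply: (cov3 (pi x)) => //; rewrite exy.
have hedge x y : pi x <> pi y -> hadj x y -> adj (pi x) (pi y).
  by move=> ne; apply: cov4.
have hmatch x y y' : pi x <> pi y -> pi y = pi y' -> hadj x y -> hadj x y' -> y = y'.
  move=> ne eyy xy; apply: (cov5 (pi x) (pi y)) => //; first exact: hedge.
  by rewrite eyy.
have [s [s1 s2]] := nat_below (y := k) ltac:(lra).
pose kn := s.+1; pose l := (16 * kn)%nat.
have hkn : k <= INR kn <= 2 * k by rewrite S_INR; lra.
set D := maxdeg adj in hD kL kF.
have D8 := hD0 _ hD.
pose U := [set u | (#|L u| <= deg adj u)%nat].
have hl : INR l = 16 * INR kn by rewrite mult_INR /=; lra.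
have expl : exp (- INR l) <= / (8 * INR D ^ 4).
  have p4 : 0 < INR D ^ 4 by apply: pow_lt; lra.
  rewrite -[8 * _]exp_ln; last lra.
  by rewrite -exp_Ropp; apply: exp_mono; lra.
have [||||S [iS cS]] := @cover_colouring V W adj hadj pi adj_sym hadj_sym hadj_irr hlist hedge hmatch
   U l kn _ _ (4 * (D.+1 * (D.+1 * D.+1))) (leqnn _).
- by rewrite /l /kn; lia.
- by rewrite /l.
- move=> u B uU hB.
  have cX : INR #|lst pi u| <= INR D.
    rewrite lstL; apply: INR_leq; apply: leq_trans (leq_maxdeg adj u).
    by move: uU; rewrite inE.
  have om3 := proj1 cb u.
  case: (hu u) => [h|[d [t [hd dk ht hL]]]]; first by move: uU; rewrite inE leqNgt h.
  have kd : k <= d by have := Rmax_r a 1; nra.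
  have Dk : Rmax a 1 <= d / k.
    apply: (Rmult_le_reg_r k); first lra.
    have -> : d / k * k = d by field; lra.
    by [].
  have [[hdich hrate] [hln [_ l1]]] := ha (d / k) ltac:(have := Rmax_l a 1; lra).
  have om2 : (2 <= (om u).-1)%nat by lia.
  have [tau [tau1 htau dich]] := hdich _ _ om2 ht.
  have [t0 tl] := hrate _ _ om2 ht.
  have Dk0 : 1 <= d / k by have := Rmax_r a 1; lra.
  pose rk := d / k / ln (d / k).
  have R1 : 1 <= e * rk.
    apply: (Rmult_le_reg_r (ln (d / k))); first lra.
    have -> : e * rk * ln (d / k) = e * (d / k) by rewrite /rk; field; lra.
    by rewrite Rmult_1_l.
  have R0 : 0 < rk by nra.
  (* Then [/ (2 * c)] is the first threshold of the dichotomy at [d / k]. *)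
  pose c := / (2 * (e * rk)).
  have c0 : 0 < c by apply: Rinv_0_lt_compat; lra.
  have c1 : c <= 1.
    by rewrite -Rinv_1; apply: Rinv_le_contravar; lra.
  have ic : / (2 * c) = e * (d / k) / ln (d / k).
    rewrite /c /rk; field; repeat split; try lra.
  have XR : k * rk <= INR #|lst pi u|.
    rewrite lstL; apply: Rle_trans hL.
    have -> : k * rk = d * / ln (d / k) by rewrite /rk; field; lra.
    have : d * / ln (d / k) <= d * / t.
      by apply: Rmult_le_compat_l; [lra | apply: Rinv_le_contravar].
    have : 0 <= d * / t by apply: Rmult_le_pos; [lra | left; apply: Rinv_0_lt_compat].
    rewrite /Rdiv; nra.
  have D0' := pos_INR D.
  pose Q := 8 * INR D * (INR D + 1) ^ 3.
  have D13 : 0 < (INR D + 1) ^ 3 by apply: pow_lt; lra.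
  have Q0 : 0 < Q by rewrite /Q; nra.
  have omu : (om u <= omega_max om)%nat by apply: (leq_bigmax (F := om)).
  have main : \big[Rplus/0]_(T : {set W} | (T \subset B) && independent hadj T)
      (if local_bad hadj pi l kn B u T then 1 else 0)
      <= (exp (- INR l) + INR #|lst pi u| / Q) * Zs hadj 1 B.
    apply: (@local_bad_bound V W adj hadj pi adj_irr hadj_sym hadj_irr hlist hedge hmatch u B
      (om u).-1 hB (fun F sF => nbrs_graph_omega sg cb (leqnn _) sF) kn l tau Q c e eps3) => //;
      [ | by rewrite /e /eps3; lra | | | ].
    - move=> F gF kF'; apply: kF; first by apply: graph_omega_le gF; lia.
      by have := INR_leq kF'; lra.
    - by move=> F gF; rewrite ic; apply: dich.
    - rewrite lstL; have t1 : 0 <= INR tau by apply: pos_INR.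
      have h1 : (1 + eps) * d <= t * INR #|L u|.
        have := Rmult_le_compat_l t _ _ (Rlt_le _ _ t0) hL.
        by have -> : t * ((1 + eps) * (d / t)) = (1 + eps) * d by field; lra.
      have X0 := pos_INR #|L u|.
      have h2 : (1 - e) * t * INR #|L u| <= INR tau * INR #|L u| by apply: Rmult_le_compat_r.
      have h3 : (1 - e) * ((1 + eps) * d) <= (1 - e) * (t * INR #|L u|).
        by apply: Rmult_le_compat_l; lra.
      have h4 : d <= (1 - eps3) * ((1 - e) * ((1 + eps) * d)).
        have : 1 <= (1 - eps3) * ((1 - e) * (1 + eps)).
          apply: (Rle_trans _ ((1 - eps3) * ((1 - e) * (1 + e0)))); last first.
            by rewrite /e /eps3; apply: Rmult_le_compat_l; [lra | apply: Rmult_le_compat_l; lra].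
          by rewrite /e /eps3; nra.
        nra.
      have h5 : (1 - eps3) * ((1 - e) * ((1 + eps) * d)) <= (1 - eps3) * (INR tau * INR #|L u|).
        by apply: Rmult_le_compat_l; [rewrite /eps3; lra | lra].
      lra.
    - have h1 : c * (k * rk) <= c * INR #|lst pi u| by apply: Rmult_le_compat_l; lra.
      have h2 : c * (k * rk) = k / (2 * e) by rewrite /c; field; lra.
      have h3 : k / (2 * e) * eps3 = 256 * k by rewrite /e; field; rewrite /eps3; lra.
      have h4 : c * (k * rk) * eps3 <= c * INR #|lst pi u| * eps3.
        by apply: Rmult_le_compat_r; [rewrite /eps3 | ]; lra.
      rewrite h2 h3 in h4; rewrite hl; lra.
  have eq : INR (4 * (D.+1 * (D.+1 * D.+1))) = 4 * (INR D + 1) ^ 3.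
    by rewrite !mult_INR !S_INR /=; ring.
  rewrite eq; apply: Rle_trans (Rmult_le_compat_l _ _ _ _ main) _; first lra.
  rewrite -Rmult_assoc -[X in _ <= X]Rmult_1_l; apply: Rmult_le_compat_r.
    by have := Zs_ge1 hadj B (lam := 1) ltac:(lra); lra.
  have h1 : INR #|lst pi u| / Q <= / (8 * (INR D + 1) ^ 3).
    apply: (Rle_trans _ (INR D / Q)).
      by apply: Rmult_le_compat_r => //; left; apply: Rinv_0_lt_compat.
    by apply: Req_le; rewrite /Q; field; split; lra.
  have h2 : 4 * (INR D + 1) ^ 3 * / (8 * (INR D + 1) ^ 3) = / 2 by field; lra.
  have h3 : 4 * (INR D + 1) ^ 3 * / (8 * INR D ^ 4) <= / 2.
    have p4' : 0 < INR D ^ 4 by apply: pow_lt; lra.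
    have p4 : 0 < 8 * INR D ^ 4 by lra.
    apply: (Rmult_le_reg_r (8 * INR D ^ 4)) => //.
    rewrite Rmult_assoc Rinv_l; last lra.
    have h4 : (INR D + 1) ^ 3 <= (2 * INR D) ^ 3 by apply: pow_incr; lra.
    have h5 : (2 * INR D) ^ 3 <= INR D ^ 4.
      have -> : (2 * INR D) ^ 3 = 8 * INR D ^ 3 by ring.
      have -> : INR D ^ 4 = INR D * INR D ^ 3 by ring.
      by apply: Rmult_le_compat_r => //; apply: pow_le; lra.
    lra.
  have h6 : 4 * (INR D + 1) ^ 3 * exp (- INR l) <= / 2.
    apply: Rle_trans h3; apply: Rmult_le_compat_l; lra.
  have h7 : 4 * (INR D + 1) ^ 3 * (INR #|lst pi u| / Q) <= / 2.
    rewrite -h2; apply: Rmult_le_compat_l; lra.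
  lra.
- by move=> u; rewrite inE -ltnNge lstL.
by exists S.
Qed.

(** * The parameter k *)

Lemma to_infty_pow4 : to_infty (fun x => 8 * x ^ 4).
Proof.
move=> c; exists (Rmax c 1) => x hx; have h1 := Rmax_l c 1; have h2 := Rmax_r c 1.
have h3 : 1 <= x ^ 3 by apply: pow_R1_Rle; lra.
have -> : 8 * x ^ 4 = 8 * (x * x ^ 3) by ring.
nra.
Qed.

Lemma exp_sqrt_lower L : 0 <= L -> L <= exp (sqrt (2 * L)).
Proof.
move=> L0; set z := sqrt (2 * L).
have z2 : z * z = 2 * L by apply: sqrt_sqrt; lra.
have z0 : 0 <= z by apply: sqrt_pos.
have h := exp_ineq1_le (z / 4).
have -> : exp z = (exp (z / 4) * exp (z / 4)) * (exp (z / 4) * exp (z / 4)).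
  by rewrite -!exp_plus; congr exp; lra.
have h1 : z <= exp (z / 4) * exp (z / 4).
  have : (1 + z / 4) * (1 + z / 4) <= exp (z / 4) * exp (z / 4).
    by apply: Rmult_le_compat; lra.
  have := Rle_0_sqr (1 - z / 4); rewrite /Rsqr; lra.
have : z * z <= (exp (z / 4) * exp (z / 4)) * (exp (z / 4) * exp (z / 4)).
  by apply: Rmult_le_compat.
lra.
Qed.

Lemma exp2_ge4 : 4 <= exp 2.
Proof.
have h := exp_ineq1_le 1; have -> : 2 = 1 + 1 by lra.
rewrite exp_plus; nra.
Qed.

(** The target [8 D (D + 1)^3 <= 64 D^4] has logarithm at most [ln 8 + L <= 11/10 * L]. For the
    first term of the minimum, Ramsey's theorem gives an independent set of about [exp 2 * L]
    vertices, whose subsets suffice. For the second, [11/40 * 4 * (1 + eps) * L >= 11/10 * L]. *)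
Lemma kpar_large eps : 0 < eps -> exists D0 : nat, forall D om : nat,
  (D0 <= D)%nat -> (3 <= om)%nat -> large_k (kpar eps (INR D) om) D om.-1.
Proof.
move=> eps0; have l0 : 0 < 1 by lra.
have [N0 HN0] := Zs_lower_bound l0.
have ev : evt (fun x => let L := ln (8 * x ^ 4) in
    1 <= x /\ 1 <= L /\ ln 8 <= / 10 * L /\ N0 ^ 2 <= 2 * L).
  apply: evt_and (evt_ge 1) _.
  apply: (evt_comp (to_infty_comp to_infty_ln to_infty_pow4)
    (P := fun L => 1 <= L /\ ln 8 <= / 10 * L /\ N0 ^ 2 <= 2 * L)).
  exists (Rmax 1 (Rmax (10 * ln 8) (N0 ^ 2))) => L hL.
  have h1 := Rmax_l 1 (Rmax (10 * ln 8) (N0 ^ 2)).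
  have h2 := Rmax_r 1 (Rmax (10 * ln 8) (N0 ^ 2)).
  have h3 := Rmax_l (10 * ln 8) (N0 ^ 2).
  have h4 := Rmax_r (10 * ln 8) (N0 ^ 2).
  lra.
have [D0 hD0] := evt_nat ev.
exists D0 => D om /hD0 {hD0} [D1 [L1 [L8 LN]]] om3.
rewrite /kpar; set L := ln (8 * INR D ^ 4) in L1 L8 LN *.
have r2 : (2 <= om.-1)%nat by lia.
have -> : (om - 1)%nat = om.-1 by lia.
rewrite -(INR_pred_om om3); set r := om.-1 in r2 *.
have rho := ln_nat_ge2 r2.
have e4 := exp2_ge4.
have eL : 4 * L <= exp 2 * L by apply: Rmult_le_compat_r; lra.
set S := 4 * ln (INR r) * ((1 + eps) * L).
have S2 : 2 * L <= S.
  have : L <= (1 + eps) * L by nra.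
  rewrite /S => h.
  have : 2 * L <= 4 * ln (INR r) * L by nra.
  have : 4 * ln (INR r) * L <= 4 * ln (INR r) * ((1 + eps) * L).
    by apply: Rmult_le_compat_l; lra.
  lra.
have kL : L <= Rmin ((exp 2 * L) ^ r) (exp (sqrt S)).
  apply: Rmin_glb.
    apply: (Rle_trans _ ((exp 2 * L) ^ 1)); first by rewrite pow_1; lra.
    by apply: Rle_pow; [lra | lia].
  apply: Rle_trans (exp_sqrt_lower _) _; first lra.
  by apply: exp_mono; apply: sqrt_le_1_alt.
split=> // [|W hadj F [hs hi ho] hk]; first lra.
have Z1 := Zs_ge1 hadj F (lam := 1) ltac:(lra).
suff lnZ : 11 / 10 * L <= ln (Zs hadj 1 F).
  have D4 : 0 < 8 * INR D ^ 4 by have : 0 < INR D ^ 4 by [apply: pow_lt; lra]; lra.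
  have h : 8 * (8 * INR D ^ 4) <= Zs hadj 1 F.
    apply: ln_reg; [lra | lra |].
    by rewrite ln_mult -/L; lra.
  apply: Rle_trans h.
  have h4 : (INR D + 1) ^ 3 <= (2 * INR D) ^ 3 by apply: pow_incr; lra.
  have h5 : INR D * (INR D + 1) ^ 3 <= INR D * (2 * INR D) ^ 3 by apply: Rmult_le_compat_l; lra.
  have -> : 8 * (8 * INR D ^ 4) = 8 * (INR D * (2 * INR D) ^ 3) by ring.
  lra.
have : (exp 2 * L) ^ r <= INR #|F| \/ exp (sqrt S) <= INR #|F|.
  by move: hk; rewrite /Rmin; case: Rle_dec => _; [left | right].
case=> hF.
  have [I [sI iI cI]] := ramsey hs hi ho.
  have I0 := pos_INR #|I|.
  have hI : exp 2 * L <= INR #|I| + 1.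
    apply: Rnot_lt_le => lt.
    have h : (INR #|I| + 1) ^ r <= (exp 2 * L) ^ r by apply: pow_incr; lra.
    have : INR #|F| < INR (expn #|I|.+1 r) by apply: INR_ltn.
    have -> : INR (expn #|I|.+1 r) = (INR #|I| + 1) ^ r.
      by rewrite -S_INR; elim: (r) => [|n IH] //=; rewrite expnS mult_INR IH.
    lra.
  have := Zs_ge_indep (lam := 1) ltac:(lra) sI iI.
  move/(ln_mono (pow_lt (1 + 1) #|I| ltac:(lra))).
  rewrite ln_pow_nat; last lra.
  have := ln_lt_2; have -> : 1 + 1 = 2 by lra.
  move=> h2 h; nra.
have F0 : 0 < INR #|F| by have := exp_pos (sqrt S); lra.
have s0 := sqrt_pos S.
have hln : sqrt S <= ln (INR #|F|).
  by rewrite -[sqrt S]ln_exp; apply: ln_mono => //; apply: exp_pos.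
have S22 : S <= ln (INR #|F|) ^ 2.
  rewrite -{1}(sqrt_sqrt S) /=; last lra.
  by rewrite Rmult_1_r; apply: Rmult_le_compat.
have hN : N0 <= ln (INR #|F|).
  apply: Rnot_lt_le => lt.
  have : ln (INR #|F|) ^ 2 < N0 ^ 2 by rewrite /= !Rmult_1_r; apply: Rmult_le_0_lt_compat; lra.
  lra.
have := HN0 W hadj r F hs hi r2 ho hN.
apply: Rle_trans.
apply: (Rmult_le_reg_r (ln (INR r))); first lra.
have -> : 11 / 40 * ln (INR #|F|) ^ 2 / ln (INR r) * ln (INR r) = 11 / 40 * ln (INR #|F|) ^ 2.
  by field; lra.
have : 11 / 40 * S <= 11 / 40 * ln (INR #|F|) ^ 2 by lra.
rewrite /S; have : 0 <= ln (INR r) * (eps * L).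
  by apply: Rmult_le_pos; [lra | apply: Rmult_le_pos; lra].
lra.
Qed.

Lemma omega_max_ge (V : finType) (adj : rel V) (om : V -> nat) : clique_bounded adj om ->
  (1 <= maxdeg adj)%nat -> (3 <= omega_max om)%nat.
Proof.
move=> cb hD; case: (pickP (mem [set: V])) => [v _|h].
  by apply: leq_trans (proj1 cb v) _; apply: (leq_bigmax (F := om)).
by move: hD; rewrite /maxdeg big_pred0 // => v; have := h v; rewrite /= in_setT.
Qed.

Lemma gA_rate om d k : (3 <= om)%nat -> 1 < ln (d / k) -> gA (INR om) d k = d / tA (d / k) om.-1.
Proof.
move=> om3 l1; have [ll [lr r2]] := rate_numerics (r := om.-1) l1 ltac:(lia).
rewrite /gA /tA; rewrite INR_pred_om // in r2 *.
by field; lra.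
Qed.

Lemma gB_rate om d k : (3 <= om)%nat -> 1 < ln (d / k) -> gB (INR om) d k = d / tB (d / k) om.-1.
Proof.
move=> om3 l1; have [ll [lr r2]] := rate_numerics (r := om.-1) l1 ltac:(lia).
rewrite /gB /tB; rewrite INR_pred_om // in r2 lr *.
have s1 := sqrt_lt_R0 _ lr; have s2 : 0 < sqrt (ln (d / k)) by apply: sqrt_lt_R0; lra.
rewrite !sqrt_div_alt //; last lra.
by field; lra.
Qed.

Lemma cover_colouring_local eps : 0 < eps ->
  exists (delta0 : R) (D0 : nat),
  forall (V : finType) (adj : rel V) (om : V -> nat),
    simple_graph adj -> clique_bounded adj om -> (D0 <= maxdeg adj)%nat ->
    let k := kpar eps (INR (maxdeg adj)) (omega_max om) in
    let delta := delta0 * k in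
    forall (W : finType) (hadj : rel W) (L : V -> {set W}),
      is_cover adj hadj L ->
      (forall u : V,
        Rmin ((1 + eps) * Rmax (gA (INR (om u)) (INR (deg adj u)) k) (gA (INR (om u)) delta k))
             ((1 + eps) * Rmax (gB (INR (om u)) (INR (deg adj u)) k) (gB (INR (om u)) delta k))
          <= INR #|L u|) ->
      cover_colourable V hadj.
Proof.
move=> eps0; have [d1 [D1 [d11 hcore]]] := local_cover_colouring eps0.
have [D2 hk] := kpar_large eps0.
have [a ha] := to_infty_ln 2.
pose d0 := Rmax d1 a.
have d0d1 : d1 <= d0 by apply: Rmax_l.
have d0a : a <= d0 by apply: Rmax_r.
exists d0, (maxn (maxn D1 D2) 1) => V adj om sg cb.
rewrite !geq_max => /andP[/andP[hD1 hD2] hD] k delta W hadj L cov hL.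
have lk := hk _ _ hD2 (omega_max_ge cb hD); rewrite -/k in lk.
have [k1 _ _] := lk.
apply: (hcore V adj om k sg cb hD1 lk W hadj L cov) => u; right.
have om3 := proj1 cb u.
pose d := Rmax (INR (deg adj u)) delta.
have dd : INR (deg adj u) <= d by apply: Rmax_l.
have ddel : delta <= d by apply: Rmax_r.
have dk : d0 * k <= d by [].
have l2 : 2 <= ln (d / k).
  apply: ha; apply: (Rmult_le_reg_r k); first lra.
  have -> : d / k * k = d by field; lra.
  by nra.
have gmax f : f d <= Rmax (f (INR (deg adj u))) (f delta).
  by rewrite /d {1}/Rmax; case: Rle_dec => _; [apply: Rmax_r | apply: Rmax_l].
have hA := gmax (fun d => gA (INR (om u)) d k).
have hB := gmax (fun d => gB (INR (om u)) d k).
rewrite gA_rate // in hA; last lra.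
rewrite gB_rate // in hB; last lra.
move: (hL u); rewrite /Rmin; case: Rle_dec => _ h.
  exists d, (tA (d / k) (om u).-1); split=> //; [by nra | by left |].
  by apply: Rle_trans h; apply: Rmult_le_compat_l; lra.
exists d, (tB (d / k) (om u).-1); split=> //; [by nra | by right |].
by apply: Rle_trans h; apply: Rmult_le_compat_l; lra.
Qed.

Definition chi_c_bound (om : nat) (D : R) : R :=
  Rmin (fA (INR om) D) (5 * D * sqrt (ln (INR om - 1) / ln D)).

(* If the first alternative fails then [z := sqrt (log (om-1) / log D) < 1/5] or the bound [fA] is
   the smaller one; since [log k <= (4 + o(1)) z log D], [D / k] is a positive power of [D].  This is
   where the constant 5 comes from. *)
Lemma chi_c_bound_rate e delta1 : 0 < e <= 1 -> 1 <= delta1 ->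
  evt (fun D => forall om k, (3 <= om)%nat -> 1 <= k -> k <= kpar (e / 100) D om ->
    D <= chi_c_bound om D /\ 1 <= e * D \/
    exists t, [/\ is_rate t (D / k) om.-1, delta1 * k <= D &
      (1 + e / 100) * (D / t) + 1 <= (1 + e) * chi_c_bound om D]).
Proof.
move=> he hdel; have ec : 0 < e / 8 by lra.
have c2 : 0 < (e / 2000) ^ 2 / 2 by have : 0 < (e / 2000) ^ 2 by [apply: pow_lt; lra]; lra.
have ev : evt (fun l => [/\ 8 <= l, ln 8 <= 4 / 100 * l, ln delta1 <= 19 / 100 * l,
    ln l <= (e / 2000) ^ 2 / 2 * l & 4 <= ln l]).
  have h := evt_and (evt_ln_le c2) (to_infty_ln 4).
  have := evt_and (evt_and (evt_ge 8) (evt_ge (25 * ln 8))) (evt_and (evt_ge (100 / 19 * ln delta1)) h).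
  by apply: evt_mono => l [[h1 h2] [h3 [h4 h5]]]; split; lra.
apply: evt_mono (evt_and (evt_ln_le ec) (evt_comp to_infty_ln ev)) => D [hD [l8 hln8 hdl hll ll4]].
move=> om k om3 k1 hk.
set l := ln D in hD l8 hln8 hdl hll ll4 *.
have D0 : 0 < D by apply: Rnot_le_lt => /ln_nonpos h; rewrite -/l in h; lra.
have om2 : (2 <= om.-1)%nat by lia.
have r2 : 2 <= INR om.-1 by apply: (@INR_leq 2).
have lr := ln_nat_ge2 om2.
rewrite /kpar in hk; set L := ln (8 * D ^ 4) in hk.
have eomm : (om - 1)%nat = om.-1 by lia.
rewrite eomm -(INR_pred_om om3) in hk.
have eL : L = ln 8 + 4 * l.
  rewrite /L ln_mult; [|lra|exact: pow_lt].
  by rewrite ln_pow_nat // -/l /=; lra.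
have L0 : 0 < L by have := ln_lt_2; have : ln 2 <= ln 8 by [apply: ln_mono; lra]; lra.
have hk1 := Rle_trans _ _ _ hk (Rmin_l _ _).
have hk2 := Rle_trans _ _ _ hk (Rmin_r _ _).
rewrite /chi_c_bound -(INR_pred_om om3).
have eDl : 8 <= e * (D / l).
  apply: (Rmult_le_reg_r l); first lra.
  have -> : e * (D / l) * l = e * D by field; lra.
  lra.
have fAE : fA (INR om) D = (INR om.-1 - 1) * ln l * (D / l).
  by rewrite /fA INR_pred_om // -/l; field; lra.
set rho := ln (INR om.-1) in lr hk2 *.
set z := sqrt (rho / l).
have rl0 : 0 < rho / l by apply: Rdiv_lt_0_compat; lra.
have z0 : 0 < z by apply: sqrt_lt_R0.
have z2 : z * z * l = rho by rewrite /z sqrt_sqrt; [field; lra | lra].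
have lnDk : ln (D / k) = l - ln k by rewrite ln_div //; lra.
have Dk0 : 0 < D / k by apply: Rdiv_lt_0_compat; lra.
have lnk0 : 0 <= ln k by rewrite -ln_1; apply: ln_mono; lra.
have bigD : ln k <= 81 / 100 * l -> delta1 * k <= D.
  move=> h; apply: ln_reg => //; first nra.
  by rewrite ln_mult -/l; lra.
rewrite {1 2}/Rmin; case: Rle_dec => hmin; last first.
  (* If [5 * z >= 1] the bound is at least [D] and greedy colouring will do. *)
  case: (Rle_lt_dec 1 (5 * z)) => h5.
    by left; split; [nra | nra].
  right.
  have lnk : ln k <= 404 / 100 * z * l.
    have : ln k <= sqrt (4 * rho * ((1 + e / 100) * L)).
      by rewrite -[sqrt _]ln_exp; apply: ln_mono => //; lra.
    have -> : 404 / 100 * z * l = sqrt ((404 / 100 * z * l) * (404 / 100 * z * l)).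
      by rewrite sqrt_square //; apply: Rmult_le_pos; lra.
    move=> h; apply: Rle_trans h _; apply: sqrt_le_1_alt.
    have -> : 404 / 100 * z * l * (404 / 100 * z * l) = (404 / 100) * (404 / 100) * l * (z * z * l).
      by ring.
    rewrite z2.
    have h1 : (1 + e / 100) * L <= 404 / 100 * (101 / 100 * l) by nra.
    have : rho * ((1 + e / 100) * L) <= rho * (404 / 100 * (101 / 100 * l)).
      by apply: Rmult_le_compat_l; lra.
    lra.
  (* By [z < 1/5]. Hence [ln (D / k) >= 0.192 * l], and since [0.438^2 < 0.192] the rate at [D / k]
     is at least [0.219 / z]. As [1 / 0.219 < 4.57], the constant 5 leaves room for the factor
     [1 + e / 100] and the added 1. *)
  have lnk' : ln k <= 808 / 1000 * l by nra.
  have m0 : 192 / 1000 * l <= ln (D / k) by lra.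
  exists (tB (D / k) om.-1); split; [by right | by apply: bigD; lra |].
  have ht : 219 / 1000 / z <= tB (D / k) om.-1.
    rewrite /tB -/rho.
    have : 438 / 1000 / z <= sqrt (ln (D / k) / rho).
      rewrite -[X in X <= _](sqrt_square); last by left; apply: Rdiv_lt_0_compat; lra.
      apply: sqrt_le_1_alt; apply: (Rmult_le_reg_r rho); first lra.
      have -> : ln (D / k) / rho * rho = ln (D / k) by field; lra.
      have -> : 438 / 1000 / z * (438 / 1000 / z) * rho = 438 / 1000 * (438 / 1000) * l.
        by rewrite -z2; field; lra.
      lra.
    have -> : 219 / 1000 / z = / 2 * (438 / 1000 / z) by field; lra.
    lra.
  have z219 : 0 < 219 / 1000 / z by apply: Rdiv_lt_0_compat; lra.
  have hDt : D / tB (D / k) om.-1 <= D * z * (1000 / 219).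
    have -> : D * z * (1000 / 219) = D / (219 / 1000 / z) by field; lra.
    by apply: Rmult_le_compat_l; [lra | apply: Rinv_le_contravar].
  have Dz : 8 <= D * z.
    have zl : / l <= z.
      have il : 0 < / l by apply: Rinv_0_lt_compat; lra.
      rewrite -[X in X <= _](sqrt_square); last lra.
      apply: sqrt_le_1_alt; rewrite /Rdiv; apply: Rmult_le_compat_r; first lra.
      by apply: (Rle_trans _ (/ 8)); [apply: Rinv_le_contravar; lra | lra].
    have := Rmult_le_compat_l D _ _ (Rlt_le _ _ D0) zl; rewrite -/(D / l).
    have : 0 < D / l by apply: Rdiv_lt_0_compat; lra.
    nra.
  nra.
right.
(* With [rr = om - 2], [hmin] says [rr * ln l <= 5 * z * l]. As [z^2 * l = rho <= rr], it gives
   [rr <= 25 * l], so [rho = O(ln l)] and [z] is tiny. Ramsey's term in [kpar] then gives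
   [ln k <= 4 * rr * ln l <= 20 * z * l], a negligible part of [l], so replacing [D] by [D / k] in
   the logarithms costs only a factor close to 1. *)
rewrite fAE in hmin *.
set rr := INR om.-1 - 1 in hmin *.
have rr1 : 1 <= rr by rewrite /rr; lra.
have hmin' : rr * ln l <= 5 * z * l.
  apply: (Rmult_le_reg_r (D / l)); first by apply: Rdiv_lt_0_compat; lra.
  by have -> : 5 * z * l * (D / l) = 5 * D * z by field; lra.
have lnk4 : ln k <= 4 * (rr * ln l).
  have h1 : ln k <= INR om.-1 * ln (exp 2 * L).
    rewrite -ln_pow_nat; last by apply: Rmult_lt_0_compat => //; apply: exp_pos.
    by apply: ln_mono; lra.
  have h2 : ln (exp 2 * L) <= 2 * ln l.
    rewrite ln_mult ?ln_exp //; last exact: exp_pos.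
    have : ln L <= ln (exp 2 * l).
      apply: ln_mono => //.
      have e5 : 5 <= exp 2.
        have e1 := exp_ineq1_le (1 / 2).
        have -> : exp 2 = exp (1 / 2) ^ 4 by rewrite exp_pow; congr exp; rewrite /=; lra.
        apply: (Rle_trans _ ((3 / 2) ^ 4)); first by rewrite /=; lra.
        by apply: pow_incr; lra.
      have : 5 * l <= exp 2 * l by apply: Rmult_le_compat_r; lra.
      lra.
    rewrite ln_mult ?ln_exp; [lra | exact: exp_pos | lra].
  have h3 : INR om.-1 * ln (exp 2 * L) <= INR om.-1 * (2 * ln l) by apply: Rmult_le_compat_l; lra.
  have h4 : INR om.-1 * (2 * ln l) <= 2 * rr * (2 * ln l).
    by apply: Rmult_le_compat_r; rewrite /rr; lra.
  lra.
have rho_rr : rho <= rr by apply: ln_le_sub1; lra.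
have sq : rr * ln l * (rr * ln l) <= 25 * l * rho.
  have -> : 25 * l * rho = 5 * z * l * (5 * z * l) by rewrite -z2; ring.
  by apply: Rmult_le_compat => //; nra.
have rr25 : rr <= 25 * l.
  have h : rr * rr <= rr * ln l * (rr * ln l).
    have -> : rr * ln l * (rr * ln l) = rr * rr * (ln l * ln l) by ring.
    rewrite -[X in X <= _]Rmult_1_r; apply: Rmult_le_compat_l; nra.
  have h2 : 25 * l * rho <= 25 * l * rr by apply: Rmult_le_compat_l; lra.
  apply: (Rmult_le_reg_r rr); lra.
have rho_ll : rho <= 2 * ln l.
  have h : rho <= ln (exp 4 * l).
    apply: ln_mono; first lra.
    have e26 : 26 <= exp 4.
      have e1 := exp_ineq1_le (1 / 3).
      have -> : exp 4 = exp (1 / 3) ^ 12 by rewrite exp_pow; congr exp; rewrite /=; lra.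
      apply: (Rle_trans _ ((4 / 3) ^ 12)); first by rewrite /=; lra.
      by apply: pow_incr; lra.
    rewrite /rr in rr25; nra.
  by rewrite ln_mult ?ln_exp in h; [lra | exact: exp_pos | lra].
have zsmall : 20 * z <= e / 100.
  have : z * z <= (e / 2000) * (e / 2000).
    apply: (Rmult_le_reg_r l); first lra.
    have e2 : (e / 2000) ^ 2 / 2 * l = (e / 2000 * (e / 2000) * l) / 2 by field.
    rewrite z2; lra.
  move=> h; apply: Rnot_lt_le => lt.
  have : e / 2000 * (e / 2000) < z * z by apply: Rmult_le_0_lt_compat; lra.
  lra.
have lnk : ln k <= e / 100 * l.
  have : 20 * z * l <= e / 100 * l by apply: Rmult_le_compat_r; lra.
  lra.
have lnk' : ln k <= / 100 * l by nra.
exists (tA (D / k) om.-1); split; [by left | by apply: bigD; lra |].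
set m := ln (D / k).
have m1 : (1 - e / 100) * l <= m by rewrite /m lnDk; lra.
have m2 : m <= l by rewrite /m lnDk; lra.
have m3 : 1 < m by rewrite /m lnDk; lra.
have lnm : 0 < ln m <= ln l.
  split; [by rewrite -ln_1; apply: ln_increasing; lra | by apply: ln_mono; lra].
have hDt : D / tA (D / k) om.-1 = rr * ln m * D / m.
  by rewrite /tA -/m -/rr; field; lra.
pose Y := rr * ln l * (D / l).
have hY : (1 - e / 100) * (D / tA (D / k) om.-1) <= Y.
  rewrite hDt; apply: (Rmult_le_reg_r (m * l)); first by apply: Rmult_lt_0_compat; lra.
  have -> : (1 - e / 100) * (rr * ln m * D / m) * (m * l) = rr * D * (ln m * ((1 - e / 100) * l)).
    by field; lra.
  have -> : Y * (m * l) = rr * D * (ln l * m) by rewrite /Y; field; lra.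
  apply: Rmult_le_compat_l; first nra.
  by apply: Rmult_le_compat; nra.
have Y4 : 4 * (D / l) <= Y.
  have dl : 0 < D / l by apply: Rdiv_lt_0_compat; lra.
  by rewrite /Y; apply: Rmult_le_compat_r; nra.
rewrite -/Y; set Z := D / tA _ _ in hY *.
have eY : 32 <= e * Y by nra.
have h1 : (1 - e / 100) * ((1 + e / 100) * Z) <= (1 + e / 100) * Y.
  have := Rmult_le_compat_l (1 + e / 100) _ _ ltac:(lra) hY; lra.
have h2 : (1 + e / 100) * Y <= (1 - e / 100) * ((1 + e / 2) * Y).
  have : (1 + e / 100) <= (1 - e / 100) * (1 + e / 2) by nra.
  nra.
have h3 : (1 + e / 100) * Z <= (1 + e / 2) * Y.
  by apply: (Rmult_le_reg_l (1 - e / 100)); lra.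
lra.
Qed.

Lemma nat_floor y : 0 < y -> exists s : nat, INR s <= y < INR s + 1.
Proof.
move=> /nat_below[s [s1 [s2|s2]]]; first by exists s; lra.
by exists s.+1; rewrite S_INR; lra.
Qed.

Lemma chi_c_bound_gt0 om D : (3 <= om)%nat -> 1 < ln D -> 0 < chi_c_bound om D.
Proof.
move=> om3 l1; have [ll [lr r2]] := rate_numerics (r := om.-1) l1 ltac:(lia).
rewrite INR_pred_om // in r2 lr.
have D0 : 0 < D by apply: Rnot_le_lt => /ln_nonpos; lra.
apply: Rmin_glb_lt.
  apply: Rmult_lt_0_compat; first lra; apply: Rdiv_lt_0_compat; last lra.
  exact: Rmult_lt_0_compat.
apply: Rmult_lt_0_compat; first lra; apply: sqrt_lt_R0; apply: Rdiv_lt_0_compat; lra.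
Qed.

Lemma chi_c_upper_bound eps : 0 < eps ->
  exists D0 : nat,
  forall (V : finType) (adj : rel V) (om : V -> nat),
    simple_graph adj -> clique_bounded adj om -> (D0 <= maxdeg adj)%nat ->
    forall k : nat, is_chi_c adj k ->
      INR k <= (1 + eps) * chi_c_bound (omega_max om) (INR (maxdeg adj)).
Proof.
move=> eps0; pose e := Rmin eps 1.
have e0 : 0 < e <= 1 by split; [apply: Rmin_glb_lt; lra | apply: Rmin_r].
have eeps : e <= eps by apply: Rmin_l.
have e100 : 0 < e / 100 by lra.
have [d1 [D1 [d11 hcore]]] := local_cover_colouring e100.
have [D2 hk] := kpar_large e100.
have [D3 hD3] := evt_nat (evt_and (evt_comp to_infty_ln (evt_ge 2)) (chi_c_bound_rate e0 d11)).
exists (maxn (maxn D1 D2) (maxn D3 1)) => V adj om sg cb.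
rewrite !geq_max => /andP[/andP[hD1 hD2] /andP[hD hD4]] k [_ kmin].
set om' := omega_max om; set D := maxdeg adj in hD1 hD2 hD hD4 *.
have om3 : (3 <= om')%nat by apply: omega_max_ge cb hD4.
have cb' : clique_bounded adj (fun=> om').
  have omu u : (om u <= om')%nat by apply: (leq_bigmax (F := om)).
  by split=> [u //|u S uS cS]; apply: leq_trans (proj2 cb u S uS cS) (omu u).
pose kk := kpar (e / 100) (INR D) om'.
have lk := hk _ _ hD2 om3; have [k1 _ _] := lk; rewrite -/kk in k1 lk.
have DR : 1 <= INR D by apply: (@INR_leq 1).
set X := chi_c_bound om' (INR D).
have [l2 hrate] := hD3 _ hD.
have X0 : 0 < X by apply: chi_c_bound_gt0 => //; lra.
have y0 : 0 < (1 + e) * X by apply: Rmult_lt_0_compat; lra.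
(* The added 1 in [chi_c_bound_rate] pays for rounding down to a whole number of colours; in its
   greedy alternative, [1 <= e * D] gives [K > D]. *)
have [K [K1 K2]] := nat_floor y0.
suff allK : all_k_covers_colourable adj K by have := INR_leq (kmin K allK); nra.
move=> W hadj L cov hL.
apply: (hcore V adj (fun=> om') kk sg cb' hD1 _ W hadj L cov) => [|u].
  suff -> : omega_max (fun _ : V => om') = om' by [].
  apply/eqP; rewrite eqn_leq; apply/andP; split; first exact/bigmax_leqP.
  rewrite {1}/om' {1}/omega_max; apply/bigmax_leqP => v _.
  apply: leq_trans (leq_bigmax (F := fun=> om') v).
  exact: (leq_bigmax (F := om) v).
rewrite hL; have dD : INR (deg adj u) <= INR D by apply: INR_leq; apply: leq_maxdeg.
have [[h1 h2]|[t [ht hdk hX]]] := hrate om' kk om3 k1 (Rle_refl _).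
  rewrite -/X in h1; left; have : INR D < INR K by nra.
  by move=> h; apply: leq_ltn_trans (leq_maxdeg adj u) _; rewrite ltnNge; apply/negP => /INR_leq; rewrite -/D; lra.
by rewrite -/X in hX; right; exists (INR D), t; split=> //; lra.
Qed.

Theorem mainTheorem16 :
  (* (1) occupancy fraction lower bound; o(1) depends only on lam and Delta *)
  (forall (lam eps : R), 0 < lam -> 0 < eps ->
    exists D0 : nat,
    forall (V : finType) (adj : rel V) (om : V -> nat),
      simple_graph adj -> clique_bounded adj om -> (D0 <= maxdeg adj)%nat ->
      (1 - eps) * bound1 (INR (maxdeg adj)) (INR (omega_max om))
        <= / INR #|V| * (lam * ZG' adj lam / ZG adj lam))
  /\
  (* (2) local fractional colouring *)
  (forall eps : R, 0 < eps ->
    exists delta0 : R,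
    forall (V : finType) (adj : rel V) (om : V -> nat),
      simple_graph adj -> clique_bounded adj om ->
      exists w : {set V} -> list (R * R),
        frac_colouring adj w /\
        forall (u : V) (x : R), colour_of w u x ->
          0 <= x < Rmin
            ((1 + eps) * Rmax (fA (INR (om u)) (INR (deg adj u))) (fA (INR (om u)) delta0))
            ((1 + eps) * Rmax (fB (INR (om u)) (INR (deg adj u))) (fB (INR (om u)) delta0)))
  /\
  (* (2') chi_f bound as Delta -> oo *)
  (forall eps : R, 0 < eps ->
    exists D0 : nat,
    forall (V : finType) (adj : rel V) (om : V -> nat),
      simple_graph adj -> clique_bounded adj om -> (D0 <= maxdeg adj)%nat ->
      forall r : R, is_chi_f adj r ->
        r <= (1 + eps) * Rmin (fA (INR (omega_max om)) (INR (maxdeg adj)))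
                              (fB (INR (omega_max om)) (INR (maxdeg adj))))
  /\
  (* (3) local correspondence colouring *)
  (forall eps : R, 0 < eps ->
    exists (delta0 : R) (D0 : nat),
    forall (V : finType) (adj : rel V) (om : V -> nat),
      simple_graph adj -> clique_bounded adj om -> (D0 <= maxdeg adj)%nat ->
      let k := kpar eps (INR (maxdeg adj)) (omega_max om) in
      let delta := delta0 * k in
      forall (W : finType) (hadj : rel W) (L : V -> {set W}),
        is_cover adj hadj L ->
        (forall u : V,
          Rmin ((1 + eps) * Rmax (gA (INR (om u)) (INR (deg adj u)) k) (gA (INR (om u)) delta k))
               ((1 + eps) * Rmax (gB (INR (om u)) (INR (deg adj u)) k) (gB (INR (om u)) delta k))
            <= INR #|L u|) ->
        cover_colourable V hadj)
  /\
  (* (3') chi_c bound as Delta -> oo *)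
  (forall eps : R, 0 < eps ->
    exists D0 : nat,
    forall (V : finType) (adj : rel V) (om : V -> nat),
      simple_graph adj -> clique_bounded adj om -> (D0 <= maxdeg adj)%nat ->
      forall k : nat, is_chi_c adj k ->
        INR k <= (1 + eps) *
          Rmin (fA (INR (omega_max om)) (INR (maxdeg adj)))
               (5 * INR (maxdeg adj) * sqrt (ln (INR (omega_max om) - 1) / ln (INR (maxdeg adj))))).
Proof.
split; first exact: occupancy_lower_bound.
split; last split; last split; [ | exact: frac_colouring_max | exact: cover_colouring_local
  | exact: chi_c_upper_bound].
move=> eps eps0; have [d0 hd0] := local_frac_colouring eps0.
exists d0 => V adj om sg cb.
pose d u := Rmax (INR (deg adj u)) d0.
have [|w [hw hx]] := hd0 V adj om d sg cb.
  by move=> u; split; [apply: Rmax_l | apply: Rmax_r].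
exists w; split=> // u x ux; have [x0 xlt] := hx u x ux.
split=> //; apply: Rlt_le_trans xlt _.
have gmax f : f (d u) <= Rmax (f (INR (deg adj u))) (f d0).
  by rewrite /d {1}/Rmax; case: Rle_dec => _; [apply: Rmax_r | apply: Rmax_l].
apply: Rmin_glb; apply: Rmult_le_compat_l; try lra.
  exact: Rle_trans (Rmin_l _ _) (gmax _).
exact: Rle_trans (Rmin_r _ _) (gmax _).
Qed.
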